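(* Let $\alpha(x)$ be a positive sub-polynomial such that $$\lim_{x\to+\infty}\frac{|\alpha(x)-p(x)|}{(\log x)^m}=+\infty\quad\text{for all }m>0,\ p\in\mathbb{R}[x],$$ and let $\mathcal{P}\subseteq\mathbb{N}$ be the set of prime numbers. Suppose that $A,B\subseteq\mathcal{P}$ satisfy $$\overline{d}_{\mathcal{P}}(A,B):=\limsup_{N\to\infty}\frac{\min(|A\cap[1,N]|,|B\cap[1,N]|)}{|\mathcal{P}\cap[1,N]|}>0.$$ Then there exist arbitrarily large $x\in A$, $y\in B$ and some $n\in\mathbb{N}$ such that $x+y=\lfloor\alpha(n)\rfloor$.
   Context: $\mathbb{N}=\{1,2,\dots\}$. Let $\mathcal{G}$ be the ring (under pointwise addition and multiplication) of germs at $+\infty$ of continuous real-valued functions defined on half-lines $(a,+\infty)$; two functions have the same germ if they agree for all sufficiently large $x$. A Hardy field is a subfield of $\mathcal{G}$ closed under differentiation (each element is eventually differentiable and its derivative's germ lies in the field). A sub-polynomial is a function $\alpha$ whose germ belongs to some Hardy field and which satisfies $\lim_{x\to+\infty}\alpha(x)/x^l=0$ for some $l>0$. Functions and germs are not distinguished; when values $\alpha(n)$, $n\in\mathbb{N}$, appear, $\alpha$ denotes a fixed real-valued representative defined on $[1,+\infty)$. The conclusion means: for every $K$ there are $x\in A$, $y\in B$ with $x,y\geq K$ and $n\in\mathbb{N}$ with $x+y=\lfloor\alpha(n)\rfloor$. *)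

(* Defs.v *)
From HB Require Import structures.
From mathcomp Require Import all_boot all_order all_algebra finmap.
From mathcomp Require Import all_classical all_reals all_analysis.

Set Implicit Arguments.
Unset Strict Implicit.
Unset Printing Implicit Defensive.

Import Order.TTheory GRing.Theory Num.Theory.
Import numFieldNormedType.Exports.

Local Open Scope classical_set_scope.
Local Open Scope ring_scope.

Definition same_germ (R : realType) (f g : R -> R) : Prop :=
  \forall x \near +oo, f x = g x.

(* A germ at +oo of a function defined on a half-line is represented by any
   total function R -> R having that germ (its values off the half-line are
   irrelevant), and a set of germs by the set of all representatives of its
   members, i.e. by a set of functions that is saturated for same_germ. *)
Record hardy_field (R : realType) (H : set (R -> R)) : Prop := HardyField {
  hardy_saturated : forall f g, same_germ f g -> H f -> H g;
  hardy_continuous : forall f, H f -> \forall x \near +oo, {for x, continuous f};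
  hardy0 : H (fun=> 0);
  hardy1 : H (fun=> 1);
  hardyN : forall f, H f -> H (fun x => - f x);
  hardyD : forall f g, H f -> H g -> H (fun x => f x + g x);
  hardyM : forall f g, H f -> H g -> H (fun x => f x * g x);
  hardyV : forall f, H f -> ~ same_germ f (fun=> 0) ->
    exists2 g, H g & same_germ (fun x => f x * g x) (fun=> 1);
  hardy_derivable : forall f, H f -> \forall x \near +oo, derivable f x 1;
  hardy_derive : forall f, H f -> H (derive1 f)
}.

Definition sub_polynomial (R : realType) (alpha : R -> R) : Prop :=
  (exists2 H : set (R -> R), hardy_field H & H alpha) /\
  (exists2 l : R, 0 < l & alpha x / x `^ l @[x --> +oo] --> (0 : R)).

Definition primes_set : set nat := [set p | prime p].

(* |A /\ [1, N]| *)
Definition count_upto (A : set nat) (N : nat) : nat :=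
  #|` fset_set (A `&` [set n | (1 <= n <= N)%N]) |.

(* The limsup is taken in the extended reals, so it needs no boundedness side
   condition; the terms N = 0, 1, with zero denominator, do not affect it. *)
Definition upper_density_primes (R : realType) (A B : set nat) : \bar R :=
  limn_esup (fun N : nat =>
    ((minn (count_upto A N) (count_upto B N))%:R /
     (count_upto primes_set N)%:R : R)%:E).

(* Main.v *)
Require Import Defs.
From mathcomp Require Import all_boot all_order all_algebra finmap.
From mathcomp Require Import all_classical all_reals all_analysis.
From mathcomp Require Import ring lra zify.

Set Implicit Arguments.
Unset Strict Implicit.
Unset Printing Implicit Defensive.

Import Order.TTheory GRing.Theory Num.Theory.
Import numFieldNormedType.Exports.

Local Open Scope classical_set_scope.
Local Open Scope ring_scope.

(** The primes enter only through Chebyshev's bound pi(N) >> N / log N, so that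
    A and B have N / (log N)^O(1) elements below suitable large N. By pigeonhole
    some short blocks of A and of B are still that dense, and a sum of the two
    blocks lies in the range of alpha on a short window [M, M + L) with
    L = M / (log M)^O(1). The circle method on a cyclic group reduces solving
    x + y = floor (alpha n) there to a saving of a power of log M in
    \sum_n e(beta alpha(M + n)) for 0 < beta <= (log M)^O(1), and only for beta
    a multiple r / P, where P is about alpha(M + L) - alpha(M). If r is at most
    a power of log M, alpha is close to linear on the window, and the sum is
    almost a sum over full periods. For larger beta the Weyl-van der Corput test
    of order j applies, where j is the first order for which
    beta |alpha^(j)(M)| is small: comparing consecutive derivatives shows that
    beta |alpha^(j)(M)| L^j is then still large. The comparison takes place in a
    Hardy field containing x and log x, where any two functions are eventually
    ordered: if x^j |alpha^(j)(x)| were at most a power of log x, integrating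
    j times would put alpha within a power of log x of a polynomial. *)

(** * Exponential sums *)

Section ExponentialSums.
Context {R : realType}.
Implicit Types (f g c s : nat -> R) (N n : nat).

(** Every loss is a power of one parameter Y = ln Mt, where [alpha] passes 2N between Mt and Mt + 1.
    Y has to be fixed before the blocks, whose length depends on it, whereas the start M of the
    window is known only after the pigeonhole has picked the blocks. Hence the estimates at M are
    stated for any Y with ln M <= Y <= (ln M)^2; the upper bound comes from the monotonicity of
    [alpha] / log^6. Rounding spoils the transform of floor (alpha n) at all but small frequencies.
    So the values are counted on a grid of mesh 1/G, modulo GP, where G is a power of Y: at r <=
    Y^18 P the rounding of G alpha is harmless, and higher frequencies are damped by thickening A
    and B to intervals of the grid. The blocks have at least P / Y^7 elements, which a saving of Y^9
    in the exponential sums beats; the thickening has about Y^26 points because its tail costs Y^18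
    and the density another Y^7. *)

Definition diff f : nat -> R := fun n => f n.+1 - f n.

Definition monotone_upto N f : Prop :=
  (forall n, (n < N)%N -> f n <= f n.+1) \/
  (forall n, (n < N)%N -> f n.+1 <= f n).

(** Summation by parts. For monotone [c] the variation telescopes to |c N - c 0|; as [c] is
    nonnegative, adding the boundary terms c N + c 0 gives twice the larger of the two. *)
Lemma abel_bound c s (B : R) N : monotone_upto N c ->
  (forall n, (n <= N)%N -> 0 <= c n <= B) -> (forall n, `|s n| <= 1) ->
  `|\sum_(n < N) c n * (s n.+1 - s n)| <= 2 * B.
Proof.
move=> cmono cB s1.
have B0 : 0 <= B by have /andP[] := cB 0%N isT; exact: le_trans.
case: N => [|N] in cmono cB *; first by rewrite big_ord0 normr0 mulr_ge0.
have key M : (M <= N)%N ->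
  `|\sum_(n < M.+1) c n * (s n.+1 - s n) - c M * s M.+1 + c 0%N * s 0%N| <=
  `|c M - c 0%N|.
  elim: M => [_|M IH MN].
    rewrite big_ord_recl big_ord0 addr0 subrr normr0.
    by rewrite [X in `|X|](_ : _ = 0) ?normr0//=; ring.
  rewrite big_ord_recr /=.
  rewrite [X in `|X|](_ : _ =
    (\sum_(n < M.+1) c n * (s n.+1 - s n) - c M * s M.+1 + c 0%N * s 0%N) -
    (c M.+1 - c M) * s M.+1); last by ring.
  apply: (le_trans (ler_normB _ _)).
  apply: (le_trans (lerD (IH (ltnW MN)) (_ : _ <= `|c M.+1 - c M|))).
    by rewrite normrM ler_piMr.
  case: cmono => cm.
    have c0M : c 0%N <= c M.
      elim: (M) (ltnW MN) => // i ih iN.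
      by apply: le_trans (ih (ltnW iN)) (cm _ _); rewrite ltnS ltnW.
    have := cm M; rewrite ltnS (ltnW MN) => /(_ isT) cMM.
    by rewrite !ger0_norm; lra.
  have c0M : c M <= c 0%N.
    elim: (M) (ltnW MN) => // i ih iN.
    by apply: le_trans (cm _ _) (ih (ltnW iN)); rewrite ltnS ltnW.
  have := cm M; rewrite ltnS (ltnW MN) => /(_ isT) cMM.
  by rewrite !ler0_norm; lra.
have := key _ (leqnn N).
set S := \sum_(n < _) _ => H.
have := cB 0%N isT; have := cB N (leqnSn N).
move=> /andP[cN0 cNB] /andP[c00 c0B].
have -> : S = (S - c N * s N.+1 + c 0%N * s 0%N) + c N * s N.+1 - c 0%N * s 0%N by ring.
have h1 : `|c N * s N.+1| <= c N by rewrite normrM (ger0_norm cN0) ler_piMr.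
have h2 : `|c 0%N * s 0%N| <= c 0%N by rewrite normrM (ger0_norm c00) ler_piMr.
apply: (le_trans (ler_normB _ _)).
apply: (le_trans (lerD (ler_normD _ _) h2)).
have : `|c N - c 0%N| + c N + c 0%N <= 2 * B.
  by case: (lerP (c 0%N) (c N)) => h; lra.
lra.
Qed.

Lemma mulr_cos_le_sin (x : R) : 0 <= x <= pi / 2 -> x * cos x <= sin x.
Proof.
move=> /andP[]; rewrite le_eqVlt => /predU1P[<-|x0 xpi].
  by rewrite mul0r sin0.
have cs : {within `[0, x], continuous sin}.
  by apply: continuous_subspaceT => y; exact: continuous_sin.
have [y] := @MVT R sin cos 0 x x0 (fun y _ => is_derive_sin y) cs.
rewrite in_itv/= => /andP[y0 yx]; rewrite sin0 !subr0 => ->.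
rewrite mulrC ler_wpM2r ?(ltW x0)//.
have pi0 := @pi_gt0 R.
have x1 : x \in `[0, pi] by rewrite in_itv/=; apply/andP; split; lra.
have y1 : y \in `[0, pi] by rewrite in_itv/=; apply/andP; split; lra.
by apply/ltW; rewrite ltr_cos.
Qed.

Definition cot (x : R) := cos x / sin x.

Lemma cot_ge0_le (x : R) : 0 < x <= pi / 2 -> 0 <= cot x <= x^-1.
Proof.
move=> /andP[x0 xpi]; have pi0 := @pi_gt0 R.
have s0 : 0 < sin x by apply: sin_gt0_pi; lra.
have c0 : 0 <= cos x by apply: cos_ge0_pihalf; lra.
rewrite /cot divr_ge0 ?(ltW s0)//=.
rewrite ler_pdivrMr// -ler_pdivrMl ?invr_gt0// invrK.
by apply: mulr_cos_le_sin; lra.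
Qed.

Lemma cot_nonincreasing (x y : R) : 0 < x -> x <= y -> y <= pi / 2 -> cot y <= cot x.
Proof.
move=> x0 xy ypi; have pi0 := @pi_gt0 R.
have s0 : 0 < sin x by apply: sin_gt0_pi; lra.
have s1 : 0 < sin y by apply: sin_gt0_pi; lra.
have c1 : 0 <= cos y by apply: cos_ge0_pihalf; lra.
have scmp : sin x <= sin y.
  move: xy; rewrite le_eqVlt => /predU1P[->//|xy].
  by apply/ltW; rewrite ltr_sin // in_itv/=; apply/andP; split; lra.
have ccmp : cos y <= cos x.
  move: xy; rewrite le_eqVlt => /predU1P[->//|xy].
  by apply/ltW; rewrite ltr_cos // in_itv/=; apply/andP; split; lra.
rewrite /cot; apply: ler_pM => //; first by rewrite invr_ge0 ltW.
by rewrite lef_pV2.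
Qed.

(* With [g = pi * diff f n], [2 cos (2 pi f n)] is the increment of
   [cot g * sin (2 pi f) - cos (2 pi f)], up to the variation of [cot g]. *)
Lemma kuzmin_landau f N (lam : R) : 0 < lam -> lam <= 4^-1 ->
  (forall n, (n <= N)%N -> lam <= diff f n <= 2 * lam) ->
  monotone_upto N (diff f) ->
  lam * `|\sum_(n < N) cos (2 * pi * f n)| <= 1.
Proof.
move=> lam0 lam4 fb fm; have pi0 := @pi_gt0 R; have pi2 := @pi_ge2 R.
have gb n : (n <= N)%N -> pi * lam <= pi * diff f n <= pi / 2.
  move=> nN; have /andP[h1 h2] := fb n nN.
  rewrite !ler_pM2l// h1 /=; lra.
have pl0 : 0 < pi * lam by rewrite mulr_gt0.
have cb n : (n <= N)%N -> 0 <= cot (pi * diff f n) <= (pi * lam)^-1.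
  move=> nN; have /andP[h1 h2] := gb n nN.
  have h0 : 0 < pi * diff f n by exact: lt_le_trans h1.
  have /andP[-> h3] : 0 <= cot (pi * diff f n) <= (pi * diff f n)^-1.
    by apply: cot_ge0_le; rewrite h0.
  by apply: (le_trans h3); rewrite lef_pV2.
have cm : monotone_upto N (fun n => cot (pi * diff f n)).
  have ord n : (n <= N)%N -> 0 < pi * diff f n /\ pi * diff f n <= pi / 2.
    by move=> nN; have /andP[h1 h2] := gb n nN; split=> //; exact: lt_le_trans h1.
  case: fm => fm; [right|left] => n nN.
    have [h1 h2] := ord _ (ltnW nN); have [h3 h4] := ord _ nN.
    by apply: cot_nonincreasing => //; rewrite ler_pM2l// fm.
  have [h1 h2] := ord _ (ltnW nN); have [h3 h4] := ord _ nN.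
  by apply: cot_nonincreasing => //; rewrite ler_pM2l// fm.
pose F n := 2 * pi * f n.
have E n : (n < N)%N -> 2 * cos (F n) =
    cot (pi * diff f n) * (sin (F n.+1) - sin (F n)) - (cos (F n.+1) - cos (F n)).
  move=> nN; set g := pi * diff f n.
  have -> : F n.+1 = F n + (g + g) by rewrite /F /g /diff; ring.
  have sg : sin g != 0.
    have /andP[h1 h2] := gb n (ltnW nN); rewrite gt_eqF// sin_gt0_pi//.
    by rewrite (lt_le_trans pl0 h1)/=; apply: (le_lt_trans h2); lra.
  rewrite (sinD (F n)) (cosD (F n)) (sinD g) (cosD g) /cot.
  have cs : cos g * cos g = 1 - sin g * sin g by have := cos2Dsin2 g; lra.
  by field: cs.
have ab := @abel_bound _ (fun n => sin (F n)) (pi * lam)^-1 N cm cb (fun n => sin_max _).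
have tel : \sum_(n < N) (cos (F n.+1) - cos (F n)) = cos (F N) - cos (F 0%N).
  by rewrite -(big_mkord xpredT (fun n => cos (F n.+1) - cos (F n))) telescope_sumr.
have S2 : 2 * \sum_(n < N) cos (F n) =
   \sum_(n < N) cot (pi * diff f n) * (sin (F n.+1) - sin (F n)) - (cos (F N) - cos (F 0%N)).
  by rewrite -tel -sumrB mulr_sumr; apply: eq_bigr => n _; apply: E.
have : 2 * `|\sum_(n < N) cos (F n)| <= 2 * (pi * lam)^-1 + 2.
  rewrite -(ger0_norm (_ : 0 <= 2 :> R))// -normrM S2 (ger0_norm (_ : 0 <= 2 :> R))//.
  apply: (le_trans (ler_normB _ _)); apply: lerD => //.
  apply: (le_trans (ler_normB _ _)); have := cos_max (F N); have := cos_max (F 0%N); lra.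
move=> H.
have : `|\sum_(n < N) cos (F n)| <= (pi * lam)^-1 + 1 by lra.
move=> {}H; apply: (le_trans (ler_wpM2l (ltW lam0) H)).
rewrite mulrDr mulr1 invfM mulrCA divff ?gt_eqF// mulr1.
have : pi^-1 <= 2^-1 :> R by rewrite lef_pV2 ?posrE.
lra.
Qed.

End ExponentialSums.

(** * Weyl differencing and derivative tests of every order *)

Section Weyl.
Context {R : realType}.
Implicit Types (f g c s : nat -> R) (N n : nat).

Lemma iter_diff_shift f j i n :
  iter j diff (fun n => f (n + i)%N) n = iter j diff f (n + i)%N.
Proof. by elim: j n => //= j IH n; rewrite /diff !IH addSn. Qed.

Lemma iter_diffB f g j n :
  iter j diff (fun n => f n - g n) n = iter j diff f n - iter j diff g n.
Proof. by elim: j n => //= j IH n; rewrite /diff !IH; ring. Qed.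

Lemma iter_diffZ (b : R) f j n :
  iter j diff (fun n => b * f n) n = b * iter j diff f n.
Proof. by elim: j n => //= j IH n; rewrite /diff !IH; ring. Qed.

Lemma eq_iter_diff f g j : f =1 g -> iter j diff f =1 iter j diff g.
Proof. by move=> fg; elim: j => //= j IH n; rewrite /diff !IH. Qed.

Lemma iter_diff_gap f j h i n :
  iter j diff (fun n => f (n + (i + h))%N - f (n + i)%N) n =
  \sum_(t < h) iter j.+1 diff f (n + i + t)%N.
Proof.
rewrite iter_diffB !iter_diff_shift.
rewrite -(big_mkord xpredT (fun t => iter j.+1 diff f (n + i + t)%N)) /=.
rewrite (eq_bigr (fun t => iter j diff f (n + i + t.+1)%N - iter j diff f (n + i + t)%N)).
  by rewrite telescope_sumr// addn0 addnA.
by move=> t _; rewrite /diff addnS.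
Qed.

(** Finite differences replace derivatives so that Weyl differencing is exact: by [iter_diff_gap] a
    gap h turns order j+1 into order j, with [lam] multiplied by h and the factor 2 and the
    monotonicity preserved. *)
Definition tame j N (lam : R) f : Prop :=
  (forall n, (n <= N)%N -> lam <= iter j diff f n <= 2 * lam) /\
  monotone_upto N (iter j diff f).

Lemma tame_gap j N lam f N' i h : tame j.+1 N lam f -> (N' + i + h <= N)%N ->
  tame j N' (h%:R * lam) (fun n => f (n + (i + h))%N - f (n + i)%N).
Proof.
move=> [fb fm] Nih; split.
  move=> n nN; rewrite iter_diff_gap mulrCA.
  have E x : h%:R * x = \sum_(t < h) x :> R by rewrite sumr_const card_ord mulr_natl.
  rewrite !E.
  by apply/andP; split; apply: ler_sum => t _; have /andP[] := fb (n + i + t)%N ltac:(have := ltn_ord t; lia).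
case: fm => fm; [left|right] => n nN; rewrite !iter_diff_gap; apply: ler_sum => t _;
  by rewrite !addSn; apply: fm; have := ltn_ord t; lia.
Qed.

Lemma sqr_sum_le N (x : nat -> R) :
  (\sum_(n < N) x n) ^+ 2 <= N%:R * \sum_(n < N) x n ^+ 2.
Proof.
elim: N => [|N IH]; first by rewrite !big_ord0 expr0n mulr0.
rewrite !big_ord_recr /=.
have Q0 : 0 <= \sum_(n < N) x n ^+ 2 by apply: sumr_ge0 => n _; exact: sqr_ge0.
move: IH Q0; set S := \sum_(n < N) x n; set Q := \sum_(n < N) x n ^+ 2 => IH Q0.
rewrite -natr1.
have [N0|N0] := posnP N.
  have -> : S = 0 by rewrite /S N0 big_ord0.
  have -> : Q = 0 by rewrite /Q N0 big_ord0.
  by rewrite N0 !add0r mul1r.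
have n0 : 0 < N%:R :> R by rewrite ltr0n.
have : N%:R * (2 * S * x N) <= N%:R * (Q + N%:R * x N ^+ 2).
  by have := sqr_ge0 (S - N%:R * x N); nra.
by rewrite ler_pM2l// => h; nra.
Qed.

(** Cauchy-Schwarz over n. Adding the square of the matching sine sum turns products of cosines into
    cosines of differences, which does the work of the modulus of a complex exponential sum. *)
Lemma van_der_corput f N H :
  (\sum_(n < N) \sum_(i < H) cos (2 * pi * f (n + i)%N)) ^+ 2 <=
  N%:R * \sum_(i < H) \sum_(i' < H) \sum_(n < N)
     cos (2 * pi * (f (n + i)%N - f (n + i')%N)).
Proof.
apply: le_trans (sqr_sum_le _ (fun n => \sum_(i < H) cos (2 * pi * f (n + i)%N))) _.
rewrite ler_wpM2l//.
under [leRHS]eq_bigr => i _ do rewrite exchange_big.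
rewrite exchange_big /=; apply: ler_sum => n _.
apply: (@le_trans _ _ ((\sum_(i < H) cos (2 * pi * f (n + i)%N)) ^+ 2 +
   (\sum_(i < H) sin (2 * pi * f (n + i)%N)) ^+ 2)).
  by rewrite lerDl sqr_ge0.
rewrite !expr2 !big_distrlr /= -big_split /=.
under eq_bigr => i _ do rewrite -big_split /=.
apply: ler_sum => i _; apply: ler_sum => i' _.
by rewrite mulrBr cosB.
Qed.

Lemma sum_window (H a h : nat) :
  (\sum_(i < H) ((a <= i) && (i < a + h)) <= h)%N.
Proof.
rewrite -(big_mkord xpredT (fun i => nat_of_bool ((a <= i) && (i < a + h))%N)).
have -> : (\sum_(0 <= i < H) ((a <= i) && (i < a + h)) =
   size [seq i <- iota 0 H | (a <= i) && (i < a + h)])%N.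
  by rewrite size_filter -sum1_count [RHS]big_mkcond /= /index_iota subn0; apply: eq_bigr => i _; case: ifP.
rewrite -[X in (_ <= X)%N](size_iota a h); apply: uniq_leq_size.
  by rewrite filter_uniq// iota_uniq.
by move=> i; rewrite mem_filter !mem_iota => /andP[].
Qed.

Lemma sum_near_diagonal (H h : nat) (i : nat) :
  \sum_(i' < H) (((i < i' + h) && (i' < i + h))%N : nat)%:R <= (2 * h)%:R :> R.
Proof.
rewrite -natr_sum ler_nat mul2n -addnn.
apply: (@leq_trans (\sum_(i' < H) ((i <= i') && (i' < i + h)) +
   \sum_(i' < H) ((i.+1 - h <= i') && (i' < i.+1 - h + h)))%N); last first.
  by apply: leq_add; apply: sum_window.
rewrite -big_split /=; apply: leq_sum => i' _.
case: (boolP ((i < i' + h) && (i' < i + h))%N) => // /andP[h1 h2].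
case: (leqP i i') => h3; first by rewrite h2.
have -> : ((i.+1 - h <= i') && (i' < i.+1 - h + h))%N = true by lia.
by rewrite addn1.
Qed.

Lemma norm_sum_cos_le N (u : nat -> R) : `|\sum_(n < N) cos (u n)| <= N%:R.
Proof.
apply: (le_trans (ler_norm_sum _ _ _)).
rewrite -[leRHS]mul1r mulr_natr -[X in _ *+ X](card_ord N) -sumr_const.
by apply: ler_sum => n _; exact: cos_max.
Qed.

(** For each i < H the range [i, N' + i) misses exactly H of the N terms, each of size at most 1. *)
Lemma weyl_shift f N N' H : (N' + H = N)%N ->
  `|H%:R * \sum_(n < N) cos (2 * pi * f n) -
   \sum_(n < N') \sum_(i < H) cos (2 * pi * f (n + i)%N)| <= H%:R * H%:R.
Proof.
move=> NH.
rewrite exchange_big /= mulr_natl -[X in _ *+ X](card_ord H) -sumr_const -sumrB.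
apply: (le_trans (ler_norm_sum _ _ _)).
have -> : H%:R * H%:R = \sum_(i < H) H%:R :> R by rewrite sumr_const card_ord mulr_natl.
apply: ler_sum => i _.
pose u n := cos (2 * pi * f n).
rewrite -(big_mkord xpredT u) -(big_mkord xpredT (fun n => u (n + i)%N)).
have iH := ltn_ord i.
rewrite (@big_cat_nat _ _ _ i) //=; last by lia.
rewrite (@big_cat_nat _ _ _ (N' + i) i) //=; [|lia|lia].
have -> : \sum_(i <= n < N' + i) u n = \sum_(0 <= n < N') u (n + i)%N.
  by rewrite -{1}(add0n (i : nat)) big_addn addnK.
rewrite addrCA addrAC subrr add0r.
apply: (le_trans (ler_normD _ _)).
rewrite [leRHS](_ : _ = (i : nat)%:R + (N - (N' + i))%:R); last by rewrite -natrD; congr _%:R; lia.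
apply: lerD.
  by rewrite big_mkord; apply: (norm_sum_cos_le _ (fun n => 2 * pi * f n)).
rewrite -{1}(add0n (N' + i)%N) big_addn big_mkord.
exact: (norm_sum_cos_le _ (fun n => 2 * pi * f (n + (N' + i))%N)).
Qed.

(** [E] is the saving over the trivial bound. It will be a power of a logarithm, so any polynomial
    loss C E^d is affordable and the exponents below are not optimized. *)
Definition derivative_test j (d C : nat) : Prop :=
  forall (E : R) N (lam : R) f, 1 <= E -> 0 < lam -> tame j.+1 N lam f ->
  lam * (C%:R * E ^+ d) <= 1 -> C%:R * E ^+ d <= N%:R ^+ j.+1 * lam ->
  E * `|\sum_(n < N) cos (2 * pi * f n)| <= N%:R.

Lemma derivative_test0 : derivative_test 0 1 4.
Proof.
move=> E N lam f E1 lam0 [fb fm]; rewrite !expr1 => h1 h2.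
have lam4 : lam <= 4^-1 by nra.
have := kuzmin_landau lam0 lam4 fb fm.
set S := `|_| => h3.
have S0 : 0 <= S by exact: normr_ge0.
rewrite -(ler_pM2r lam0); apply: le_trans h2; nra.
Qed.

(** Pairs of shifts closer than h0 are bounded trivially and contribute a proportion 2 h0 / H <= 1 /
    (8 E^2); the other pairs contribute at most 1 / (16 E^2). Together this is below 1 / (4 E^2), so
    the averaged sum uses half of the allowance N / E; the error H of the shift uses the other
    half. *)
Lemma weyl_combine f (E : R) N N' H h0 : 1 <= E -> (N' + H = N)%N -> (0 < H)%N ->
  16 * E ^+ 2 * h0%:R <= H%:R -> 2 * E * H%:R <= N%:R ->
  (forall i i', (i' < H)%N -> (i' + h0 <= i < H)%N -> 16 * E ^+ 2 *
    `|\sum_(n < N') cos (2 * pi * (f (n + i)%N - f (n + i')%N))| <= N'%:R) ->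
  E * `|\sum_(n < N) cos (2 * pi * f n)| <= N%:R.
Proof.
move=> E1 N'H Hpos Hh0 HN pair.
have E0 : 0 < E by lra.
have E2p : 0 < 16 * E ^+ 2 by nra.
have H0 : 0 < H%:R :> R by rewrite ltr0n.
have N'r : N%:R = N'%:R + H%:R :> R by rewrite -N'H natrD.
have N'0 : 0 <= N'%:R :> R by [].
pose T i i' := \sum_(n < N') cos (2 * pi * (f (n + i)%N - f (n + i')%N)).
have Tb i i' : (i < H)%N -> (i' < H)%N ->
  T i i' <= N'%:R * (((i < i' + h0) && (i' < i + h0))%N : nat)%:R + N'%:R / (16 * E ^+ 2).
  move=> iH i'H; apply: (le_trans (ler_norm _)).
  have [/andP[h1 h2]|] := boolP ((i < i' + h0) && (i' < i + h0))%N.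
    rewrite mulr1 -[leLHS]addr0 lerD ?divr_ge0 ?(ltW E2p)//.
    exact: (norm_sum_cos_le _ (fun n => 2 * pi * (f (n + i)%N - f (n + i')%N))).
  rewrite negb_and -!leqNgt mulr0 add0r ler_pdivlMr// mulrC => /orP[h1|h1].
    by apply: pair => //; rewrite h1.
  rewrite (_ : T i i' = T i' i); first by apply: pair => //; rewrite h1.
  by apply: eq_bigr => n _; rewrite -cosN; congr cos; ring.
set S := \sum_(n < N) _; set S' := \sum_(n < N') \sum_(i < H) cos (2 * pi * f (n + i)%N).
have HS : `|H%:R * S - S'| <= H%:R * H%:R by exact: weyl_shift.
have S'2 : S' ^+ 2 <= (N'%:R * H%:R / (2 * E)) ^+ 2.
  apply: (le_trans (van_der_corput f N' H)).
  have : \sum_(i < H) \sum_(i' < H) T i i' <=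
     H%:R * (N'%:R * (2 * h0)%:R) + H%:R * (H%:R * (N'%:R / (16 * E ^+ 2))).
    have cst (x : R) : H%:R * x = \sum_(i < H) x.
      by rewrite sumr_const card_ord mulr_natl.
    rewrite !cst -big_split /=; apply: ler_sum => i _.
    apply: (@le_trans _ _ (\sum_(i' < H) (N'%:R * (((i < i' + h0) && (i' < i + h0))%N : nat)%:R + N'%:R / (16 * E ^+ 2)))).
      by apply: ler_sum => i' _; apply: Tb.
    by rewrite big_split /= -mulr_sumr lerD2r ler_wpM2l// sum_near_diagonal.
  move=> /(ler_wpM2l N'0) /le_trans; apply.
  have -> : (N'%:R * H%:R / (2 * E)) ^+ 2 = N'%:R ^+ 2 * (H%:R ^+ 2 * (4 * E ^+ 2)^-1).
    by field; rewrite gt_eqF.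
  have -> : N'%:R * (H%:R * (N'%:R * (2 * h0)%:R) + H%:R * (H%:R * (N'%:R / (16 * E ^+ 2))))
     = N'%:R ^+ 2 * (H%:R * (2 * h0%:R) + H%:R ^+ 2 * (16 * E ^+ 2)^-1).
    by rewrite natrM; field; rewrite gt_eqF.
  rewrite ler_wpM2l ?exprn_ge0//.
  have h8 : 2 * h0%:R <= H%:R * (8 * E ^+ 2)^-1.
    rewrite ler_pdivlMr; last by lra.
    clear -Hh0; lra.
  have -> : H%:R ^+ 2 * (4 * E ^+ 2)^-1 = H%:R * (H%:R * (8 * E ^+ 2)^-1) +
      (H%:R ^+ 2 * (16 * E ^+ 2)^-1 + H%:R ^+ 2 * (16 * E ^+ 2)^-1).
    by field; rewrite gt_eqF.
  apply: lerD; first by rewrite ler_wpM2l.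
  by rewrite lerDl mulr_ge0 ?invr_ge0 ?exprn_ge0// ltW.
have {S'2} S'b : `|S'| <= N'%:R * H%:R / (2 * E).
  rewrite -(@ler_pXn2r _ 2%N) ?nnegrE//; first by rewrite real_normK ?num_real.
  by rewrite !mulr_ge0 ?invr_ge0// mulr_ge0// ltW.
have : H%:R * `|S| <= H%:R * H%:R + N'%:R * H%:R / (2 * E).
  rewrite -[X in X * `|S|](ger0_norm (_ : 0 <= H%:R))// -normrM.
  rewrite (_ : H%:R * S = (H%:R * S - S') + S'); last by ring.
  by apply: (le_trans (ler_normD _ _)); rewrite lerD.
move=> /(ler_wpM2l (ltW E0)).
have -> : E * (H%:R * H%:R + N'%:R * H%:R / (2 * E)) = H%:R * (E * H%:R + N'%:R / 2).
  by field; rewrite gt_eqF.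
rewrite mulrCA ler_pM2l// => /le_trans; apply.
clear -HN N'r H0; lra.
Qed.

(** [Q] is the ratio H / h0 and [Phi] the threshold of the test of order j at saving 16 E^2. The
    base 34 E^3 = 2 E * 17 E^2 bounds 2 E Q. The square of [Phi] serves the last bound: the two
    hypotheses on [Psi] give Psi^2 <= N^(j+2), hence Psi <= N^(j+1). *)
Lemma weyl_thresholds j N (E Phi lam Q : R) : 1 <= E -> 1 <= Phi -> 0 < lam ->
  1 <= Q -> Q <= 17 * E ^+ 2 ->
  let Psi := 2 ^+ (j + 3) * (34 * E ^+ 3) ^+ j.+1 * Phi ^+ 2 in
  lam * Psi <= 1 -> Psi <= N%:R ^+ j.+2 * lam ->
  [/\ Phi * Q * lam <= 1, 2 * E * Q <= N%:R,
      2 ^+ (j + 3) * E * Q * Phi <= N%:R ^+ j.+2 * lam &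
      2 ^+ (j + 2) * Q * Phi ^+ 2 <= N%:R ^+ j.+1].
Proof.
move=> E1 Phi1 lam0 Q1 Q17; set B : R := 34 * E ^+ 3 => Psi.
have [B1 EQB] : 1 <= B /\ 2 * E * Q <= B.
  have h : 1 <= E ^+ 3 by rewrite exprn_ege1.
  rewrite /B; have e : 34 * E ^+ 3 = 2 * E * (17 * E ^+ 2) by ring.
  split; first by lra.
  by rewrite e; apply: ler_wpM2l => //; lra.
move: B B1 EQB @Psi => B B1 EQB Psi.
have Bj : B <= B ^+ j.+1 by rewrite exprS ler_peMr ?exprn_ege1//; lra.
have p2 : 1 <= 2 ^+ (j + 2) :> R by rewrite exprn_ege1//; lra.
have p3 : 2 ^+ (j + 3) = 2 * 2 ^+ (j + 2) :> R by rewrite addnS exprS.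
have QB : Q <= B by clear -E1 Q1 EQB; nra.
have EQB' : E * Q <= B by clear -E1 Q1 EQB; nra.
have PP : Phi <= Phi ^+ 2 by clear -Phi1; nra.
have BP : B * Phi <= B ^+ j.+1 * Phi ^+ 2 by apply: ler_pM => //; lra.
rewrite /Psi; have [A AE] : exists A, A = B ^+ j.+1 by eexists.
rewrite -!AE in Bj BP *; set t := 2 ^+ (j + 2) in p2 p3 *.
rewrite p3 => {Q17 Psi p3} lP1 lP2.
have A1 : 1 <= A by lra.
have AP1 : 1 <= A * Phi ^+ 2 by rewrite mulr_ege1//; lra.
have tA : 1 <= 2 * t * A * Phi ^+ 2 by rewrite -mulrA mulr_ege1//; lra.
have c2 : A <= 2 * t * A * Phi ^+ 2.
  have -> : 2 * t * A * Phi ^+ 2 = A * (2 * t * Phi ^+ 2) by ring.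
  by rewrite ler_peMr ?mulr_ege1//; lra.
have c1 : Phi * Q <= 2 * t * A * Phi ^+ 2.
  apply: (@le_trans _ _ (A * Phi ^+ 2)).
    by apply: le_trans BP; rewrite mulrC ler_wpM2r//; lra.
  by rewrite -[2 * t * A * _]mulrA ler_peMl//; lra.
have c3 : 2 * t * E * Q * Phi <= 2 * t * A * Phi ^+ 2.
  rewrite -!(mulrA (2 * t)) ler_pM2l; last by lra.
  by apply: le_trans BP; rewrite ler_wpM2r//; lra.
have c4 : t * Q * Phi ^+ 2 <= 2 * t * A * Phi ^+ 2.
  rewrite ler_wpM2r ?sqr_ge0//; apply: ler_pM; lra.
move: (2 * t * A * Phi ^+ 2) tA c1 c2 c3 c4 lP1 lP2 => Psi Psi1 c1 c2 c3 c4 lP1 lP2.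
have N1 : (1 <= N)%N.
  by case: N lP2 => //; rewrite exprS mul0r mul0r; lra.
have N1r : 1 <= N%:R :> R by rewrite ler1n.
have NPsi2 : Psi ^+ 2 <= N%:R ^+ j.+2.
  have h : Psi * (lam * Psi) <= Psi by rewrite ler_piMr//; lra.
  have : lam * Psi ^+ 2 <= lam * N%:R ^+ j.+2.
    rewrite (mulrC _ (N%:R ^+ _)); apply: le_trans lP2; clear -h; lra.
  by rewrite ler_pM2l.
have NPsi : Psi <= N%:R ^+ j.+1.
  rewrite -(@ler_pXn2r _ 2%N) ?nnegrE ?exprn_ge0//; last by lra.
  by apply: (le_trans NPsi2); rewrite -exprM ler_weXn2l// muln2 -addnn addSnnS leq_addl.
split.
- by apply: le_trans lP1; rewrite [leLHS]mulrC ler_wpM2l// ltW.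
- rewrite leNgt; apply/negP => NEQ.
  have : N%:R ^+ j.+1 < B ^+ j.+1 by rewrite ltrXn2r//; lra.
  rewrite ltNge => /negP; apply; rewrite -AE; exact: le_trans NPsi.
- exact: le_trans lP2.
- exact: le_trans NPsi.
Qed.

Lemma weyl_parameters j N (E Phi lam : R) : 1 <= E -> 1 <= Phi -> 0 < lam ->
  let Psi := 2 ^+ (j + 3) * (34 * E ^+ 3) ^+ j.+1 * Phi ^+ 2 in
  lam * Psi <= 1 -> Psi <= N%:R ^+ j.+2 * lam ->
  exists h0 H N', [/\ [/\ (0 < h0)%N, (0 < H)%N & (N' + H = N)%N],
    16 * E ^+ 2 * h0%:R <= H%:R, 2 * E * H%:R <= N%:R,
    H%:R * lam * Phi <= 1 & Phi <= N'%:R ^+ j.+1 * (h0%:R * lam)].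
Proof.
move=> E1 Phi1 lam0 Psi lP1 lP2.
have [Q [Qpos Q16 Q17]] : exists Q, [/\ (0 < Q)%N, 16 * E ^+ 2 <= Q%:R & Q%:R <= 17 * E ^+ 2].
  exists (Num.truncn (16 * E ^+ 2)).+1.
  have E21 : 1 <= E ^+ 2 by rewrite exprn_ege1.
  have /andP[h1 h2] : (Num.truncn (16 * E ^+ 2))%:R <= 16 * E ^+ 2 <
      (Num.truncn (16 * E ^+ 2)).+1%:R by apply: truncn_itv; lra.
  by have h3 := @natr1 R (Num.truncn (16 * E ^+ 2)); split=> //; lra.
have Q1 : 1 <= Q%:R :> R by rewrite ler1n.
have [c1 c2 c3 c4] := weyl_thresholds E1 Phi1 lam0 Q1 Q17 lP1 lP2.
clear Psi lP1 lP2 Q17.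
have Q0 : 0 < Q%:R :> R by rewrite ltr0n.
have E0 : 0 < E by lra.
have Phi0 : 0 < Phi by lra.
have PQl0 : 0 < Phi * Q%:R * lam by apply: mulr_gt0 => //; apply: mulr_gt0.
have EQ0 : 0 < 2 * E * Q%:R by apply: mulr_gt0 => //; apply: mulr_gt0.
(* With H = h0 Q, the two entries are the largest h0 allowed by 2 E H <= N and by H lam Phi <= 1.
   Rounding down loses at most a factor 2, since mu >= 1. *)
set mu := Num.min (N%:R / (2 * E * Q%:R)) ((Phi * Q%:R * lam)^-1).
have mu1 : 1 <= mu.
  by rewrite /mu le_min ler_pdivlMr// mul1r c2 /= invf_ge1.
have [h0 [h01 h0mu muh0]] : exists h0, [/\ (1 <= h0)%N, h0%:R <= mu & mu <= 2 * h0%:R].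
  exists (Num.truncn mu); clear -mu1.
  have h01 : (1 <= Num.truncn mu)%N by rewrite -(@truncn1 R) le_truncn.
  have /andP[h1 h2] : (Num.truncn mu)%:R <= mu < (Num.truncn mu).+1%:R by apply: truncn_itv; lra.
  have h3 : 1 <= (Num.truncn mu)%:R :> R by rewrite ler1n.
  by have h4 := @natr1 R (Num.truncn mu); split=> //; lra.
have [H HQ] : exists H, H = (h0 * Q)%N by eexists.
have HE : H%:R = h0%:R * Q%:R :> R by rewrite HQ natrM.
have HN : 2 * E * H%:R <= N%:R.
  rewrite HE mulrCA -ler_pdivlMr//; apply: (le_trans h0mu).
  by rewrite ge_min lexx.
have Hlam : H%:R * lam * Phi <= 1.
  have : mu <= (Phi * Q%:R * lam)^-1 by rewrite ge_min lexx orbT.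
  move=> /(le_trans h0mu); rewrite -[_^-1]mul1r ler_pdivlMr// HE.
  clear; lra.
have Hpos : (0 < H)%N by rewrite HQ muln_gt0 h01.
have HN2 : 2 * H%:R <= N%:R :> R.
  by apply: le_trans HN; rewrite ler_wpM2r// ler_peMr.
have HleN : (H <= N)%N.
  have : 0 < H%:R :> R by rewrite ltr0n.
  by rewrite -(ler_nat R); clear -HN2; lra.
have [N' N'H] : exists N', (N' + H = N)%N by exists (N - H)%N; rewrite subnK.
have N'N : N%:R / 2 <= N'%:R :> R.
  have : N%:R = N'%:R + H%:R :> R by rewrite -N'H natrD.
  by clear -HN2; lra.
exists h0, H, N'; split=> //.
  rewrite HE mulrC ler_wpM2l//.
apply: (@le_trans _ _ ((N%:R / 2) ^+ j.+1 * (mu / 2 * lam))); last first.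
  have mu20 : 0 <= mu / 2 by clear -mu1; lra.
  apply: ler_pM.
  - by rewrite exprn_ge0// divr_ge0.
  - by rewrite mulr_ge0// ltW.
  - by apply: lerXn2r; rewrite ?nnegrE ?divr_ge0.
  - by rewrite ler_pM2r//; clear -muh0; lra.
rewrite exprMn exprVn.
have p2 : 0 < 2 ^+ j.+1 :> R by rewrite exprn_gt0.
have e2 : 2 ^+ (j + 2) = 2 * 2 ^+ j.+1 :> R by rewrite addn2 exprS.
have e3 : 2 ^+ (j + 3) = 4 * 2 ^+ j.+1 :> R by rewrite addn3 !exprS; ring.
rewrite e3 in c3; rewrite e2 in c4.
rewrite /mu; case: (leP (N%:R / (2 * E * Q%:R)) ((Phi * Q%:R * lam)^-1)) => _.
  have -> : N%:R ^+ j.+1 / 2 ^+ j.+1 * (N%:R / (2 * E * Q%:R) / 2 * lam) =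
    (N%:R ^+ j.+2 * lam) / (4 * 2 ^+ j.+1 * E * Q%:R).
    by rewrite (exprS _ j.+1); field; rewrite !gt_eqF.
  rewrite ler_pdivlMr ?mulr_gt0//; apply: le_trans c3; clear; lra.
have -> : N%:R ^+ j.+1 / 2 ^+ j.+1 * ((Phi * Q%:R * lam)^-1 / 2 * lam) =
    N%:R ^+ j.+1 / (2 * 2 ^+ j.+1 * Q%:R * Phi).
  by field; rewrite !gt_eqF.
rewrite ler_pdivlMr ?mulr_gt0//.
apply: le_trans c4; rewrite expr2; clear; lra.
Qed.

(** The test of order j is applied to each differenced phase with saving 16 E^2 and size h lam; h0
    <= h keeps this size above the lower threshold and h <= H below the upper one. *)
Lemma derivative_testS j d C : (0 < C)%N -> derivative_test j d C ->
  derivative_test j.+1 (3 * j.+1 + (d * 2) * 2)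
    (2 ^ (j + 3) * 34 ^ j.+1 * (C * 16 ^ d) ^ 2).
Proof.
move=> C0 IH E N lam f E1 lam0 tf.
set Phi : R := C%:R * (16 * E ^+ 2) ^+ d.
have PsiE : (2 ^ (j + 3) * 34 ^ j.+1 * (C * 16 ^ d) ^ 2)%:R * E ^+ (3 * j.+1 + (d * 2) * 2) =
    2 ^+ (j + 3) * (34 * E ^+ 3) ^+ j.+1 * Phi ^+ 2.
  rewrite /Phi 2!natrM !natrX natrM natrX (exprD E).
  have -> : E ^+ (3 * j.+1) = (E ^+ 3) ^+ j.+1 by rewrite exprM.
  have -> : E ^+ (d * 2 * 2) = ((E ^+ 2) ^+ d) ^+ 2.
    by rewrite -!exprM; congr (_ ^+ _); lia.
  by rewrite !exprMn; ring.
rewrite PsiE => lP1 lP2.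
have E21 : 1 <= E ^+ 2 by rewrite exprn_ege1.
have Phi1 : 1 <= Phi.
  by rewrite /Phi mulr_ege1 ?ler1n// exprn_ege1//; lra.
have [h0 [H [N' [[h00 H0 N'H] Hh0 HN Hlam key]]]] :=
  weyl_parameters E1 Phi1 lam0 lP1 lP2.
apply: (weyl_combine E1 N'H H0 Hh0 HN) => i i' i'H /andP[ii' iH].
have [h [[hp hH ->] ihH]] : exists h, [/\ (h0 <= h)%N, (h <= H)%N & i = (i' + h)%N] /\ (i' + h < H)%N.
  by exists (i - i')%N; split; [split|]; clear -ii' iH; lia.
have h0h : h0%:R <= h%:R :> R by rewrite ler_nat.
have hHr : h%:R <= H%:R :> R by rewrite ler_nat.
have hl0 : 0 < h%:R * lam by rewrite mulr_gt0// ltr0n (leq_trans h00).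
have N'ih : (N' + i' + h <= N)%N by clear -N'H ihH; lia.
apply: (IH _ _ (h%:R * lam) (fun n => f (n + (i' + h))%N - f (n + i')%N)) => //.
- lra.
- exact: (tame_gap tf).
- apply: le_trans Hlam; rewrite ler_wpM2r//; first by rewrite (le_trans ler01).
  by rewrite ler_pM2r.
- by apply: (le_trans key); rewrite ler_wpM2l ?exprn_ge0// ler_pM2r.
Qed.

Theorem derivative_test_exists j : exists d C, (0 < C)%N /\ derivative_test j d C.
Proof.
elim: j => [|j [d [C [C0 IH]]]]; first by exists 1%N, 4%N; split=> //; exact: derivative_test0.
exists (3 * j.+1 + (d * 2) * 2)%N, (2 ^ (j + 3) * 34 ^ j.+1 * (C * 16 ^ d) ^ 2)%N.
split; last exact: derivative_testS.
by rewrite !muln_gt0 !expn_gt0 ?muln_gt0 ?expn_gt0 C0.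
Qed.

End Weyl.

(** * The circle method on a cyclic group *)

Section Fourier.
Context {R : realType}.

Lemma cosD2piM (k : nat) (x : R) : cos (x + 2 * pi * k%:R) = cos x.
Proof.
have -> : 2 * pi * k%:R = pi *+ 2 *+ k :> R by rewrite -mulr_natr -(mulr_natr pi); ring.
exact: (@periodicn _ _ cos (pi *+ 2) (@cosD2pi R) k x).
Qed.

Lemma sinD2piM (k : nat) (x : R) : sin (x + 2 * pi * k%:R) = sin x.
Proof.
have -> : 2 * pi * k%:R = pi *+ 2 *+ k :> R by rewrite -mulr_natr -(mulr_natr pi); ring.
exact: (@periodicn _ _ sin (pi *+ 2) (@sinD2pi R) k x).
Qed.

(** Multiplication by 2 sin (pi m / q), which is nonzero for 0 < m < q, makes the sum telescope
    between two points that differ by m full turns. *)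
Lemma sum_cos_period (q m : nat) (c : R) : (0 < m < q)%N ->
  \sum_(r < q) cos (2 * pi * (r%:R * m%:R / q%:R) + c) = 0.
Proof.
move=> /andP[m0 mq].
have q0 : 0 < q%:R :> R by rewrite ltr0n; lia.
have m0r : 0 < m%:R :> R by rewrite ltr0n.
have mqr : m%:R < q%:R :> R by rewrite ltr_nat.
have pi0 := @pi_gt0 R.
set g : R := pi * (m%:R / q%:R).
have sg : sin g != 0.
  rewrite gt_eqF// sin_gt0_pi// mulr_gt0 ?divr_gt0//=.
  by rewrite gtr_pMr// ltr_pdivrMr// mul1r.
apply/eqP; rewrite -(mulrI_eq0 _ (mulfI (_ : 2 * sin g != 0))) ?mulf_neq0//.
rewrite mulr_sumr.
pose u r := sin (2 * g * r%:R + c - g).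
rewrite (eq_bigr (fun r : 'I_q => u r.+1 - u r)); last first.
  move=> r _; rewrite /u -[r.+1%:R]natr1.
  have -> : 2 * g * (r%:R + 1) + c - g = 2 * g * r%:R + c + g by ring.
  have -> : 2 * pi * (r%:R * m%:R / q%:R) + c = 2 * g * r%:R + c by rewrite /g; ring.
  by rewrite sinD sinB; ring.
rewrite -(big_mkord xpredT (fun r => u r.+1 - u r)) telescope_sumr// /u mulr0 add0r.
have -> : 2 * g * q%:R + c - g = (c - g) + 2 * pi * m%:R.
  by rewrite /g; field; rewrite gt_eqF.
by rewrite sinD2piM subrr.
Qed.

Lemma sum_seq_const (s : seq nat) (c : R) : \sum_(i <- s) c = (size s)%:R * c.
Proof. by rewrite big_const_seq count_predT iter_addr_0 mulr_natl. Qed.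

(** [csum] and [ssum] are the real and imaginary parts of the Fourier transform of X on Z/q at
    frequency r, and [norm2] below is its squared modulus. *)
Definition csum (q r : nat) (X : seq nat) : R :=
  \sum_(a <- X) cos (2 * pi * (r%:R * a%:R / q%:R)).
Definition ssum (q r : nat) (X : seq nat) : R :=
  \sum_(a <- X) sin (2 * pi * (r%:R * a%:R / q%:R)).

Lemma sum_cos_diff (q u v : nat) : (0 < q)%N -> u <> v %[mod q] ->
  \sum_(r < q) cos (2 * pi * (r%:R * u%:R / q%:R) - 2 * pi * (r%:R * v%:R / q%:R)) = 0 :> R.
Proof.
move=> q0.
wlog uv : u v / (v <= u)%N.
  move=> H h; case: (leqP v u) => vu; first exact: H.
  rewrite -[RHS](H v u (ltnW vu)); last by move=> e; apply: h.
  by apply: eq_bigr => r _; rewrite -cosN; congr cos; ring.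
move=> h.
have qr : 0 < q%:R :> R by rewrite ltr0n.
have m0 : (0 < (u - v) %% q < q)%N.
  rewrite ltn_mod q0 andbT lt0n; apply/eqP => e; apply: h.
  by apply/eqP; rewrite eqn_mod_dvd//; apply/eqP.
rewrite -[RHS](sum_cos_period 0 m0); apply: eq_bigr => r _; rewrite addr0.
rewrite -[LHS](cosD2piM 0) mulr0 addr0 -[RHS](cosD2piM (r * ((u - v) %/ q))).
congr cos.
have -> : u%:R = v%:R + (((u - v) %/ q)%:R * q%:R + ((u - v) %% q)%:R) :> R.
  by rewrite -natrM -!natrD -divn_eq addnC subnK.
by rewrite natrM; field; rewrite gt_eqF.
Qed.

Lemma sum_cos_same (q u : nat) :
  \sum_(r < q) cos (2 * pi * (r%:R * u%:R / q%:R) - 2 * pi * (r%:R * u%:R / q%:R)) = q%:R :> R.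
Proof.
by under eq_bigr => r _ do rewrite subrr cos0; rewrite sumr_const card_ord.
Qed.

Lemma csum_opp q r X : (0 < q)%N -> (r <= q)%N -> csum q (q - r) X = csum q r X.
Proof.
move=> q0 rq; apply: eq_bigr => a _.
rewrite -[RHS]cosN -[RHS](cosD2piM a); congr cos.
by rewrite natrB//; field; rewrite gt_eqF// ltr0n.
Qed.

Lemma ssum_opp q r X : (0 < q)%N -> (r <= q)%N -> ssum q (q - r) X = - ssum q r X.
Proof.
move=> q0 rq; rewrite /ssum -sumrN; apply: eq_bigr => a _.
rewrite -[RHS]sinN -[RHS](sinD2piM a); congr sin.
by rewrite natrB//; field; rewrite gt_eqF// ltr0n.
Qed.

Lemma csum_ssum_size q r X : `|csum q r X| <= (size X)%:R /\ `|ssum q r X| <= (size X)%:R.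
Proof.
rewrite -sum1_size natr_sum.
by split; apply: (le_trans (ler_norm_sum _ _ _)); apply: ler_sum => a _;
  [exact: cos_max|exact: sin_max].
Qed.

Definition norm2 q r X : R := csum q r X ^+ 2 + ssum q r X ^+ 2.

Lemma norm2_ge0 q r X : 0 <= norm2 q r X.
Proof. by rewrite addr_ge0 ?sqr_ge0. Qed.

Lemma norm2E q r X : norm2 q r X = \sum_(a <- X) \sum_(b <- X)
  cos (2 * pi * (r%:R * a%:R / q%:R) - 2 * pi * (r%:R * b%:R / q%:R)).
Proof.
rewrite /norm2 !expr2 !big_distrlr /= -big_split /=; apply: eq_bigr => a _.
by rewrite -big_split /=; apply: eq_bigr => b _; rewrite cosB.
Qed.

Lemma parseval q X : (0 < q)%N -> uniq X -> all (fun a => (a < q)%N) X ->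
  \sum_(r < q) norm2 q r X = q%:R * (size X)%:R.
Proof.
move=> q0 Xu Xq.
under eq_bigr => r _ do rewrite norm2E.
rewrite exchange_big /=.
have h a : a \in X -> \sum_(r < q) \sum_(b <- X)
    cos (2 * pi * (r%:R * a%:R / q%:R) - 2 * pi * (r%:R * b%:R / q%:R)) = q%:R :> R.
  move=> aX; rewrite exchange_big /= (bigD1_seq a)//= sum_cos_same big1_seq ?addr0//.
  move=> b /andP[ba bX]; apply: sum_cos_diff => //.
  rewrite !modn_small ?(allP Xq)//; first by move/esym/eqP; rewrite (negbTE ba).
rewrite big_seq (eq_bigr (fun=> q%:R)); last by move=> a aX; exact: h.
by rewrite -big_seq -mulr_natr -sum1_size natr_sum mulr_sumr; apply: eq_bigr => a _; rewrite mulr1.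
Qed.

(** The triple sum is the real part of the transform of U times the conjugate of those of X and Y.
    The modulus of the product for X and Y is at most half the sum of their squared moduli, and this
    is used once against [csum] and once against [ssum] of U. *)
Lemma trilinear_bound q r (U X Y : seq nat) (M : R) :
  `|csum q r U| <= M -> `|ssum q r U| <= M ->
  - (M * (norm2 q r X + norm2 q r Y)) <= \sum_(u <- U) \sum_(a <- X) \sum_(b <- Y)
    cos (2 * pi * (r%:R * u%:R / q%:R) - 2 * pi * (r%:R * (a + b)%:R / q%:R)).
Proof.
move=> cM sM.
set Xc := csum q r X; set Xs := ssum q r X; set Yc := csum q r Y; set Ys := ssum q r Y.
have -> : \sum_(u <- U) \sum_(a <- X) \sum_(b <- Y)
    cos (2 * pi * (r%:R * u%:R / q%:R) - 2 * pi * (r%:R * (a + b)%:R / q%:R)) =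
  csum q r U * (Xc * Yc - Xs * Ys) + ssum q r U * (Xs * Yc + Xc * Ys).
  rewrite [Xc * Yc]big_distrlr [Xs * Ys]big_distrlr [Xs * Yc]big_distrlr [Xc * Ys]big_distrlr /=.
  rewrite -sumrB -big_split /= !big_distrlr /= -big_split /=.
  apply: eq_bigr => u _; rewrite -big_split /=; apply: eq_bigr => a _.
  rewrite -sumrB -big_split /= 2!mulr_sumr -big_split /=; apply: eq_bigr => b _.
  have -> : 2 * pi * (r%:R * (a + b)%:R / q%:R) =
    2 * pi * (r%:R * a%:R / q%:R) + 2 * pi * (r%:R * b%:R / q%:R) :> R by rewrite natrD; ring.
  by rewrite cosB cosD sinD.
move: (csum q r U) (ssum q r U) cM sM => Uc Us cM sM.
rewrite /norm2 -/Xc -/Xs -/Yc -/Ys.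
move: Xc Xs Yc Ys => a b c d.
have M0 : 0 <= M by exact: le_trans cM.
have h (x y z : R) : `|x| <= M -> `|y| <= z -> - (M * z) <= x * y.
  move=> xM yz; have : `|x * y| <= M * z by rewrite normrM ler_pM.
  by rewrite ler_norml => /andP[].
have n1 : `|a * c - b * d| <= (a ^+ 2 + b ^+ 2 + (c ^+ 2 + d ^+ 2)) / 2.
  have := sqr_ge0 (a - c); have := sqr_ge0 (a + c).
  have := sqr_ge0 (b - d); have := sqr_ge0 (b + d).
  by move=> ????; rewrite ler_norml; apply/andP; split; nra.
have n2 : `|b * c + a * d| <= (a ^+ 2 + b ^+ 2 + (c ^+ 2 + d ^+ 2)) / 2.
  have := sqr_ge0 (a - d); have := sqr_ge0 (a + d).
  have := sqr_ge0 (b - c); have := sqr_ge0 (b + c).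
  by move=> ????; rewrite ler_norml; apply/andP; split; nra.
have := h _ _ _ cM n1; have := h _ _ _ sM n2; lra.
Qed.

(** Without a solution, orthogonality makes the triple sums over all frequencies add up to 0; the
    frequency 0 alone gives |U| |X| |Y|, which the others are too small to cancel. *)
Lemma fourier_criterion q (U X Y : seq nat) (M : nat -> R) : (0 < q)%N ->
  (forall r, (0 < r < q)%N -> `|csum q r U| <= M r /\ `|ssum q r U| <= M r) ->
  \sum_(1 <= r < q) M r * (norm2 q r X + norm2 q r Y) <
    (size U)%:R * (size X)%:R * (size Y)%:R ->
  exists u a b, [/\ u \in U, a \in X, b \in Y & u = (a + b)%N %[mod q]].
Proof.
move=> q0 MU lt; apply: contrapT => nex.
have : \sum_(r < q) \sum_(u <- U) \sum_(a <- X) \sum_(b <- Y)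
    cos (2 * pi * (r%:R * u%:R / q%:R) - 2 * pi * (r%:R * (a + b)%:R / q%:R)) = 0 :> R.
  rewrite exchange_big /= big_seq big1// => u uU.
  rewrite exchange_big /= big_seq big1// => a aX.
  rewrite exchange_big /= big_seq big1// => b bY.
  by apply: sum_cos_diff => // e; apply: nex; exists u, a, b.
pose T r : R := \sum_(u <- U) \sum_(a <- X) \sum_(b <- Y)
    cos (2 * pi * (r%:R * u%:R / q%:R) - 2 * pi * (r%:R * (a + b)%:R / q%:R)).
rewrite -(big_mkord xpredT T) big_ltn//.
have -> : T 0%N = (size U)%:R * (size X)%:R * (size Y)%:R.
  rewrite -mulrA -!sum_seq_const; apply: eq_bigr => u _.
  apply: eq_bigr => a _.
  rewrite -[(size Y)%:R]mulr1 -sum_seq_const; apply: eq_bigr => b _.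
  by rewrite !mul0r mulr0 subrr cos0.
have : - (\sum_(1 <= r < q) M r * (norm2 q r X + norm2 q r Y)) <= \sum_(1 <= r < q) T r.
  rewrite -sumrN; apply: ler_sum_nat => r rq.
  by have [h1 h2] := MU r rq; apply: trilinear_bound.
lra.
Qed.

(* If floor (G v) = (G x + i) + (G y + i') with i + i' < G, then
   floor v = x + y; replacing x by the points G x + i makes the Fourier transform
   decay at high frequencies. *)
Definition thicken (G G1 : nat) (A : seq nat) : seq nat :=
  [seq (G * x + i)%N | x <- A, i <- iota 0 G1].

(** The thickened set is the direct sum of G A and an interval, and the transform of a convolution
    is a product. *)
Lemma norm2_thicken q r G G1 A :
  norm2 q r (thicken G G1 A) = norm2 q r [seq (G * x)%N | x <- A] * norm2 q r (iota 0 G1).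
Proof.
set X := [seq _ | x <- A].
have e (x i : nat) : 2 * pi * (r%:R * (G * x + i)%:R / q%:R) =
  2 * pi * (r%:R * (G * x)%:R / q%:R) + 2 * pi * (r%:R * i%:R / q%:R) :> R by rewrite natrD; ring.
have -> : norm2 q r (thicken G G1 A) =
  (csum q r X * csum q r (iota 0 G1) - ssum q r X * ssum q r (iota 0 G1)) ^+ 2 +
  (ssum q r X * csum q r (iota 0 G1) + csum q r X * ssum q r (iota 0 G1)) ^+ 2.
  rewrite /norm2 /csum /ssum !big_distrlr /= -sumrB -big_split /=.
  rewrite !big_allpairs_dep !big_map /=; congr (_ ^+ 2 + _ ^+ 2); apply: eq_bigr => x _.
    by rewrite -sumrB; apply: eq_bigr => i _; rewrite e cosD.
  by rewrite -big_split; apply: eq_bigr => i _; rewrite e sinD.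
by rewrite /norm2; ring.
Qed.

Lemma size_thicken G G1 A : size (thicken G G1 A) = (size A * G1)%N.
Proof. by rewrite size_allpairs size_iota. Qed.

Lemma uniq_thicken G G1 A : (G1 <= G)%N -> uniq A -> uniq (thicken G G1 A).
Proof.
move=> G1G uA; apply: allpairs_uniq => //; first exact: iota_uniq.
move=> [x i] [y j] /allpairsPdep[x' [i' [_ + [-> ->]]]].
rewrite mem_iota add0n /= => iG /allpairsPdep[y' [j' [_ + [-> ->]]]].
rewrite mem_iota add0n /= => jG e.
have G0 : (0 < G)%N by lia.
have := congr1 (fun n => n %% G)%N e; have := congr1 (fun n => n %/ G)%N e.
rewrite ![(G * _)%N]mulnC !modnMDl !divnMDl// !(modn_small (leq_trans _ G1G))//.
by rewrite !(divn_small (leq_trans _ G1G))// !addn0 => -> ->.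
Qed.

Lemma thicken_lt G G1 P A : (G1 <= G)%N -> all (fun a => (a < P)%N) A ->
  all (fun a => (a < G * P)%N) (thicken G G1 A).
Proof.
move=> G1G /allP AP; apply/allP => z /allpairsPdep[x [i [xA]]].
rewrite mem_iota add0n => /andP[_ iG] ->.
have xP := AP _ xA; apply: (@leq_trans (G * x.+1)); first by rewrite mulnS; lia.
by rewrite leq_mul2l xP orbT.
Qed.

(** The transform of an interval is O(q / r) whatever its length: a linear phase of slope r / q
    satisfies [kuzmin_landau] with [lam] half the slope. *)
Lemma norm2_iota_le q r G1 (kappa : R) : 0 < kappa -> (0 < r)%N -> (2 * r <= q)%N ->
  kappa * q%:R <= r%:R -> norm2 q r (iota 0 G1) <= 8 / kappa ^+ 2.
Proof.
move=> k0 r0 rq kr.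
have q0 : 0 < q%:R :> R by rewrite ltr0n; lia.
have r0r : 0 < r%:R :> R by rewrite ltr0n.
have rqr : 2 * r%:R <= q%:R :> R by rewrite -natrM ler_nat.
set lam : R := r%:R / q%:R / 2.
have lam0 : 0 < lam by rewrite /lam !divr_gt0.
have klam : kappa <= 2 * lam.
  rewrite /lam mulrC divfK// ler_pdivlMr//.
have lam4 : lam <= 4^-1.
  have : r%:R / q%:R <= 2^-1 :> R by rewrite ler_pdivrMr//; lra.
  by rewrite /lam; lra.
have key (c : R) : `|\sum_(i < G1) cos (2 * pi * (r%:R / q%:R * i%:R - c))| <= 2 / kappa.
  have d n : diff (fun i => r%:R / q%:R * i%:R - c) n = 2 * lam.
    by rewrite /diff -[n.+1%:R]natr1 /lam; field; rewrite gt_eqF.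
  have db n : (n <= G1)%N -> lam <= diff (fun i => r%:R / q%:R * i%:R - c) n <= 2 * lam.
    by move=> _; rewrite d; apply/andP; split; lra.
  have dm : monotone_upto G1 (diff (fun i => r%:R / q%:R * i%:R - c)).
    by left => n _; rewrite !d.
  have := kuzmin_landau lam0 lam4 db dm.
  set S := `|_| => h.
  have S0 : 0 <= S by exact: normr_ge0.
  by rewrite ler_pdivlMr//; nra.
have kc : `|csum q r (iota 0 G1)| <= 2 / kappa.
  have := key 0; rewrite -(big_mkord xpredT (fun i => cos (2 * pi * (r%:R / q%:R * i%:R - 0)))).
  rewrite /index_iota subn0; set a := bigop _ _ _; set b := csum _ _ _.
  have -> // : a = b by apply: eq_bigr => i _; congr cos; ring.
have ks : `|ssum q r (iota 0 G1)| <= 2 / kappa.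
  have := key (4^-1); rewrite -(big_mkord xpredT (fun i => cos (2 * pi * (r%:R / q%:R * i%:R - 4^-1)))).
  rewrite /index_iota subn0; set a := bigop _ _ _; set b := ssum _ _ _.
  have -> // : a = b.
  by apply: eq_bigr => i _; rewrite -cosBpihalf; congr cos; field; rewrite gt_eqF.
have -> : 8 / kappa ^+ 2 = (2 / kappa) ^+ 2 + (2 / kappa) ^+ 2 by field; rewrite gt_eqF.
by apply: lerD; rewrite -real_normK ?num_real// lerXn2r ?nnegrE// divr_ge0// ltW.
Qed.

(** At low frequencies U saves [eps], and Parseval for the thickened sets costs q |A| G1. At high
    frequencies U is bounded trivially, but the interval factor is at most 8 / kappa^2, and Parseval
    is applied to the dilates G A and G B, which are smaller by the factor G1. *)
Lemma circle_method (G G1 P : nat) (U A B : seq nat) (kappa eps : R) :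
  0 <= eps -> (0 < G1 <= G)%N -> (0 < P)%N -> uniq A -> uniq B ->
  all (fun a => (a < P)%N) A -> all (fun a => (a < P)%N) B -> 0 < kappa ->
  (forall r, (0 < r)%N -> (2 * r <= G * P)%N -> r%:R <= kappa * (G * P)%:R ->
    `|csum (G * P) r U| <= eps * (size U)%:R /\ `|ssum (G * P) r U| <= eps * (size U)%:R) ->
  (size U)%:R * ((eps * (G * P)%:R * G1%:R + 8 / kappa ^+ 2 * (G * P)%:R) *
     ((size A)%:R + (size B)%:R)) < (size U)%:R * (G1%:R ^+ 2 * (size A)%:R * (size B)%:R) ->
  exists u x y i i', [/\ u \in U, x \in A, y \in B, (i < G1)%N /\ (i' < G1)%N &
    u = ((G * x + i) + (G * y + i'))%N %[mod (G * P)]].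
Proof.
move=> eps0 /andP[G10 G1G] P0 uA uB AP BP k0 HU.
set q := (G * P)%N in HU *.
have q0 : (0 < q)%N by rewrite muln_gt0 P0 andbT (leq_trans G10).
set X := thicken G G1 A; set Y := thicken G G1 B.
set GA := [seq (G * x)%N | x <- A]; set GB := [seq (G * x)%N | x <- B].
set Lr := (size U)%:R; set D := 8 / kappa ^+ 2.
have D0 : 0 <= D by rewrite divr_ge0// exprn_ge0// ltW.
move=> lt.
suff [u [a [b [uU aX bY]]]] :
   exists u a b, [/\ u \in U, a \in X, b \in Y & u = (a + b)%N %[mod q]].
  case/allpairsPdep: aX => x [i [xA + ->]]; case/allpairsPdep: bY => y [i' [yB + ->]].
  rewrite !mem_iota !add0n => i'G iG e.
  by exists u, x, y, i, i'.
(* Low frequencies are those close to 0 modulo q, from either side; r and q - r have conjugate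
   transforms. *)
pose good r := (((2 * r <= q)%N && (r%:R <= kappa * q%:R)) ||
   ((2 * (q - r) <= q)%N && ((q - r)%:R <= kappa * q%:R))).
pose M r : R := if good r then eps * Lr else Lr.
apply: (@fourier_criterion q U X Y M) => //.
  move=> r /andP[r0 rq]; rewrite /M /good; case: ifP => [|_]; last exact: csum_ssum_size.
  move=> /orP[/andP[h1 h2]|/andP[h1 h2]]; first exact: HU.
  have -> : csum q r U = csum q (q - r) U by rewrite csum_opp// ltnW.
  have -> : `|ssum q r U| = `|ssum q (q - r) U| by rewrite ssum_opp ?normrN// ltnW.
  by apply: HU => //; rewrite subn_gt0.
have bound r : (0 < r < q)%N -> M r * (norm2 q r X + norm2 q r Y) <=
    eps * Lr * (norm2 q r X + norm2 q r Y) + Lr * D * (norm2 q r GA + norm2 q r GB).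
  move=> /andP[r0 rq]; rewrite /M; case: ifPn => g.
    by rewrite lerDl; apply: mulr_ge0; [exact: mulr_ge0|apply: addr_ge0; exact: norm2_ge0].
  rewrite -[leLHS]add0r; apply: lerD.
    by apply: mulr_ge0; [exact: mulr_ge0|apply: addr_ge0; exact: norm2_ge0].
  rewrite -mulrA ler_wpM2l//.
  have DD : norm2 q r (iota 0 G1) <= D.
    move: g; rewrite /good negb_or !negb_and => /andP[g1 g2].
    have [h|h] := leqP (2 * r) q.
      move: g1; rewrite h /= -ltNge => g1.
      by apply: norm2_iota_le => //; exact: ltW.
    have h' : (2 * (q - r) <= q)%N by clear -h; lia.
    move: g2; rewrite h' /= -ltNge => g2.
    have -> : norm2 q r (iota 0 G1) = norm2 q (q - r) (iota 0 G1).
      by rewrite /norm2 csum_opp ?ssum_opp ?sqrrN// ltnW.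
    by apply: norm2_iota_le => //; [rewrite subn_gt0|exact: ltW].
  rewrite !norm2_thicken -/GA -/GB (mulrDr D).
  by apply: lerD; rewrite mulrC ler_wpM2r ?norm2_ge0.
apply: le_lt_trans; first by apply: ler_sum_nat => r rq; exact: bound.
have ext (f : nat -> R) : (forall r, 0 <= f r) -> \sum_(1 <= r < q) f r <= \sum_(r < q) f r.
  by move=> f0; rewrite -(big_mkord xpredT f) [leRHS]big_ltn// lerDr.
rewrite big_split /= -!mulr_sumr.
have SX Z : uniq Z -> all (fun a => (a < q)%N) Z ->
    \sum_(1 <= r < q) norm2 q r Z <= q%:R * (size Z)%:R.
  by move=> uZ Zq; rewrite -parseval//; apply: ext => r; exact: norm2_ge0.
have sG Z : uniq Z -> all (fun a => (a < P)%N) Z ->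
   uniq [seq (G * x)%N | x <- Z] /\ all (fun a => (a < q)%N) [seq (G * x)%N | x <- Z].
  move=> uZ /allP ZP; have G0 : (0 < G)%N by exact: leq_trans G1G.
  split; first by rewrite map_inj_uniq// => a b /eqP; rewrite eqn_pmul2l// => /eqP.
  by apply/allP => z /mapP[x /ZP xP ->]; rewrite /q ltn_pmul2l.
have hX := SX X (uniq_thicken G1G uA) (thicken_lt G1G AP).
have hY := SX Y (uniq_thicken G1G uB) (thicken_lt G1G BP).
have [uGA GAq] := sG _ uA AP; have [uGB GBq] := sG _ uB BP.
have hGA := SX _ uGA GAq; have hGB := SX _ uGB GBq.
move: hX hY hGA hGB; rewrite !size_map !size_thicken => hX hY hGA hGB.
apply: (@le_lt_trans _ _ (eps * Lr * (q%:R * (size A * G1)%:R + q%:R * (size B * G1)%:R) +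
   Lr * D * (q%:R * (size A)%:R + q%:R * (size B)%:R))).
  by apply: lerD; (apply: ler_wpM2l; [exact: mulr_ge0|rewrite big_split; exact: lerD]).
rewrite (natrM _ (size A)) (natrM _ (size B)); move: lt; rewrite -/Lr -/D -/q.
by congr (_ < _); ring.
Qed.

End Fourier.

(** * Chebyshev's lower bound *)

Lemma leq_expn2_central_binomial n : (2 ^ n <= 'C(n.*2, n))%N.
Proof.
elim: n => // n IH; rewrite expnS.
apply: (leq_trans (leq_mul (leqnn 2) IH)).
have h : ('C(n.*2, n) <= 'C(n.*2.+1, n.+1))%N by rewrite binS leq_addl.
have -> : 'C(n.+1.*2, n.+1) = ('C(n.*2.+1, n.+1) + 'C(n.*2.+1, n.+1))%N.
  rewrite doubleS binS; congr (_ + _)%N.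
  rewrite -[in RHS]bin_sub; last by rewrite ltnS -addnn leq_addr.
  by congr 'C(_, _); rewrite -addnn; lia.
by rewrite mul2n -addnn leq_add.
Qed.

(** Legendre's formula: floor (2n / p^k) exceeds 2 floor (n / p^k) by at most 1, and by 0 once p^k >
    2n, so the exponent is at most the largest k with p^k <= 2n. *)
Lemma expn_logn_central_binomial p n : prime p -> (0 < n)%N ->
  (p ^ logn p 'C(n.*2, n) <= n.*2)%N.
Proof.
move=> pp n0.
have p1 := prime_gt1 pp.
have [m mE] : exists m, m = n.*2 by eexists.
rewrite -mE; have nm : (n <= m)%N by rewrite mE -addnn leq_addr.
have m0 : (0 < m)%N by exact: leq_trans nm.
have e : (logn p m`! = logn p 'C(m, n) + (logn p n`! + logn p n`!))%N.
  rewrite -(bin_fact nm).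
  have -> : (m - n = n)%N by rewrite mE -addnn addnK.
  by rewrite !lognM ?muln_gt0 ?fact_gt0 ?bin_gt0.
have ext : (logn p n`! = \sum_(1 <= k < m.+1) n %/ p ^ k)%N.
  rewrite logn_fact// [RHS](@big_cat_nat _ _ _ n.+1)//=.
  rewrite -[LHS]addn0; congr (_ + _)%N; rewrite big_nat_cond big1// => k /andP[/andP[nk _] _].
  by rewrite divn_small// (leq_trans nk)// ltnW// ltn_expl.
apply: (@leq_trans (p ^ trunc_log p m)); last exact: trunc_logP.
rewrite leq_exp2l//.
suff : (logn p m`! <= trunc_log p m + (logn p n`! + logn p n`!))%N.
  by rewrite e leq_add2r.
rewrite logn_fact// ext -!big_split /=.
apply: (@leq_trans (\sum_(1 <= k < m.+1) ((k <= trunc_log p m) + (n %/ p ^ k + n %/ p ^ k)))%N).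
  apply: leq_sum => k _.
  have pk : (0 < p ^ k)%N by rewrite expn_gt0 prime_gt0.
  case: (leqP k (trunc_log p m)) => h /=.
    rewrite add1n -ltnS ltn_divLR// mE -addnn.
    have : (n < (n %/ p ^ k).+1 * p ^ k)%N by rewrite -ltn_divLR.
    clear; nia.
  rewrite divn_small// ltnNge; apply/negP => pm.
  by move: h; rewrite ltnNge trunc_log_max.
rewrite big_split /= leq_add2r.
apply: leq_trans (sum_window m.+1 1 (trunc_log p m)).
by rewrite big_add1 /= big_mkord big_ord_recl /= add0n.
Qed.

Lemma prime_dvd_fact_leq p m : prime p -> (p %| m`!)%N -> (p <= m)%N.
Proof.
move=> pp; elim: m => [|m IH]; first by rewrite fact0 Euclid_dvd1.
rewrite factS Euclid_dvdM// => /orP[/dvdn_leq->//|/IH h]; exact: ltnW.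
Qed.

Lemma central_binomial_le n (s : seq nat) : (0 < n)%N ->
  (forall p, prime p -> (p <= n.*2)%N -> p \in s) ->
  ('C(n.*2, n) <= n.*2 ^ size s)%N.
Proof.
move=> n0 hs.
have C0 : (0 < 'C(n.*2, n))%N by rewrite bin_gt0 -addnn leq_addr.
rewrite [X in (X <= _)%N](prod_prime_decomp C0) prime_decompE big_map /=.
apply: (@leq_trans (\prod_(p <- primes 'C(n.*2, n)) n.*2)).
  rewrite !big_seq; apply: leq_prod => p; rewrite mem_primes => /and3P[pp _ _].
  exact: expn_logn_central_binomial.
rewrite big_const_seq count_predT iter_muln_1 leq_pexp2l ?double_gt0//.
apply: uniq_leq_size; first exact: primes_uniq.
move=> p; rewrite mem_primes => /and3P[pp _ pC]; apply: hs => //.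
have : (p %| n.*2`!)%N.
  by rewrite -(bin_fact (_ : n <= n.*2)%N) ?dvdn_mulr// -addnn leq_addr.
exact: prime_dvd_fact_leq.
Qed.

Lemma count_upto_seq (A : set nat) N : exists s : seq nat,
  [/\ uniq s, size s = count_upto A N & forall x, x \in s <-> A x /\ (1 <= x <= N)%N].
Proof.
have fin : finite_set (A `&` [set n | (1 <= n <= N)%N]).
  apply: sub_finite_set (finite_II N.+1) => x [_ /= /andP[_ h]].
  by rewrite /= ltnS.
exists (fset_set (A `&` [set n | (1 <= n <= N)%N])).
split=> [||x]; [exact: fset_uniq|by []|].
by rewrite in_fset_set// in_setE /=.
Qed.

(** With n = floor (N / 2), the binomial C(2n, n) is at least 2^n and is a product of prime powers,
    each at most 2n; taking logarithms bounds the number of primes from below. *)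
Lemma chebyshev_lower (R : realType) : exists2 c : R, 0 < c &
  forall N, (2 <= N)%N -> c * N%:R <= (count_upto primes_set N)%:R * ln N%:R.
Proof.
exists (ln 2 / 3) => [|N N2].
  by rewrite divr_gt0// ln_gt0// ltr1n.
have [s [us <- hs]] := count_upto_seq primes_set N.
have [n [n0 nN Nn]] : exists n, [/\ (0 < n)%N, (n.*2 <= N)%N & (N <= 3 * n)%N].
  exists N./2; split; lia.
have h : (2 ^ n <= n.*2 ^ size s)%N.
  apply: leq_trans (leq_expn2_central_binomial n) _.
  apply: central_binomial_le => // p pp pn; apply/hs; split=> //.
  by rewrite prime_gt0// (leq_trans pn).
have ln2 : 0 < ln 2 :> R by rewrite ln_gt0// ltr1n.
have N0 : 0 < N%:R :> R by rewrite ltr0n; apply: leq_trans N2.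
have : n%:R * ln 2 <= (size s)%:R * ln N%:R :> R.
  have : ln (2 ^+ n) <= ln (N%:R ^+ size s) :> R.
    rewrite ler_ln ?posrE ?exprn_gt0// -!natrX ler_nat.
    by apply: (leq_trans h); case: (size s) => // k; rewrite leq_exp2r.
  by rewrite !lnXn// -[ln 2 *+ n]mulr_natl -[ln N%:R *+ _]mulr_natl.
have : N%:R <= 3 * n%:R :> R by rewrite -natrM ler_nat.
nra.
Qed.

(** * Hardy fields *)

Section Hardy.
Context {R : realType}.
Implicit Types (f g p q df dg : R -> R) (H A : set (R -> R)).

Lemma near_pinftyP (P : R -> Prop) :
  (\forall x \near +oo, P x) <-> exists a, forall x, a < x -> P x.
Proof.
split=> [[a [_ h]]|[a h]]; first by exists a.
by exists a; split=> //; exact: num_real.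
Qed.

Lemma near_pinfty_near (P : R -> Prop) : (\forall x \near +oo, P x) ->
  \forall x \near +oo, \forall y \near x, P y.
Proof.
move=> /near_pinftyP[a h]; apply/near_pinftyP; exists a => x ax.
by near=> y; apply: h; near: y; exact: lt_nbhsr.
Unshelve. all: by end_near. Qed.

Lemma mvt f df (a u v : R) : (forall x, a < x -> is_derive x 1 f (df x)) ->
  a < u -> u < v -> exists2 c, u < c < v & f v - f u = df c * (v - u).
Proof.
move=> fd au uv.
have [||c] := @MVT R f df u v uv.
- by move=> x; rewrite in_itv/= => /andP[ux _]; apply: fd; exact: lt_trans ux.
- apply: derivable_within_continuous => x; rewrite in_itv/= => /andP[ux _].
  by have [] := fd x (lt_le_trans au ux).
- by rewrite in_itv/= => h e; exists c.
Qed.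

Lemma is_deriveD' f g (x a b : R) : is_derive x 1 f a -> is_derive x 1 g b ->
  is_derive x 1 (fun y => f y + g y) (a + b).
Proof. exact: is_deriveD. Qed.

Lemma is_deriveM' f g (x a b : R) : is_derive x 1 f a -> is_derive x 1 g b ->
  is_derive x 1 (fun y => f y * g y) (a * g x + f x * b).
Proof.
move=> fa gb; have := is_deriveM fa gb; rewrite /GRing.scale/= => h.
by rewrite (_ : _ + _ = f x * b + g x * a) //; ring.
Qed.

Lemma is_deriveN' f (x a : R) : is_derive x 1 f a -> is_derive x 1 (fun y => - f y) (- a).
Proof. exact: is_deriveN. Qed.

Lemma is_deriveV' f (x a : R) : f x != 0 -> is_derive x 1 f a ->
  is_derive x 1 (fun y => (f y)^-1) (- a / f x ^+ 2).
Proof.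
move=> fx fa; have := is_deriveV fx fa; rewrite /GRing.scale/= => h.
by rewrite (_ : _ / _ = - f x ^- 2 * a) //; ring.
Qed.

Definition eventually_derive f df : Prop := \forall x \near +oo, is_derive (x : R) (1 : R) f (df x).

Lemma same_germ_refl f : same_germ f f. Proof. exact: nearW. Qed.

Lemma same_germ_sym f g : same_germ f g -> same_germ g f.
Proof. by apply: filterS => x ->. Qed.

Lemma same_germ_trans f g h : same_germ f g -> same_germ g h -> same_germ f h.
Proof. by apply: filterS2 => x -> ->. Qed.

Lemma eventually_derive_germ f g df dg : same_germ f g -> same_germ df dg ->
  eventually_derive f df -> eventually_derive g dg.
Proof.
move=> /near_pinfty_near fg; apply: filterS3 fg => x fg e [d1 d2].
split; first exact: near_eq_derivable d1.
by rewrite -e -d2; apply/esym/near_eq_derive.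
Qed.

Lemma eventually_derive1 f df : eventually_derive f df -> same_germ (derive1 f) df.
Proof. by apply: filterS => x [_ <-]; rewrite derive1E. Qed.

Lemma eventually_deriveD f g df dg : eventually_derive f df -> eventually_derive g dg ->
  eventually_derive (fun x => f x + g x) (fun x => df x + dg x).
Proof. by apply: filterS2 => x; exact: is_deriveD'. Qed.

Lemma eventually_deriveM f g df dg : eventually_derive f df -> eventually_derive g dg ->
  eventually_derive (fun x => f x * g x) (fun x => df x * g x + f x * dg x).
Proof. by apply: filterS2 => x; exact: is_deriveM'. Qed.

Lemma eventually_deriveN f df : eventually_derive f df ->
  eventually_derive (fun x => - f x) (fun x => - df x).
Proof. by apply: filterS => x; exact: is_deriveN'. Qed.

(** This trichotomy is what lets a ring of germs have a field of fractions, since nonzero germs then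
    vanish at no large x; applied to differences, it makes any two elements of a Hardy field
    comparable. *)
Definition has_sign f : Prop := [\/ same_germ f (fun=> 0),
  \forall x \near +oo, 0 < f x | \forall x \near +oo, f x < 0].

Lemma has_sign_germ f g : same_germ f g -> has_sign f -> has_sign g.
Proof.
move=> fg [h|h|h]; [apply: Or31|apply: Or32|apply: Or33].
- exact: same_germ_trans (same_germ_sym fg) h.
- by apply: filterS2 fg h => x ->.
- by apply: filterS2 fg h => x ->.
Qed.

Lemma has_signN f : has_sign f -> has_sign (fun x => - f x).
Proof.
move=> [h|h|h]; [apply: Or31|apply: Or33|apply: Or32]; apply: filterS h => x.
- by move=> ->; rewrite oppr0.
- by rewrite oppr_lt0.
- by rewrite oppr_gt0.
Qed.

Lemma has_signM f g : has_sign f -> has_sign g -> has_sign (fun x => f x * g x).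
Proof.
move=> [h|h|h] [k|k|k]; (try by apply: Or31; apply: filterS2 h k => x -> _; rewrite mul0r);
  (try by apply: Or31; apply: filterS2 h k => x _ ->; rewrite mulr0).
- by apply: Or32; apply: filterS2 h k => x; exact: mulr_gt0.
- by apply: Or33; apply: filterS2 h k => x h k; rewrite pmulr_rlt0.
- by apply: Or33; apply: filterS2 h k => x h k; rewrite pmulr_llt0.
- by apply: Or32; apply: filterS2 h k => x h k; rewrite nmulr_rgt0.
Qed.

(** A strictly monotone function changes sign at most once, and one with zero derivative is
    eventually constant. *)
Lemma has_sign_derive f df : eventually_derive f df -> has_sign df -> has_sign f.
Proof.
have pos g dg : eventually_derive g dg -> (\forall x \near +oo, 0 < dg x) -> has_sign g.
  move=> /near_pinftyP[a ga] /near_pinftyP[b gb].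
  set m := Num.max a b.
  have incr u v : m < u -> u < v -> g u < g v.
    rewrite gt_max => /andP[au bu] uv.
    have [c /andP[uc cv] e] := mvt ga au uv.
    by rewrite -subr_gt0 e mulr_gt0 ?subr_gt0// gb// (lt_trans bu).
  have [[x0 [mx0 g0]]|no] := pselect (exists x0, m < x0 /\ 0 <= g x0).
    apply: Or32; apply/near_pinftyP; exists x0 => x x0x.
    by apply: le_lt_trans g0 _; exact: incr.
  apply: Or33; apply/near_pinftyP; exists m => x mx.
  by rewrite ltNge; apply/negP => g0; apply: no; exists x.
move=> fd [df0|df0|df0].
- move/near_pinftyP: fd => [a fa]; move/near_pinftyP: df0 => [b fb].
  set m := Num.max a b + 1.
  have [am bm] : a < m /\ b < m.
    by split; rewrite /m ltr_pwDr// le_max lexx ?orbT.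
  have cst x : m < x -> f x = f m.
    move=> mx; have [c /andP[mc _] e] := mvt fa am mx.
    by apply/eqP; rewrite -subr_eq0 e fb ?mul0r// (lt_trans bm).
  case: (ltgtP (f m) 0) => h; [apply: Or33|apply: Or32|apply: Or31];
    by apply/near_pinftyP; exists m => x /cst ->.
- exact: pos df0.
- have : has_sign (fun x => - f x).
    apply: (pos _ (fun x => - df x)); first exact: eventually_deriveN.
    by apply: filterS df0 => x; rewrite oppr_gt0.
  by move=> /has_signN; apply: has_sign_germ; apply: nearW => x; rewrite opprK.
Qed.

Lemma hardy_has_derive H f : hardy_field H -> H f -> eventually_derive f (derive1 f).
Proof.
move=> hH Hf; apply: filterS (hardy_derivable hH Hf) => x d.
by split=> //; rewrite derive1E.
Qed.

(** A nonzero element has an inverse, so it has no large zeros, and by continuity it cannot change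
    sign without one. *)
Lemma hardy_has_sign H f : hardy_field H -> H f -> has_sign f.
Proof.
move=> hH Hf; have [|nz] := pselect (same_germ f (fun=> 0)); first exact: Or31.
have [g Hg fg] := hardyV hH Hf nz.
have /near_pinftyP[a fa] : \forall x \near +oo, f x != 0.
  apply: filterS fg => x e; apply/eqP => fx0; move: e; rewrite fx0 mul0r.
  by move/esym/eqP; rewrite oner_eq0.
have /near_pinftyP[b fb] := hardy_continuous hH Hf.
set m := Num.max a b + 1.
have [am bm] : a < m /\ b < m by split; rewrite /m ltr_pwDr// le_max lexx ?orbT.
have nosign x : m < x -> ~~ (Num.min (f m) (f x) <= 0 <= Num.max (f m) (f x)).
  move=> mx; apply/negP => mm.
  have [|c] := IVT (ltW mx) _ mm.
    apply: continuous_in_subspaceT => y; rewrite inE /= in_itv /= => /andP[my _].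
    by apply: fb; exact: lt_le_trans my.
  rewrite in_itv/= => /andP[mc _] fc0.
  by have := fa c (lt_le_trans am mc); rewrite fc0 eqxx.
have fm0 := fa m am.
case: (ltgtP (f m) 0) fm0 => // h _; [apply: Or33|apply: Or32];
  apply/near_pinftyP; exists m => x mx; have := nosign x mx;
  rewrite ge_min le_max negb_and !negb_or -!ltNge.
  by move=> /orP[/andP[+ _]|/andP[_]//]; rewrite ltNge (ltW h).
by move=> /orP[/andP[_]//|/andP[+ _]]; rewrite ltNge (ltW h).
Qed.

End Hardy.

(** * Adjoining an antiderivative to a Hardy field *)

Section Adjunction.
Context {R : realType}.
Implicit Types (f g p q df dg : R -> R) (H A : set (R -> R)).

(** A differential ring of germs with eventual signs. These properties suffice for its fractions to
    form a Hardy field, so an extension only has to be checked on polynomials. *)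
Record germ_ring A : Prop := GermRing {
  germ_ring_saturated : forall f g, same_germ f g -> A f -> A g;
  germ_ring0 : A (fun=> 0);
  germ_ring1 : A (fun=> 1);
  germ_ringN : forall f, A f -> A (fun x => - f x);
  germ_ringD : forall f g, A f -> A g -> A (fun x => f x + g x);
  germ_ringM : forall f g, A f -> A g -> A (fun x => f x * g x);
  germ_ring_derive : forall f, A f -> exists2 df, A df & eventually_derive f df;
  germ_ring_sign : forall f, A f -> has_sign f
}.

Lemma has_sign_neq0 q : has_sign q -> ~ same_germ q (fun=> 0) ->
  \forall x \near +oo, q x != 0.
Proof.
move=> [h|h|h] nz; first by have := nz h.
  by apply: filterS h => x h; rewrite gt_eqF.
by apply: filterS h => x h; rewrite lt_eqF.
Qed.

Lemma near_neq0_not_germ0 q : (\forall x \near +oo, q x != 0) -> ~ same_germ q (fun=> 0).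
Proof.
move=> h k.
have /near_pinftyP[a /(_ (a + 1))] : \forall x \near +oo, (fun _ : R => False) x.
  by apply: filterS2 h k => x /eqP.
by apply; rewrite ltrDl.
Qed.

Definition fractions A : set (R -> R) := [set g | exists p q,
  [/\ A p, A q, ~ same_germ q (fun=> 0) & same_germ g (fun x => p x / q x)]].

Lemma fractions_hardy_field A : germ_ring A -> hardy_field (fractions A).
Proof.
move=> rA.
have nz q : A q -> ~ same_germ q (fun=> 0) -> \forall x \near +oo, q x != 0.
  by move=> Aq; apply: has_sign_neq0; exact: germ_ring_sign Aq.
have nzM q q' : A q -> ~ same_germ q (fun=> 0) -> A q' -> ~ same_germ q' (fun=> 0) ->
    ~ same_germ (fun x => q x * q' x) (fun=> 0).
  move=> Aq q0 Aq' q0'; apply: near_neq0_not_germ0.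
  by apply: filterS2 (nz _ Aq q0) (nz _ Aq' q0') => x h k; rewrite mulf_neq0.
have one0 : ~ same_germ (fun _ : R => 1 : R) (fun=> 0).
  by apply: near_neq0_not_germ0; apply: nearW => x; exact: oner_neq0.
have deriv g : fractions A g -> exists2 dg, fractions A dg & eventually_derive g dg.
  move=> [p [q [Ap Aq q0 gpq]]].
  have [dp Adp pd] := germ_ring_derive rA Ap; have [dq Adq qd] := germ_ring_derive rA Aq.
  exists (fun x => (dp x * q x + - (p x * dq x)) / (q x * q x)).
    exists (fun x => dp x * q x + - (p x * dq x)), (fun x => q x * q x); split.
    - by apply: germ_ringD => //; [exact: germ_ringM|apply: germ_ringN => //; exact: germ_ringM].
    - exact: germ_ringM.
    - exact: nzM.
    - exact: same_germ_refl.
  apply: (eventually_derive_germ (same_germ_sym gpq) (same_germ_refl _)).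
  apply: filterS3 (nz _ Aq q0) pd qd => x qx px qx'.
  have := is_deriveM' px (is_deriveV' qx qx').
  by congr is_derive; field.
have emb f : A f -> fractions A f.
  move=> Af; exists f, (fun=> 1); split=> //; first exact: germ_ring1 rA.
  by apply: nearW => x; rewrite divr1.
split.
- move=> f g fg [p [q [Ap Aq q0 fpq]]]; exists p, q; split=> //.
  exact: same_germ_trans (same_germ_sym fg) fpq.
- move=> f /deriv[df _]; apply: filterS => x [d _].
  exact/differentiable_continuous/derivable1_diffP.
- exact/emb/(germ_ring0 rA).
- exact/emb/(germ_ring1 rA).
- move=> f [p [q [Ap Aq q0 fpq]]]; exists (fun x => - p x), q; split=> //.
    exact: germ_ringN.
  by apply: filterS fpq => x ->; rewrite mulNr.
- move=> f g [p [q [Ap Aq q0 fpq]]] [p' [q' [Ap' Aq' q0' gpq]]].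
  exists (fun x => p x * q' x + q x * p' x), (fun x => q x * q' x); split.
  + by apply: germ_ringD => //; exact: germ_ringM.
  + exact: germ_ringM.
  + exact: nzM.
  + near=> x; have -> : f x = p x / q x by near: x.
    have -> : g x = p' x / q' x by near: x.
    have h : q x != 0 by near: x; exact: nz.
    have h' : q' x != 0 by near: x; exact: nz.
    by field; rewrite h h'.
- move=> f g [p [q [Ap Aq q0 fpq]]] [p' [q' [Ap' Aq' q0' gpq]]].
  exists (fun x => p x * p' x), (fun x => q x * q' x); split.
  + exact: germ_ringM.
  + exact: germ_ringM.
  + exact: nzM.
  + by apply: filterS2 fpq gpq => x -> ->; rewrite invfM mulrACA.
- move=> f [p [q [Ap Aq q0 fpq]]] f0.
  have p0 : ~ same_germ p (fun=> 0).
    by move=> h; apply: f0; apply: filterS2 fpq h => x -> ->; rewrite mul0r.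
  exists (fun x => q x / p x); first by exists q, p; split=> //; exact: same_germ_refl.
  apply: filterS3 fpq (nz _ Aq q0) (nz _ Ap p0) => x -> h k.
  by field; rewrite h k.
- by move=> f /deriv[df _]; apply: filterS => x [].
- move=> f /[dup] Ff /deriv[df [p [q [Ap Aq q0 dpq]]]] fd; exists p, q; split=> //.
  exact: same_germ_trans (eventually_derive1 fd) dpq.
Unshelve. all: by end_near. Qed.

Lemma hardy_exp H f n : hardy_field H -> H f -> H (fun x => f x ^+ n).
Proof.
move=> hH Hf; elim: n => [|n IH]; first exact: hardy1.
have := hardyM hH Hf IH; apply: hardy_saturated => //.
by apply: nearW => x; rewrite exprS.
Qed.

Lemma hardy_nat H n : hardy_field H -> H (fun=> n%:R).
Proof.
move=> hH; elim: n => [|n IH]; first exact: hardy0.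
have := hardyD hH IH (hardy1 hH); apply: hardy_saturated => //.
by apply: nearW => x; rewrite -natr1.
Qed.

Variables (H : set (R -> R)) (F f : R -> R).
Hypotheses (hH : hardy_field H) (Hf : H f) (Ff : eventually_derive F f).

(** Germs of polynomials in [F] of degree at most n over H. The leading term is split off, which is
    the shape used by the induction on the degree in [pol_deg_sign]. *)
Fixpoint pol_deg (n : nat) : set (R -> R) :=
  match n with
  | 0 => H
  | m.+1 => [set g | exists a p, [/\ H a, pol_deg m p &
      same_germ g (fun x => a x * F x ^+ m.+1 + p x)]]
  end.

Lemma pol_deg_saturated n g h : same_germ g h -> pol_deg n g -> pol_deg n h.
Proof.
case: n => [|n] gh; first exact: hardy_saturated hH _ _ gh.
by move=> [a [p [Ha pp e]]]; exists a, p; split=> //; exact: same_germ_trans (same_germ_sym gh) e.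
Qed.

Lemma pol_degS n g : pol_deg n g -> pol_deg n.+1 g.
Proof.
move=> pg; exists (fun=> 0), g; split=> //; first exact: hardy0.
by apply: nearW => x; rewrite mul0r add0r.
Qed.

Lemma pol_deg_leq m n g : (m <= n)%N -> pol_deg m g -> pol_deg n g.
Proof. by move=> mn pg; rewrite -(subnK mn); elim: (n - m)%N => // k; exact: pol_degS. Qed.

Lemma pol_degZ n a g : H a -> pol_deg n g -> pol_deg n (fun x => a x * g x).
Proof.
move=> Ha; elim: n g => [|n IH] g; first exact: hardyM.
move=> [b [p [Hb pp e]]]; exists (fun x => a x * b x), (fun x => a x * p x).
split; [exact: hardyM|exact: IH|].
by apply: filterS e => x ->; ring.
Qed.

Lemma pol_degD n g h : pol_deg n g -> pol_deg n h -> pol_deg n (fun x => g x + h x).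
Proof.
elim: n g h => [|n IH] g h; first exact: hardyD.
move=> [a [p [Ha pp e]]] [b [r [Hb pr e']]].
exists (fun x => a x + b x), (fun x => p x + r x); split; [exact: hardyD|exact: IH|].
by apply: filterS2 e e' => x -> ->; ring.
Qed.

Lemma pol_deg_mulF n g : pol_deg n g -> pol_deg n.+1 (fun x => F x * g x).
Proof.
elim: n g => [|n IH] g.
  move=> Hg; exists g, (fun=> 0); split=> //; first exact: (hardy0 hH).
  by apply: nearW => x; rewrite expr1 addr0 mulrC.
move=> [a [p [Ha pp e]]]; exists a, (fun x => F x * p x); split=> //; first exact: IH.
by apply: filterS e => x ->; rewrite [F x ^+ n.+2]exprS; ring.
Qed.

Lemma pol_deg_mulFX m n g : pol_deg n g -> pol_deg (m + n) (fun x => F x ^+ m * g x).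
Proof.
move=> pg; elim: m => [|m IH].
  by apply: pol_deg_saturated pg; apply: nearW => x; rewrite mul1r.
have := pol_deg_mulF IH; apply: pol_deg_saturated.
by apply: nearW => x; rewrite exprS mulrA.
Qed.

Lemma pol_degX m : pol_deg m (fun x => F x ^+ m).
Proof.
have := @pol_deg_mulFX m 0 _ (hardy1 hH : pol_deg 0 _); rewrite addn0.
by apply: pol_deg_saturated; apply: nearW => x; rewrite mulr1.
Qed.

Lemma pol_degM m n g h : pol_deg m g -> pol_deg n h -> pol_deg (m + n) (fun x => g x * h x).
Proof.
move=> + ph; elim: m g => [|m IH] g; first by move=> Hg; exact: pol_degZ.
move=> [a [p [Ha pp e]]].
have h1 := pol_degZ Ha (pol_deg_mulFX m.+1 ph).
have h2 : pol_deg (m.+1 + n) (fun x => p x * h x) by apply: pol_degS; exact: IH.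
apply: pol_deg_saturated (pol_degD h1 h2).
by apply: filterS e => x ->; ring.
Qed.

Lemma eventually_deriveX n : eventually_derive (fun x => F x ^+ n.+1)
  (fun x => n.+1%:R * f x * F x ^+ n).
Proof.
elim: n => [|n IH].
  apply: eventually_derive_germ Ff; apply: nearW => x; first by rewrite expr1.
  by rewrite expr0 mulr1 mul1r.
apply: eventually_derive_germ (eventually_deriveM Ff IH); apply: nearW => x.
  by rewrite [in RHS]exprS.
by rewrite -[n.+2%:R]natr1 [F x ^+ n.+1]exprS; ring.
Qed.

Lemma pol_deg_derive n g : pol_deg n g -> exists2 dg, pol_deg n dg & eventually_derive g dg.
Proof.
elim: n g => [|n IH] g.
  by move=> Hg; exists (derive1 g); [exact: hardy_derive|exact: hardy_has_derive hH Hg].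
move=> [a [p [Ha pp e]]]; have [dp pdp pd] := IH _ pp.
exists (fun x => (derive1 a x * F x ^+ n.+1 + a x * (n.+1%:R * f x * F x ^+ n)) + dp x).
  apply: pol_degD; last exact: pol_degS.
  apply: pol_degD; first by apply: pol_degZ; [exact: hardy_derive|exact: pol_degX].
  apply: pol_degS; apply: pol_degZ => //; apply: pol_degZ; last exact: pol_degX.
  by apply: hardyM => //; exact: hardy_nat.
apply: (eventually_derive_germ (same_germ_sym e) (same_germ_refl _)).
apply: eventually_deriveD pd; apply: eventually_deriveM; last exact: eventually_deriveX.
exact: hardy_has_derive hH Ha.
Qed.

(* Once the leading coefficient is normalized to 1, the derivative has smaller
   degree in F, hence a sign by induction, so the function is eventually
   monotone. *)
Lemma pol_deg_sign n g : pol_deg n g -> has_sign g.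
Proof.
elim: n g => [|n IH] g; first exact: hardy_has_sign.
move=> [a [p [Ha pp e]]].
have [a0|a0] := pselect (same_germ a (fun=> 0)).
  apply: IH; apply: pol_deg_saturated pp.
  by apply: filterS2 e a0 => x -> ->; rewrite mul0r add0r.
have [b Hb ab] := hardyV hH Ha a0.
pose h x := F x ^+ n.+1 + b x * p x.
have [dbp pdbp bpd] := pol_deg_derive (pol_degZ Hb pp).
have hd : eventually_derive h (fun x => n.+1%:R * f x * F x ^+ n + dbp x).
  by apply: eventually_deriveD bpd; exact: eventually_deriveX.
have : has_sign h.
  apply: has_sign_derive hd _; apply: IH; apply: pol_degD => //.
  by apply: pol_degZ; [apply: hardyM => //; exact: hardy_nat|exact: pol_degX].
move=> /(has_signM (hardy_has_sign hH Ha)); apply: has_sign_germ.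
apply: filterS2 e ab => x -> abx.
by rewrite /h mulrDr mulrA abx mul1r.
Qed.

Definition polynomials : set (R -> R) := [set g | exists n, pol_deg n g].

Lemma polynomials_germ_ring : germ_ring polynomials.
Proof.
split.
- by move=> g h gh [n pg]; exists n; exact: pol_deg_saturated gh pg.
- by exists 0%N; exact: (hardy0 hH).
- by exists 0%N; exact: (hardy1 hH).
- move=> g [n pg]; exists n.
  apply: pol_deg_saturated (pol_degZ (hardyN hH (hardy1 hH)) pg).
  by apply: nearW => x; rewrite mulN1r.
- move=> g h [m pg] [n ph]; exists (maxn m n).
  by apply: pol_degD; [apply: pol_deg_leq pg; exact: leq_maxl|apply: pol_deg_leq ph; exact: leq_maxr].
- by move=> g h [m pg] [n ph]; exists (m + n)%N; exact: pol_degM.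
- by move=> g [n /pol_deg_derive[dg pdg gd]]; exists dg => //; exists n.
- by move=> g [n]; exact: pol_deg_sign.
Qed.

Lemma hardy_field_adjoin : exists H', [/\ hardy_field H', H `<=` H' & H' F].
Proof.
exists (fractions polynomials); split.
- exact/fractions_hardy_field/polynomials_germ_ring.
- move=> g Hg; exists g, (fun=> 1); split.
  + by exists 0%N.
  + by exists 0%N; exact: (hardy1 hH).
  + by apply: near_neq0_not_germ0; apply: nearW => x; exact: oner_neq0.
  + by apply: nearW => x; rewrite divr1.
- exists F, (fun=> 1); split.
  + by exists 1%N; apply: pol_deg_saturated (pol_degX 1); apply: nearW => x; rewrite expr1.
  + by exists 0%N; exact: (hardy1 hH).
  + by apply: near_neq0_not_germ0; apply: nearW => x; exact: oner_neq0.
  + by apply: nearW => x; rewrite divr1.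
Qed.

End Adjunction.

(** The identity is an antiderivative of 1, and once it is adjoined its inverse is available, of
    which [ln] is an antiderivative. *)
Lemma hardy_field_adjoin_id_ln (R : realType) (H : set (R -> R)) : hardy_field H ->
  exists H', [/\ hardy_field H', H `<=` H', H' id & H' (@ln R)].
Proof.
move=> hH.
have did : eventually_derive (id : R -> R) (fun=> 1).
  by apply: nearW => x; exact: is_derive_id.
have [H1 [hH1 HH1 H1id]] := hardy_field_adjoin hH (hardy1 hH) did.
have nz : ~ same_germ (id : R -> R) (fun=> 0).
  apply: near_neq0_not_germ0; apply/near_pinftyP; exists 0 => x x0.
  by rewrite gt_eqF.
have [g H1g ge] := hardyV hH1 H1id nz.
have dln : eventually_derive (@ln R) g.
  have /near_pinftyP[a h] := ge; apply/near_pinftyP; exists (Num.max a 0) => x.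
  rewrite gt_max => /andP[ax x0]; have := is_derive1_ln x0.
  congr is_derive; have := h x ax; rewrite /= => e.
  by apply: (mulfI (lt0r_neq0 x0)); rewrite e divff// gt_eqF.
have [H2 [hH2 HH2 H2ln]] := hardy_field_adjoin hH1 H1g dln.
by exists H2; split=> //; [move=> h /HH1/HH2|exact: HH2].
Qed.

(** * Comparison of derivatives *)

Section Asymptotics.
Context {R : realType}.
Implicit Types (f g df dg : R -> R).

Lemma near_pinfty_gt (a : R) : \forall x \near +oo, a < x.
Proof. by apply/near_pinftyP; exists a. Qed.

Lemma near_ln_ge (C : R) : \forall x \near +oo, C <= ln x.
Proof.
apply/near_pinftyP; exists (expR C) => x Cx.
by rewrite -[C]expRK ler_ln ?posrE ?expR_gt0 ?(lt_trans (expR_gt0 C))// ltW.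
Qed.

Lemma near_lnX_le (C : R) m : \forall x \near +oo, C * ln x ^+ m <= x.
Proof.
near=> x.
have x0 : 0 < x by near: x; exact: near_pinfty_gt.
have l0 : 0 <= ln x by near: x; exact: near_ln_ge.
have lC : `|C| * m.+1`!%:R <= ln x by near: x; exact: near_ln_ge.
have := expR_ge1Dxn m l0.
rewrite lnK ?posrE//.
have f0 : 0 < m.+1`!%:R :> R by rewrite ltr0n fact_gt0.
apply: le_trans; apply: (@le_trans _ _ (ln x ^+ m.+1 / m.+1`!%:R)); last first.
  by rewrite lerDr.
rewrite ler_pdivlMr// exprS mulrAC ler_wpM2r ?exprn_ge0//.
by apply: le_trans lC; rewrite ler_wpM2r ?ler_norm// ltW.
Unshelve. all: by end_near. Qed.

Lemma is_deriveX' f n (x a : R) : is_derive x 1 f a ->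
  is_derive x 1 (fun y => f y ^+ n) (n%:R * f x ^+ n.-1 * a).
Proof.
move=> fa; elim: n => [|n IH] /=.
  by rewrite !mul0r; exact: is_derive_cst.
have := is_deriveM' fa IH.
rewrite (_ : a * f x ^+ n + f x * (n%:R * f x ^+ n.-1 * a) = n.+1%:R * f x ^+ n * a).
  by congr is_derive; apply/funext => y; rewrite exprS.
case: n {IH} => [|n]; first by ring.
by rewrite -[n.+2%:R]natr1 [in RHS]exprS /= exprS; ring.
Qed.

Lemma is_derive_lnX (x : R) m : 0 < x ->
  is_derive x 1 (fun y : R => ln y ^+ m) (m%:R * ln x ^+ m.-1 / x).
Proof. by move=> x0; apply: is_deriveX'; exact: is_derive1_ln. Qed.

Lemma le_of_derive_ge0 f df (a : R) : (forall x, a < x -> is_derive x 1 f (df x)) ->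
  (forall x, a < x -> 0 <= df x) -> forall u v, a < u -> u <= v -> f u <= f v.
Proof.
move=> fd d0 u v au; rewrite le_eqVlt => /predU1P[->//|uv].
have [c /andP[uc cv] e] := mvt fd au uv.
by rewrite -subr_ge0 e mulr_ge0 ?subr_ge0 ?(ltW uv)// d0// (lt_trans au).
Qed.

Lemma le_of_derive_le0 f df (a : R) : (forall x, a < x -> is_derive x 1 f (df x)) ->
  (forall x, a < x -> df x <= 0) -> forall u v, a < u -> u <= v -> f v <= f u.
Proof.
move=> fd d0 u v au uv; rewrite -lerN2.
apply: (@le_of_derive_ge0 (fun x => - f x) (fun x => - df x) a) => // x ax.
  exact/is_deriveN'/fd.
by rewrite oppr_ge0 d0.
Qed.

Lemma near_and_bound f df (P : R -> Prop) (b : R) : eventually_derive f df ->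
  (\forall x \near +oo, P x) ->
  exists2 a, b <= a & forall x, a < x -> is_derive x 1 f (df x) /\ P x.
Proof.
move=> /near_pinftyP[a1 h1] /near_pinftyP[a2 h2].
exists (Num.max b (Num.max a1 a2)); first by rewrite le_max lexx.
by move=> x; rewrite !gt_max => /and3P[_ x1 x2]; split; [exact: h1|exact: h2].
Qed.

(** The comparison function h = 2 C ln^m / x^(i+1) decreases at least as fast as [g] can move. So g
    + h is nonincreasing and g - h nondecreasing, and the supremum of g - h serves as the limit c
    without any integration. *)
Lemma tail_integral g dg (C : R) m i : eventually_derive g dg -> 0 <= C ->
  (\forall x \near +oo, `|dg x| * x ^+ i.+2 <= C * ln x ^+ m) ->
  exists c C', \forall x \near +oo, `|g x - c| * x ^+ i.+1 <= C' * ln x ^+ m.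
Proof.
move=> gd C0 db.
have [a a1 ha] := near_and_bound 1 gd (filterI db (near_ln_ge (2 * m%:R + 1))).
pose h (x : R) := 2 * C * (ln x ^+ m * (x ^+ i.+1)^-1).
pose dh x : R := 2 * C * (m%:R * ln x ^+ m.-1 / x * (x ^+ i.+1)^-1 +
   ln x ^+ m * (- (i.+1%:R * x ^+ i * 1) / (x ^+ i.+1) ^+ 2)).
have hd x : a < x -> is_derive x 1 h (dh x).
  move=> ax; have x0 : 0 < x by lra.
  have h1 := @is_deriveV' _ (fun y => y ^+ i.+1) x _ (lt0r_neq0 (exprn_gt0 i.+1 x0))
    (is_deriveX' i.+1 (is_derive_id x 1)).
  have h2 := is_deriveM' (is_derive_lnX m x0) h1.
  have := is_deriveM' (is_derive_cst (2 * C) x 1) h2.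
  by congr is_derive; rewrite mul0r add0r.
have dhb x : a < x -> dh x <= - `|dg x|.
  move=> ax; have [_ [d1 l1]] := ha x ax; rewrite /= in d1 l1.
  have x0 : 0 < x by lra.
  have y0 : 0 < x ^+ i by rewrite exprn_gt0.
  have z0 : 0 < x ^+ i.+2 by rewrite exprn_gt0.
  rewrite -(ler_pM2r z0) mulNr.
  apply: (@le_trans _ _ (- (C * ln x ^+ m))); last by rewrite lerN2.
  have -> : dh x * x ^+ i.+2 = 2 * C * (m%:R * ln x ^+ m.-1 - i.+1%:R * ln x ^+ m).
    by rewrite /dh !exprS; field; rewrite !gt_eqF.
  have i1 : 1 <= i.+1%:R :> R by rewrite ler1n.
  have m0 : 0 <= m%:R :> R by [].
  (* Differentiating the power of the logarithm costs at most half of the main term once ln x >= 2m;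
     the factor 2 in [h] pays for it. *)
  suff : m%:R * ln x ^+ m.-1 *+ 2 <= ln x ^+ m.
    have e0 : 0 <= ln x ^+ m by rewrite exprn_ge0//; lra.
    have : ln x ^+ m <= i.+1%:R * ln x ^+ m by rewrite ler_peMl.
    move: (i.+1%:R * ln x ^+ m) (m%:R * ln x ^+ m.-1) (ln x ^+ m) => u v w; nra.
  case: (m) l1 m0 => [|k] l1 m0; first by rewrite mul0r mul0rn ler01.
  rewrite /= exprS -mulrnAl ler_wpM2r ?exprn_ge0//; lra.
have up u v : a < u -> u <= v -> g v + h v <= g u + h u.
  move=> au uv; apply: (@le_of_derive_le0 (fun x => g x + h x) (fun x => dg x + dh x) a _ _ u v) => // x ax.
    by apply: is_deriveD'; [case: (ha x ax)|exact: hd].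
  by have := dhb x ax; have := ler_norm (dg x); lra.
have down u v : a < u -> u <= v -> g u - h u <= g v - h v.
  move=> au uv; apply: (@le_of_derive_ge0 (fun x => g x - h x) (fun x => dg x + - dh x) a _ _ u v) => // x ax.
    by apply: is_deriveD'; [case: (ha x ax)|apply: is_deriveN'; exact: hd].
  by have := dhb x ax; have := ler_norm (- dg x); rewrite normrN; lra.
have h0 x : a < x -> 0 <= h x.
  move=> ax; have [_ [_ l1]] := ha x ax; rewrite /= in l1.
  have m0 : 0 <= m%:R :> R by [].
  by rewrite /h !mulr_ge0// ?invr_ge0 exprn_ge0//; lra.
have cross u v : a < u -> a < v -> g u - h u <= g v + h v.
  move=> au av; have [uv|vu] := leP u v.
    by apply: le_trans (down _ _ au uv) _; have := h0 _ av; lra.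
  by apply: le_trans (_ : g u + h u <= _); [have := h0 _ au; lra|exact: up av (ltW vu)].
pose S := [set g u - h u | u in [set u | a < u]].
have aa : a < a + 1 by lra.
have Sub : has_ubound S by exists (g (a + 1) + h (a + 1)) => _ [u au <-]; exact: cross.
exists (sup S), (2 * C); apply/near_pinftyP; exists a => x ax.
have x0 : 0 < x by lra.
have p0 : 0 < x ^+ i.+1 by rewrite exprn_gt0.
have : `|g x - sup S| <= h x.
  rewrite ler_distlC; apply/andP; split.
    by apply: ub_le_sup => //; exists x.
  apply: ge_sup; first by exists (g x - h x), x.
  by move=> _ [u au <-]; exact: cross.
by rewrite /h mulrA -ler_pdivlMr// invrK.
Qed.

(** At weight 1/x the tail need not converge: integrating from a fixed point costs one more
    logarithm, and the initial value is absorbed into C'. *)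
Lemma tail_integral_log g dg (C : R) m : eventually_derive g dg -> 0 <= C ->
  (\forall x \near +oo, `|dg x| * x <= C * ln x ^+ m) ->
  exists C', \forall x \near +oo, `|g x| <= C' * ln x ^+ m.+1.
Proof.
move=> gd C0 db.
have [a a1 ha] := near_and_bound 1 gd (filterI db (near_ln_ge 1)).
pose h (x : R) := C * ln x ^+ m.+1.
pose dh x : R := C * (m.+1%:R * ln x ^+ m / x).
have hd x : a < x -> is_derive x 1 h (dh x).
  move=> ax; have x0 : 0 < x by lra.
  have := is_deriveM' (is_derive_cst C x 1) (is_derive_lnX m.+1 x0).
  by congr is_derive; rewrite mul0r add0r.
have dhb x : a < x -> `|dg x| <= dh x.
  move=> ax; have [_ [d1 l1]] := ha x ax; rewrite /= in d1 l1.
  have x0 : 0 < x by lra.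
  rewrite /dh mulrA ler_pdivlMr//; apply: (le_trans d1).
  rewrite ler_wpM2l// ler_peMl ?ler1n// exprn_ge0//; lra.
have up u v : a < u -> u <= v -> g v - h v <= g u - h u.
  move=> au uv; apply: (@le_of_derive_le0 (fun x => g x - h x) (fun x => dg x + - dh x) a _ _ u v) => // x ax.
    by apply: is_deriveD'; [case: (ha x ax)|apply: is_deriveN'; exact: hd].
  by have := dhb x ax; have := ler_norm (dg x); lra.
have down u v : a < u -> u <= v -> g u + h u <= g v + h v.
  move=> au uv; apply: (@le_of_derive_ge0 (fun x => g x + h x) (fun x => dg x + dh x) a _ _ u v) => // x ax.
    by apply: is_deriveD'; [case: (ha x ax)|exact: hd].
  by have := dhb x ax; have := ler_norm (- dg x); rewrite normrN; lra.
set b := a + 1; have ab : a < b by rewrite /b; lra.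
set D := `|g b - h b| + `|g b + h b|.
have D0 : 0 <= D by rewrite addr_ge0.
exists (C + D); apply/near_pinftyP; exists b => x bx.
have ax : a < x by lra.
have [_ [_ l1]] := ha x ax; rewrite /= in l1.
have e1 : 1 <= ln x ^+ m.+1 by rewrite exprn_ege1.
have k1 := up b x ab (ltW bx); have k2 := down b x ab (ltW bx).
have k3 : D <= D * ln x ^+ m.+1 by rewrite ler_peMr.
have n1 := ler_norm (g b - h b); have n2 := ler_norm (- (g b + h b)).
have n3 : 0 <= `|g b - h b| by []. have n4 : 0 <= `|g b + h b| by [].
rewrite normrN in n2.
rewrite ler_norml mulrDl; apply/andP; rewrite -/(h x).
by move: k3; rewrite {1}/D; split; lra.
Qed.

Lemma poly_antiderivative (p : {poly R}) : exists P : {poly R}, P^`() = p.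
Proof.
exists (\poly_(i < (size p).+1) (p`_i.-1 / i%:R)).
apply/polyP => i; rewrite coef_deriv coef_poly /= ltnS.
case: ltnP => h; last by rewrite mul0rn nth_default.
by rewrite -[LHS]mulr_natr divfK// pnatr_eq0.
Qed.

End Asymptotics.

Definition derivs (R : realType) (f : R -> R) (j : nat) : R -> R :=
  iter j (fun g : R -> R => derive1 g : R -> R) f.

(** * Size of the derivatives and of their ratios *)

Section DerivativeGrowth.
Context {R : realType}.
Implicit Types (f g df dg : R -> R).

Lemma near_False : ~ \forall x \near +oo, (fun _ : R => False) x.
Proof. by move=> /near_pinftyP[a /(_ (a + 1))]; apply; rewrite ltrDl. Qed.

Variables (K : set (R -> R)) (alpha : R -> R) (l : nat).
Hypotheses (hK : hardy_field K) (Kalpha : K alpha) (Kid : K id) (Kln : K (@ln R)).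
Hypothesis alpha_gt0 : \forall x \near +oo, 0 < alpha x.
Hypothesis alpha_le : \forall x \near +oo, alpha x <= x ^+ l.
Hypothesis alpha_log : forall (p : {poly R}) m,
  \forall x \near +oo, ln x ^+ m <= `|alpha x - p.[x]|.

Let a_ := derivs alpha.

Lemma hardy_iter_derive1 j : K (a_ j).
Proof. by elim: j => //= j; exact: hardy_derive. Qed.

Lemma iter_derive1_derive j : eventually_derive (a_ j) (a_ j.+1).
Proof. exact: hardy_has_derive hK (hardy_iter_derive1 j). Qed.

Lemma hardy_compare f g : K f -> K g ->
  (\forall x \near +oo, f x <= g x) \/ (\forall x \near +oo, g x < f x).
Proof.
move=> Kf Kg; have := hardy_has_sign hK (hardyD hK Kf (hardyN hK Kg)).
move=> [h|h|h]; [left|right|left]; apply: filterS h => x.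
- by move=> /eqP; rewrite subr_eq0 => /eqP ->.
- by rewrite subr_gt0.
- by rewrite subr_lt0 => /ltW.
Qed.

Lemma hardy_norm f : K f -> K (fun x => `|f x|).
Proof.
move=> Kf; case: (hardy_has_sign hK Kf) => h.
- by apply: hardy_saturated hK _ _ _ Kf; apply: filterS h => x ->; rewrite normr0.
- by apply: hardy_saturated hK _ _ _ Kf; apply: filterS h => x h; rewrite gtr0_norm.
- by apply: hardy_saturated hK _ _ _ (hardyN hK Kf); apply: filterS h => x h; rewrite ltr0_norm.
Qed.

(** The polynomial is arbitrary so that each integration can absorb its constant. Every integration
    keeps the power of the logarithm except the one from order 1 to order 0, which adds one; order 0
    contradicts the hypothesis on [alpha]. *)
Lemma no_polynomial_approximation j m (p : {poly R}) (C : R) :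
  ~ \forall x \near +oo, `|a_ j x - p.[x]| * x ^+ j <= C * ln x ^+ m.
Proof.
elim: j m p C => [|j IH] m p C h.
  apply: near_False; near=> x.
  have h1 : `|alpha x - p.[x]| * x ^+ 0 <= C * ln x ^+ m by near: x.
  have h2 : ln x ^+ m.+1 <= `|alpha x - p.[x]| by near: x.
  have h3 : C + 1 <= ln x by near: x; exact: near_ln_ge.
  have h4 : 1 <= ln x by near: x; exact: near_ln_ge.
  have h5 : 1 <= ln x ^+ m by rewrite exprn_ege1.
  rewrite expr0 mulr1 in h1; rewrite exprS in h2; nra.
have [P dP] := poly_antiderivative p.
have gd : eventually_derive (fun x => a_ j x + - P.[x]) (fun x => a_ j.+1 x + - p.[x]).
  apply: eventually_deriveD; first exact: iter_derive1_derive.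
  by apply: eventually_deriveN; apply: nearW => x; rewrite -dP; exact: is_derive_poly.
have C0 : 0 <= `|C| by [].
have {}h : \forall x \near +oo, `|a_ j.+1 x - p.[x]| * x ^+ j.+1 <= `|C| * ln x ^+ m.
  near=> x; apply: le_trans (_ : C * ln x ^+ m <= _); first by near: x.
  by rewrite ler_wpM2r ?ler_norm// exprn_ge0//; near: x; exact: near_ln_ge.
case: j IH gd h => [|j] IH gd h.
  have [|C' {}h] := tail_integral_log gd C0 (m := m); first by apply: filterS h => x; rewrite expr1.
  by apply: (IH m.+1 P C'); apply: filterS h => x; rewrite expr0 mulr1.
have [c [C' h']] := tail_integral gd C0 h.
apply: (IH m (P + c%:P) C'); apply: filterS h' => x.
by rewrite hornerD hornerC opprD addrA.
Unshelve. all: by end_near. Qed.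

(** Both sides lie in the Hardy field, so failure would mean the reverse inequality for all large x,
    which is the excluded case p = 0. *)
Lemma iter_derive1_lower j m : \forall x \near +oo, ln x ^+ m <= x ^+ j * `|a_ j x|.
Proof.
have K1 : K (fun x => ln x ^+ m) by exact: hardy_exp.
have K2 : K (fun x => x ^+ j * `|a_ j x|).
  by apply: hardyM => //; [exact: hardy_exp|apply: hardy_norm; exact: hardy_iter_derive1].
have [//|h] := hardy_compare K1 K2.
have /= := @no_polynomial_approximation j m 0 1; case.
by apply: filterS h => x h; rewrite horner0 subr0 mul1r mulrC ltW.
Qed.

Lemma iter_derive1_sign j : exists2 s : R, s * s = 1 & \forall x \near +oo, 0 < s * a_ j x.
Proof.
case: (hardy_has_sign hK (hardy_iter_derive1 j)) => h.
- case: near_False; near=> x.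
  have : ln x ^+ 1 <= x ^+ j * `|a_ j x| by near: x; exact: iter_derive1_lower.
  have -> : a_ j x = 0 by near: x.
  rewrite normr0 mulr0 leNgt => /negP; apply.
  have : 1 <= ln x by near: x; exact: near_ln_ge.
  by rewrite expr1; lra.
- by exists 1; rewrite ?mulr1//; apply: filterS h => x; rewrite mul1r.
- by exists (-1); rewrite ?mulrNN ?mulr1//; apply: filterS h => x; rewrite mulN1r oppr_gt0.
Unshelve. all: by end_near. Qed.

Lemma power_lower_bound f df d : eventually_derive f df ->
  (\forall x \near +oo, 0 < f x) -> (\forall x \near +oo, d%:R * f x < x * df x) ->
  exists2 D : R, 0 < D & \forall x \near +oo, D * x ^+ d <= f x.
Proof.
move=> fd f0 big; have [a a1 ha] := near_and_bound 1 fd (filterI big f0).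
pose h x := f x * (x ^+ d)^-1.
pose dh x := df x * (x ^+ d)^-1 + f x * (- (d%:R * x ^+ d.-1 * 1) / (x ^+ d) ^+ 2).
have hd x : a < x -> is_derive x 1 h (dh x).
  move=> ax; have x0 : 0 < x by lra.
  apply: is_deriveM'; first by case: (ha x ax).
  exact: (@is_deriveV' _ (fun y => y ^+ d) x _ (lt0r_neq0 (exprn_gt0 d x0))
    (is_deriveX' d (is_derive_id x 1))).
have dh0 x : a < x -> 0 <= dh x.
  move=> ax; have [_ [b1 s1]] := ha x ax; rewrite /= in b1 s1.
  have x0 : 0 < x by lra.
  have p0 : 0 < x ^+ d by rewrite exprn_gt0.
  have e : d%:R * x ^+ d.-1 * x = d%:R * x ^+ d.
    by case: (d) => [|n]; rewrite ?mul0r// -mulrA -exprSr.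
  rewrite -(pmulr_rge0 _ (mulr_gt0 x0 p0)).
  have -> : x * x ^+ d * dh x = x * df x - f x * (d%:R * x ^+ d.-1 * x) / x ^+ d.
    by rewrite /dh; field; rewrite gt_eqF.
  by rewrite e mulrA mulfK ?gt_eqF//; lra.
have ab : a < a + 1 by lra.
have [_ [_ s1]] := ha _ ab; rewrite /= in s1.
have b0 : 0 < (a + 1) ^+ d by rewrite exprn_gt0//; lra.
exists (h (a + 1)); first by rewrite divr_gt0.
apply/near_pinftyP; exists (a + 1) => x bx.
have x0 : 0 < x ^+ d by rewrite exprn_gt0//; lra.
rewrite -ler_pdivlMr//; exact: (le_of_derive_ge0 hd dh0) (ltW bx).
Qed.

Lemma power_upper_bound f df d : eventually_derive f df ->
  (\forall x \near +oo, d%:R * f x < - (x * df x)) ->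
  exists D : R, \forall x \near +oo, f x * x ^+ d <= D.
Proof.
move=> fd big; have [a a1 ha] := near_and_bound 1 fd big.
pose h x := f x * x ^+ d.
pose dh x := df x * x ^+ d + f x * (d%:R * x ^+ d.-1 * 1).
have hd x : a < x -> is_derive x 1 h (dh x).
  move=> ax; apply: is_deriveM'; first by case: (ha x ax).
  exact: (is_deriveX' d (is_derive_id x 1)).
have dh0 x : a < x -> dh x <= 0.
  move=> ax; have [_ b1] := ha x ax.
  have x0 : 0 < x by lra.
  have p0 : 0 < x ^+ d by rewrite exprn_gt0.
  have e : d%:R * x ^+ d.-1 * x = d%:R * x ^+ d.
    by case: (d) => [|n]; rewrite ?mul0r// -mulrA -exprSr.
  rewrite -(pmulr_rle0 _ x0).
  have -> : x * dh x = x * df x * x ^+ d + f x * (d%:R * x ^+ d.-1 * x) by rewrite /dh; ring.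
  by rewrite e mulrA -mulrDl pmulr_lle0//; lra.
have ab : a < a + 1 by lra.
exists (h (a + 1)); apply/near_pinftyP; exists (a + 1) => x bx.
exact: (le_of_derive_le0 hd dh0) (ltW bx).
Qed.

(** If the logarithmic derivative exceeds d / x in size, then f grows at least like x^d or decays at
    least like x^-d. The first contradicts the upper bound because d > l, the second the lower bound
    because d > j. *)
Lemma log_derivative_bounded f df (C : R) j d : (l + j < d)%N -> eventually_derive f df ->
  has_sign df -> (\forall x \near +oo, 0 < f x) ->
  (\forall x \near +oo, d%:R * f x < x * `|df x|) ->
  (\forall x \near +oo, x ^+ j * f x <= C * x ^+ l) ->
  ~ \forall x \near +oo, 1 <= x ^+ j * f x.
Proof.
move=> dE fd [s0|s0|s0] f0 big up low; apply: near_False.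
- near=> x.
  have : d%:R * f x < x * `|df x| by near: x.
  have -> : df x = 0 by near: x.
  rewrite normr0 mulr0 ltNge => /negP; apply; rewrite mulr_ge0//.
  by apply: ltW; near: x.
- have [|D D0 h] := power_lower_bound fd f0 (d := d).
    by apply: filterS2 big s0 => x big s0; rewrite gtr0_norm in big.
  near=> x.
  have x1 : 1 < x by near: x; exact: near_pinfty_gt.
  have xC : `|C| / D < x by near: x; exact: near_pinfty_gt.
  have h1 : D * x ^+ d <= f x by near: x.
  have h2 : x ^+ j * f x <= C * x ^+ l by near: x.
  have xl0 : 0 < x ^+ l by rewrite exprn_gt0//; lra.
  have h3 : x ^+ l.+1 <= x ^+ d by rewrite ler_weXn2l ?(ltW x1)//; lia.
  have h4 : f x <= x ^+ j * f x.
    by rewrite ler_peMl ?exprn_ege1 ?(ltW x1)//; apply: ltW; near: x.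
  have h5 : D * x ^+ l.+1 <= C * x ^+ l.
    by apply: le_trans (_ : D * x ^+ d <= _); [rewrite ler_pM2l|lra].
  move: h5; rewrite exprS mulrA ler_pM2r// => h5.
  by move: xC; rewrite ltr_pdivrMr// => xC; have := ler_norm C; lra.
- have [|D h] := power_upper_bound fd (d := d).
    by apply: filterS2 big s0 => x big s0; rewrite ltr0_norm// mulrN in big.
  near=> x.
  have x1 : 1 < x by near: x; exact: near_pinfty_gt.
  have xD : D < x by near: x; exact: near_pinfty_gt.
  have h1 : f x * x ^+ d <= D by near: x.
  have h2 : 1 <= x ^+ j * f x by near: x.
  have h3 : x ^+ j.+1 <= x ^+ d by rewrite ler_weXn2l ?(ltW x1)//; lia.
  have f1 : 0 < f x by near: x.
  have : f x * x ^+ j.+1 <= D by apply: le_trans h1; rewrite ler_pM2l.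
  rewrite exprS mulrCA [f x * _]mulrC => h4.
  have : x <= x * (x ^+ j * f x) by rewrite ler_peMr//; lra.
  lra.
Unshelve. all: by end_near. Qed.

Lemma iter_derive1_signed j : exists s : R, [/\ s * s = 1,
  \forall x \near +oo, 0 < s * a_ j x,
  eventually_derive (fun x => s * a_ j x) (fun x => s * a_ j.+1 x) &
  \forall x \near +oo, `|a_ j x| = s * a_ j x].
Proof.
have [s s2 h] := iter_derive1_sign j; exists s; split=> //.
  have dc : eventually_derive (fun _ : R => s) (fun=> 0) by apply: nearW => x; exact: is_derive_cst.
  apply: eventually_derive_germ (eventually_deriveM dc (iter_derive1_derive j)).
    exact: same_germ_refl.
  by apply: nearW => x; rewrite mul0r add0r.
have ns : `|s| = 1.
  by apply/eqP; rewrite -(@eqrXn2 _ 2%N)// expr1n real_normK ?num_real// expr2 s2.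
by apply: filterS h => x h; rewrite -[LHS]mul1r -ns -normrM gtr0_norm.
Qed.

Lemma norm_signM (s y : R) : s * s = 1 -> `|s * y| = `|y|.
Proof.
move=> s2; rewrite normrM.
have -> : `|s| = 1.
  by apply/eqP; rewrite -(@eqrXn2 _ 2%N)// expr1n real_normK ?num_real// expr2 s2.
by rewrite mul1r.
Qed.

Lemma derivs_step j (C : R) : (\forall x \near +oo, x ^+ j * `|a_ j x| <= C * x ^+ l) ->
  \forall x \near +oo, x * `|a_ j.+1 x| <= (l + j).+1%:R * `|a_ j x|.
Proof.
move=> up.
have K1 : K (fun x => x * `|a_ j.+1 x|).
  by apply: hardyM => //; apply: hardy_norm; exact: hardy_iter_derive1.
have K2 : K (fun x => (l + j).+1%:R * `|a_ j x|).
  by apply: hardyM => //; [exact: hardy_nat|apply: hardy_norm; exact: hardy_iter_derive1].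
have [//|h] := hardy_compare K1 K2.
have [s [s2 s0 sd se]] := iter_derive1_signed j.
have hs : has_sign (fun x => s * a_ j.+1 x).
  by apply: has_signM; [|exact: hardy_has_sign hK (hardy_iter_derive1 _)];
    case: (ltgtP s 0) => e; [apply: Or33|apply: Or32|apply: Or31]; apply: nearW.
case: (@log_derivative_bounded _ _ C j (l + j).+1 (ltnSn _) sd hs s0).
- by apply: filterS2 h se => x + e; rewrite norm_signM// -e.
- by apply: filterS2 up se => x + e; rewrite -e.
- by apply: filterS2 (iter_derive1_lower j 0) se => x + e; rewrite -e expr0.
Qed.

Lemma derivs_upper j : exists C, \forall x \near +oo, x ^+ j * `|a_ j x| <= C * x ^+ l.
Proof.
elim: j => [|j [C IH]].
  exists 1; apply: filterS2 alpha_gt0 alpha_le => x h1 h2.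
  by rewrite !mul1r /a_ /derivs /= gtr0_norm.
exists ((l + j).+1%:R * C); near=> x.
have x0 : 0 < x by near: x; exact: near_pinfty_gt.
have h1 : x ^+ j * `|a_ j x| <= C * x ^+ l by near: x.
have h2 : x * `|a_ j.+1 x| <= (l + j).+1%:R * `|a_ j x|.
  by near: x; exact: derivs_step IH.
have p0 : 0 <= x ^+ j by rewrite exprn_ge0// ltW.
have c0 : 0 <= (l + j).+1%:R :> R by [].
rewrite exprSr -mulrA -mulrA; apply: le_trans (ler_wpM2l p0 h2) _.
by rewrite mulrCA ler_wpM2l.
Unshelve. all: by end_near. Qed.

Lemma derivs_ratio_upper j :
  \forall x \near +oo, x * `|a_ j.+1 x| <= (l + j).+1%:R * `|a_ j x|.
Proof. by have [C h] := derivs_upper j; exact: derivs_step h. Qed.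

(** Otherwise the logarithmic derivative of the derivative of order j+1 is at most ln^m / x^(j+2),
    which is integrable, so that derivative stays bounded. Then x^(j+2) times the next one is
    O(ln^m), against [iter_derive1_lower] with m + 1. *)
Lemma derivs_ratio_lower j m :
  \forall x \near +oo, ln x ^+ m * `|a_ j.+1 x| <= x ^+ j.+2 * `|a_ j.+2 x|.
Proof.
have K1 : K (fun x => ln x ^+ m * `|a_ j.+1 x|).
  by apply: hardyM => //; [exact: hardy_exp|apply: hardy_norm; exact: hardy_iter_derive1].
have K2 : K (fun x => x ^+ j.+2 * `|a_ j.+2 x|).
  by apply: hardyM => //; [exact: hardy_exp|apply: hardy_norm; exact: hardy_iter_derive1].
have [//|h] := hardy_compare K1 K2; exfalso.
have [s [s2 s0 sd se]] := iter_derive1_signed j.+1.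
pose g x := ln (s * a_ j.+1 x); pose dg x := (s * a_ j.+1 x)^-1 * (s * a_ j.+2 x).
have gd : eventually_derive g dg.
  by apply: filterS2 sd s0 => x d1 p; exact: (@is_derive1_comp R (@ln R) (fun y => s * a_ j.+1 y) x _ _ (is_derive1_ln p) d1).
have dgb : \forall x \near +oo, `|dg x| * x ^+ j.+2 <= 1 * ln x ^+ m.
  near=> x.
  have p : 0 < s * a_ j.+1 x by near: x.
  have h1 : x ^+ j.+2 * `|a_ j.+2 x| < ln x ^+ m * `|a_ j.+1 x| by near: x.
  have e : `|a_ j.+1 x| = s * a_ j.+1 x by near: x.
  rewrite normrM normfV (gtr0_norm p) norm_signM// mul1r -mulrA ler_pdivrMl//.
  by rewrite mulrC [leRHS]mulrC -e; exact: ltW.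
have [c [C' gc]] := tail_integral gd ler01 dgb.
apply: near_False; near=> x.
have x1 : 1 < x by near: x; exact: near_pinfty_gt.
have p : 0 < s * a_ j.+1 x by near: x.
have e : `|a_ j.+1 x| = s * a_ j.+1 x by near: x.
have h1 : x ^+ j.+2 * `|a_ j.+2 x| < ln x ^+ m * `|a_ j.+1 x| by near: x.
have h2 : `|g x - c| * x ^+ j.+1 <= C' * ln x ^+ m by near: x.
have h3 : C' * ln x ^+ m <= x by near: x; exact: near_lnX_le.
have h4 : ln x ^+ m.+1 <= x ^+ j.+2 * `|a_ j.+2 x| by near: x; exact: iter_derive1_lower.
have h5 : expR (c + 1) <= ln x by near: x; exact: near_ln_ge.
have xj : x <= x ^+ j.+1 by rewrite exprS ler_peMr ?exprn_ege1//; lra.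
have h6 : `|g x - c| <= 1.
  rewrite -(ler_pM2r (_ : 0 < x ^+ j.+1)) ?exprn_gt0//; lra.
have h7 : s * a_ j.+1 x <= expR (c + 1).
  rewrite -[leLHS](lnK (_ : _ \is Num.pos)) ?posrE// ler_expR -/(g x).
  by have := ler_norm (g x - c); lra.
have l0 : 0 < ln x ^+ m by rewrite exprn_gt0// (lt_le_trans (expR_gt0 (c + 1))).
move: h1; rewrite e ltNge => /negP; apply; apply: le_trans h4.
by rewrite exprS mulrC ler_wpM2r ?(ltW l0)//; exact: le_trans h5.
Unshelve. all: by end_near. Qed.

Lemma is_derive_divlnX f df (x : R) m : 1 < x -> is_derive x 1 f (df x) ->
  is_derive x 1 (fun y => f y / ln y ^+ m)
    ((x * ln x * df x - m%:R * f x) / (x * ln x ^+ m.+1)).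
Proof.
move=> x1 fd; have x0 : 0 < x by lra.
have l0 : 0 < ln x by rewrite ln_gt0.
have := is_deriveM' fd (@is_deriveV' _ (fun y => ln y ^+ m) x _
  (lt0r_neq0 (exprn_gt0 m l0)) (is_derive_lnX m x0)).
congr is_derive.
have e : m%:R * ln x ^+ m.-1 * ln x = m%:R * ln x ^+ m.
  by case: (m) => [|n]; rewrite ?mul0r// -mulrA -exprSr.
have p0 : 0 < ln x ^+ m by rewrite exprn_gt0.
apply: (mulIf (lt0r_neq0 (mulr_gt0 x0 (exprn_gt0 m.+1 l0)))).
rewrite divfK ?gt_eqF ?mulr_gt0 ?exprn_gt0//.
rewrite [ln x ^+ m.+1]exprS; transitivity (x * ln x * df x - f x * (m%:R * ln x ^+ m.-1 * ln x) / ln x ^+ m).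
  by field; rewrite !gt_eqF.
by rewrite e; field; rewrite gt_eqF.
Qed.

(** Otherwise [alpha] / ln^m would be eventually nonincreasing, hence bounded, although [alpha]
    exceeds every power of the logarithm. *)
Lemma alpha_log_derivative m : \forall x \near +oo, m%:R * alpha x <= x * ln x * a_ 1 x.
Proof.
have K1 : K (fun x => m%:R * alpha x) by apply: hardyM => //; exact: hardy_nat.
have K2 : K (fun x => x * ln x * a_ 1 x).
  by apply: hardyM => //; [exact: hardyM|exact: (hardy_iter_derive1 1)].
have [//|h] := hardy_compare K1 K2; exfalso.
have [a a1 ha] := near_and_bound 1 (iter_derive1_derive 0) h.
have ab : a < a + 1 by lra.
have decr : forall u v, a < u -> u <= v -> alpha v / ln v ^+ m <= alpha u / ln u ^+ m.
  apply: (@le_of_derive_le0 R (fun y => alpha y / ln y ^+ m)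
    (fun x => (x * ln x * a_ 1 x - m%:R * alpha x) / (x * ln x ^+ m.+1))) => x ax.
    by apply: is_derive_divlnX; [lra|case: (ha x ax)].
  have [_ h1] := ha x ax.
  rewrite pmulr_lle0; first by lra.
  by rewrite invr_gt0 mulr_gt0 ?exprn_gt0 ?ln_gt0//; lra.
apply: near_False; near=> x.
have ax : a + 1 < x by near: x; exact: near_pinfty_gt.
have := decr _ _ ab (ltW ax); set D := alpha (a + 1) / _ => h1.
have lD : `|D| + 1 <= ln x by near: x; exact: near_ln_ge.
have h2 : ln x ^+ m.+1 <= `|alpha x - 0.[x]| by near: x; exact: (alpha_log 0).
have D0 : 0 <= `|D| by []. have Dn := ler_norm D.
have l0 : 0 < ln x by lra.
move: h1; rewrite ler_pdivrMr ?exprn_gt0// => h1.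
have al : 0 < alpha x by near: x.
move: h2; rewrite horner0 subr0 gtr0_norm// exprS => h2.
have : ln x <= D by rewrite -(ler_pM2r (exprn_gt0 m l0)); lra.
lra.
Unshelve. all: by end_near. Qed.

Lemma alpha_div_lnX_nondecreasing m : exists a, forall x y, a < x -> x <= y ->
  alpha x / ln x ^+ m <= alpha y / ln y ^+ m.
Proof.
have [a a1 ha] := near_and_bound 1 (iter_derive1_derive 0) (alpha_log_derivative m).
exists a.
apply: (@le_of_derive_ge0 R (fun y => alpha y / ln y ^+ m)
  (fun x => (x * ln x * a_ 1 x - m%:R * alpha x) / (x * ln x ^+ m.+1))) => x ax.
  by apply: is_derive_divlnX; [lra|case: (ha x ax)].
have [_ h1] := ha x ax.
rewrite pmulr_lge0; first by lra.
by rewrite invr_gt0 mulr_gt0 ?exprn_gt0 ?ln_gt0//; lra.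
Qed.

(** At this order the derivative is O(1/x), so that beta times it is small for every frequency
    considered and the search for an order stops. *)
Lemma derivs_last : exists C, \forall x \near +oo, x * `|a_ l.+1 x| <= C.
Proof.
have [C h] := derivs_upper l.+1; exists C; near=> x.
have x0 : 0 < x by near: x; exact: near_pinfty_gt.
have : x ^+ l.+1 * `|a_ l.+1 x| <= C * x ^+ l by near: x.
by rewrite exprSr -mulrA mulrC ler_pM2r ?exprn_gt0.
Unshelve. all: by end_near. Qed.

End DerivativeGrowth.

(** * Sums over short windows *)

Section SmoothPhases.
Context {R : realType}.
Implicit Types (f g df dg : R -> R).

Lemma cos_lipschitz (x y : R) : `|cos x - cos y| <= `|x - y|.
Proof.
wlog xy : x y / x < y.
  move=> H; case: (ltgtP x y) => [h|h|->]; last by rewrite !subrr.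
  - exact: H.
  - by rewrite distrC [leRHS]distrC; exact: H.
have x1 : x - 1 < x by lra.
have [c _ e] := mvt (fun z (_ : x - 1 < z) => is_derive_cos z) x1 xy.
by rewrite distrC e normrM normrN [leRHS]distrC ler_piMl// sin_max.
Qed.

Lemma sum_cos_full_period (L r : nat) (c : R) : (0 < r < L)%N ->
  \sum_(n < L) cos (2 * pi * (r%:R * n%:R / L%:R) + c) = 0.
Proof.
move=> h; rewrite -[RHS](sum_cos_period c h); apply: eq_bigr => n _.
by congr cos; ring.
Qed.

(** The phase is compared with r n / L, whose sum over L terms vanishes because 0 < r < L. Replacing
    F / P by 1 / L and x n by n F moves the argument by at most 4 r delta turns, and 2 pi * 4 <=
    32. *)
Lemma near_linear_sum (x : nat -> R) (L r : nat) (F P delta c : R) :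
  (0 < r < L)%N -> 0 < F -> 0 <= delta <= 2^-1 ->
  (forall n, (n < L)%N -> `|x n - n%:R * F| <= delta * (L%:R * F)) ->
  `|P - L%:R * F| <= delta * (L%:R * F) ->
  `|\sum_(n < L) cos (2 * pi * (r%:R / P * x n) + c)| <= 32 * r%:R * delta * L%:R.
Proof.
move=> rL F0 /andP[d0 d2] xF PF.
have L0 : 0 < L%:R :> R by rewrite ltr0n; case/andP: rL => _ /(leq_trans _) ->.
have LF0 : 0 < L%:R * F by rewrite mulr_gt0.
have P2 : L%:R * F <= 2 * P.
  have : delta * (L%:R * F) <= 2^-1 * (L%:R * F) by rewrite ler_wpM2r// ltW.
  by move: PF; rewrite ler_norml => /andP[]; lra.
have P0 : 0 < P by lra.
have pi0 := @pi_gt0 R.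
have pi4 : pi <= 4 :> R by have /andP[_] := @pihalf_02 R; lra.
rewrite -[X in `|X|]subr0 -[X in `|_ - X|](sum_cos_full_period c rL) -sumrB.
apply: (le_trans (ler_norm_sum _ _ _)).
have -> : 32 * r%:R * delta * L%:R = \sum_(n < L) (32 * r%:R * delta) :> R.
  by rewrite sumr_const card_ord -[RHS]mulr_natr.
apply: ler_sum => n _; apply: (le_trans (cos_lipschitz _ _)).
have nL : (n : nat)%:R <= L%:R :> R by rewrite ler_nat ltnW.
have -> : 2 * pi * (r%:R / P * x n) + c - (2 * pi * (r%:R * n%:R / L%:R) + c) =
  2 * pi * r%:R * (((x n - n%:R * F) * L%:R + n%:R * (L%:R * F - P)) / (P * L%:R)).
  by field; rewrite !gt_eqF.
have b : `|((x n - n%:R * F) * L%:R + n%:R * (L%:R * F - P)) / (P * L%:R)| <= 4 * delta.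
  rewrite normrM normfV (gtr0_norm (mulr_gt0 P0 L0)) ler_pdivrMr ?mulr_gt0//.
  apply: (le_trans (ler_normD _ _)); rewrite !normrM.
  rewrite (distrC (L%:R * F)) !normr_nat.
  apply: (@le_trans _ _ (delta * (L%:R * F) * L%:R + L%:R * (delta * (L%:R * F)))).
    apply: lerD; first by rewrite ler_pM2r// xF.
    exact: ler_pM.
  have -> : delta * (L%:R * F) * L%:R + L%:R * (delta * (L%:R * F)) =
    2 * delta * L%:R * (L%:R * F) by ring.
  have -> : 4 * delta * (P * L%:R) = 2 * delta * L%:R * (2 * P) by ring.
  by rewrite ler_wpM2l// !mulr_ge0// ltW.
rewrite normrM (ger0_norm (_ : 0 <= 2 * pi * r%:R)); last by rewrite !mulr_ge0// ltW.
apply: (@le_trans _ _ (2 * pi * r%:R * (4 * delta))).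
  by rewrite ler_wpM2l// !mulr_ge0// ltW.
have -> : 2 * pi * r%:R * (4 * delta) = pi * (8 * r%:R * delta) by ring.
have -> : 32 * r%:R * delta = 4 * (8 * r%:R * delta) by ring.
by rewrite ler_wpM2r// !mulr_ge0.
Qed.

(** Induction on the order, applied to the differenced family b i (x + 1) - b i x; the ordinary mean
    value theorem removes the last difference. *)
Lemma iter_diff_mvt (J : nat) (b : nat -> R -> R) (a M : R) n :
  (forall i x, (i < J)%N -> a < x -> is_derive x 1 (b i) (b i.+1 x)) -> a < M ->
  exists2 xi, M + n%:R <= xi <= M + n%:R + J%:R &
    iter J diff (fun n => b 0%N (M + n%:R)) n = b J xi.
Proof.
elim: J b n => [|J IH] b n bd aM.
  by exists (M + n%:R); rewrite ?addr0 ?lexx.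
have bd' i x : (i < J)%N -> a < x ->
    is_derive x 1 (fun x => b i (x + 1) + - b i x) (b i.+1 (x + 1) + - b i.+1 x).
  move=> iJ ax; apply: is_deriveD'; last by apply: is_deriveN'; apply: bd => //; exact: ltnW.
  have sh : is_derive x 1 (fun y : R => y + 1) (1 + 0).
    exact: (@is_deriveD' R id (cst 1) x 1 0 (is_derive_id _ _) (is_derive_cst _ _ _)).
  have ax1 : a < x + 1 by lra.
  have := @is_derive1_comp R (b i) (fun y : R => y + 1) x _ _ (bd i _ (ltnW iJ) ax1) sh.
  by congr is_derive; rewrite addr0 mulr1.
have [xi /andP[x1 x2]] := IH (fun i x => b i (x + 1) + - b i x) n bd' aM.
rewrite iterSr /= => e.
have n0 : 0 <= n%:R :> R by [].
have axi : a < xi by lra.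
have xx : xi < xi + 1 by lra.
have [c /andP[c1 c2] e2] := mvt (fun x ax => bd J x (ltnSn J) ax) axi xx.
exists c; first by rewrite -[J.+1%:R]natr1; apply/andP; split; lra.
rewrite (eq_iter_diff J (_ : _ =1 (fun n => b 0%N (M + n%:R + 1) + - b 0%N (M + n%:R)))).
  by rewrite e e2; ring.
by move=> i; rewrite /diff -[i.+1%:R]natr1 addrA.
Qed.

(** The mean value theorem gives |f x - f M| <= eta f c with c in between. As f is monotone, f c is
    at most the larger end value; when that is f x, solving for f x turns eta into 2 eta. *)
Lemma almost_constant f df (a M D C eta x : R) :
  (forall x, a < x -> is_derive x 1 f (df x)) -> a < M -> 0 < M ->
  (forall x, M <= x -> 0 < f x) -> (forall x, M <= x -> x * `|df x| <= C * f x) ->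
  (forall x, M <= x -> 0 <= df x) \/ (forall x, M <= x -> df x <= 0) ->
  0 <= C -> C * D <= eta * M -> 0 <= eta <= 2^-1 -> M <= x <= M + D ->
  (1 - eta) * f M <= f x <= (1 + 2 * eta) * f M.
Proof.
move=> fd aM M0 f0 dfC dfs C0 CD /andP[e0 e1] /andP[Mx xD].
have fM := f0 M (lexx M).
move: Mx; rewrite le_eqVlt => /predU1P[<-|Mx].
  by apply/andP; split; nra.
have [c /andP[Mc cx] e] := mvt fd aM Mx.
have c0 : 0 < c by lra.
have fc := f0 c (ltW Mc).
have key : `|df c| * (x - M) <= eta * f c.
  have h := dfC c (ltW Mc).
  have h1 : M * `|df c| <= C * f c.
    by apply: le_trans h; rewrite ler_wpM2r// ltW.
  rewrite -(ler_pM2l M0).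
  apply: (@le_trans _ _ (C * f c * (x - M))).
    by rewrite mulrA ler_wpM2r//; lra.
  have -> : C * f c * (x - M) = f c * (C * (x - M)) by ring.
  have -> : M * (eta * f c) = f c * (eta * M) by ring.
  rewrite ler_pM2l//; apply: le_trans CD.
  by rewrite ler_wpM2l//; lra.
have xM0 : 0 < x - M by lra.
have h1 : df c * (x - M) <= `|df c| * (x - M) by rewrite ler_pM2r// ler_norm.
have h2 : - df c * (x - M) <= `|df c| * (x - M).
  by rewrite ler_pM2r// -normrN ler_norm.
case: dfs => dfs.
  have fcx : f c <= f x.
    have [c' /andP[cc' _] e'] := mvt fd (lt_trans aM Mc) cx.
    have : 0 <= df c' * (x - c) by rewrite mulr_ge0 ?dfs//; lra.
    lra.
  have dc := dfs c (ltW Mc).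
  have : 0 <= df c * (x - M) by rewrite mulr_ge0// ltW.
  move=> h3; apply/andP; split; nra.
have fcx : f c <= f M.
  have [c' /andP[Mc' _] e'] := mvt fd aM Mc.
  have : df c' * (c - M) <= 0 by rewrite mulr_le0_ge0 ?dfs ?(ltW Mc')//; lra.
  lra.
have : df c * (x - M) <= 0 by rewrite mulr_le0_ge0 ?dfs ?(ltW Mc)//; lra.
by move=> h3; apply/andP; split; nra.
Qed.

End SmoothPhases.

(** * Choice of the order of the derivative test *)

Section SmoothSums.
Context {R : realType}.

(* [F j] stands for |alpha^(j)(M)|; the order found is the first one for which
   [beta * F j.+1] is small. *)
Lemma select_order (F : nat -> R) (k D C0 : nat) (beta L M Y W : R) :
  (forall j, 0 < F j) -> 0 < beta -> 0 < L -> 0 < M -> 1 <= Y ->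
  2 * Y ^+ D <= beta * F 1%N * L -> beta * F k.+1 * Y ^+ D <= 1 ->
  (forall j, (j < k)%N -> W * F j.+1 <= M ^+ j.+2 * F j.+2) ->
  M <= 2 * Y ^+ C0 * L -> (2 * Y ^+ C0) ^+ k.+1 * (2 * Y ^+ (D + D)) <= W ->
  exists j, [/\ (j <= k)%N, 2 * Y ^+ D <= beta * F j.+1 * L ^+ j.+1 &
    beta * F j.+1 * Y ^+ D <= 1].
Proof.
move=> F0 b0 L0 M0 Y1 T1 Tk HW ML Wb.
have YD : 0 < Y ^+ D by rewrite exprn_gt0//; lra.
have V1 : 1 <= 2 * Y ^+ C0.
  have : 1 <= Y ^+ C0 by rewrite exprn_ege1.
  lra.
have step j : (j <= k)%N -> (exists i, [/\ (i <= k)%N, 2 * Y ^+ D <= beta * F i.+1 * L ^+ i.+1 &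
    beta * F i.+1 * Y ^+ D <= 1]) \/ 2 * Y ^+ D <= beta * F j.+1 * L ^+ j.+1.
  elim: j => [|j IH] jk; first by right; rewrite expr1.
  have [h|h] := IH (ltnW jk); first by left.
  have [h1|h1] := leP (beta * F j.+1 * Y ^+ D) 1.
    by left; exists j; split=> //; exact: ltnW.
  (* Here beta F_{j+1} > Y^-D. The ratio bound then makes beta F_{j+2} M^(j+2) at least W Y^-D, and
     M <= 2 Y^C0 L trades the power of M for one of L, so largeness passes to the next order. *)
  right.
  have V0 : 0 < (2 * Y ^+ C0) ^+ j.+2 by rewrite exprn_gt0//; lra.
  rewrite -(ler_pM2l V0).
  have e1 : M ^+ j.+2 <= (2 * Y ^+ C0) ^+ j.+2 * L ^+ j.+2.
    by rewrite -exprMn; apply: lerXn2r; rewrite ?nnegrE ?(ltW M0)//; lra.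
  have h2 := HW j jk.
  have bF : 0 < beta * F j.+2 by rewrite mulr_gt0.
  apply: (@le_trans _ _ (beta * F j.+2 * M ^+ j.+2)); last first.
    have -> : (2 * Y ^+ C0) ^+ j.+2 * (beta * F j.+2 * L ^+ j.+2) =
      beta * F j.+2 * ((2 * Y ^+ C0) ^+ j.+2 * L ^+ j.+2) by ring.
    by rewrite ler_pM2l.
  apply: (@le_trans _ _ (W * (beta * F j.+1))); last first.
    have -> : W * (beta * F j.+1) = beta * (W * F j.+1) by ring.
    have -> : beta * F j.+2 * M ^+ j.+2 = beta * (M ^+ j.+2 * F j.+2) by ring.
    by rewrite ler_pM2l.
  have V2 : (2 * Y ^+ C0) ^+ j.+2 <= (2 * Y ^+ C0) ^+ k.+1 by rewrite ler_weXn2l.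
  have W2 : (2 * Y ^+ C0) ^+ j.+2 * (2 * Y ^+ D) * Y ^+ D <= W.
    apply: le_trans Wb; rewrite exprD.
    have -> : (2 * Y ^+ C0) ^+ j.+2 * (2 * Y ^+ D) * Y ^+ D =
       (2 * Y ^+ C0) ^+ j.+2 * (2 * (Y ^+ D * Y ^+ D)) by ring.
    by rewrite ler_wpM2r// !mulr_ge0// ltW.
  have W0 : 0 <= W.
    apply: le_trans W2; apply: mulr_ge0; last exact: ltW.
    by apply: mulr_ge0; [exact: ltW|apply: mulr_ge0 => //; exact: ltW].
  rewrite -(ler_pM2r YD); apply: (le_trans W2); rewrite -mulrA ler_peMr//.
  exact: ltW.
have [//|h] := step k (leqnn k).
by exists k.
Qed.

Lemma iter_diff_cst (c : R) j n : iter j.+1 diff (fun=> c) n = 0.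
Proof. by elim: j n => [|j IH] n; rewrite /= /diff; [rewrite subrr|rewrite [X in X - _]IH [X in _ - X]IH subrr]. Qed.

(** [almost_constant] with eta = 1/4 confines the derivative to [3/4, 3/2] times its value at M,
    exactly the factor 2 that [tame] allows; hence the 3/4. The sign [s] makes the differences
    positive. *)
Lemma tame_phase (b : nat -> R -> R) (a s beta C c : R) (M L j : nat) :
  (forall i x, (i <= j.+1)%N -> a < x -> is_derive x 1 (b i) (b i.+1 x)) ->
  a < M%:R -> (0 < M)%N -> s * s = 1 -> 0 < beta -> 0 <= C ->
  (forall x, M%:R <= x -> 0 < s * b j.+1 x) ->
  (forall x, M%:R <= x -> x * `|b j.+2 x| <= C * `|b j.+1 x|) ->
  (forall x, M%:R <= x -> 0 <= s * b j.+2 x) \/ (forall x, M%:R <= x -> s * b j.+2 x <= 0) ->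
  8 * C * L%:R <= M%:R -> (j.+2 <= L)%N ->
  tame j.+1 L (3 / 4 * (beta * (s * b j.+1 M%:R)))
    (fun n => s * beta * b 0%N (M%:R + n%:R) - c).
Proof.
move=> bd aM M0 s2 b0 C0 bs bC bsgn CL jL.
have M0r : 0 < M%:R :> R by rewrite ltr0n.
have E i n : iter i.+1 diff (fun n => s * beta * b 0%N (M%:R + n%:R) - c) n =
    s * beta * iter i.+1 diff (fun n => b 0%N (M%:R + n%:R)) n.
  by rewrite iter_diffB iter_diff_cst subr0 iter_diffZ.
have mvtD i n : (i <= j.+2)%N -> (n <= L)%N -> exists2 xi, M%:R <= xi <= M%:R + 2 * L%:R &
    iter i diff (fun n => b 0%N (M%:R + n%:R)) n = b i xi.
  move=> ij nL.
  have [|xi /andP[x1 x2] e] := @iter_diff_mvt R i b a M%:R n _ aM.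
    by move=> i' x i'i; apply: bd; rewrite -ltnS; exact: leq_trans ij.
  exists xi => //.
  have n0 : 0 <= n%:R :> R by [].
  have nLr : n%:R <= L%:R :> R by rewrite ler_nat.
  have iL : i%:R <= L%:R :> R by rewrite ler_nat (leq_trans ij).
  by apply/andP; split; lra.
split=> [n nL|].
  have [xi xib e] := mvtD j.+1 n (leqnSn _) nL.
  rewrite E e.
  have sd x : a < x -> is_derive x 1 (fun y => s * b j.+1 y) (s * b j.+2 x).
    move=> ax; have := is_deriveM' (is_derive_cst s x 1) (bd j.+1 x (leqnn _) ax).
    by congr is_derive; rewrite mul0r add0r.
  have bC' x : M%:R <= x -> x * `|s * b j.+2 x| <= C * (s * b j.+1 x).
    move=> Mx; rewrite norm_signM//; apply: (le_trans (bC x Mx)).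
    by rewrite -(norm_signM (b j.+1 x) s2) gtr0_norm// bs.
  have CD : C * (2 * L%:R) <= 4^-1 * M%:R by lra.
  have eta : 0 <= (4^-1 : R) <= 2^-1 by apply/andP; split; lra.
  have /andP[h1 h2] := almost_constant sd aM M0r bs bC' bsgn C0 CD eta xib.
  set F := s * b j.+1 M%:R in h1 h2 *.
  have -> : s * beta * b j.+1 xi = beta * (s * b j.+1 xi) by ring.
  have -> : 2 * (3 / 4 * (beta * F)) = beta * (3 / 2 * F) by field.
  have -> : 3 / 4 * (beta * F) = beta * (3 / 4 * F) by field.
  by rewrite !ler_pM2l//; apply/andP; split; lra.
have mono n : (n < L)%N -> exists2 xi, M%:R <= xi &
  iter j.+1 diff (fun n => s * beta * b 0%N (M%:R + n%:R) - c) n.+1 -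
  iter j.+1 diff (fun n => s * beta * b 0%N (M%:R + n%:R) - c) n = beta * (s * b j.+2 xi).
  move=> nL; have [xi /andP[x1 _] e] := mvtD j.+2 n (leqnn _) (ltnW nL).
  exists xi => //; transitivity (iter j.+2 diff (fun n => s * beta * b 0%N (M%:R + n%:R) - c) n) => //.
  by rewrite E e; ring.
case: bsgn => sg; [left|right] => n /mono[xi xM e].
  by rewrite -subr_ge0 e mulr_ge0 ?(ltW b0)// sg.
by rewrite -subr_le0 e mulr_ge0_le0 ?(ltW b0)// sg.
Qed.

Lemma cos_signM (s x : R) : s * s = 1 -> cos (s * x) = cos x.
Proof.
move=> s2; have /orP[/eqP->|/eqP->] : (s == 1) || (s == -1).
- by rewrite -sqrf_eq1 expr2 s2.
- by rewrite mul1r.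
- by rewrite mulN1r cosN.
Qed.

Lemma derivative_test_uniform k : exists d C, (0 < C)%N /\
  forall j, (j <= k)%N -> derivative_test (R := R) j d C.
Proof.
have weaken j d C d' C' : (d <= d')%N -> (C <= C')%N ->
    derivative_test (R := R) j d C -> derivative_test (R := R) j d' C'.
  move=> dd CC H E N lam f E1 lam0 tf h1 h2.
  have le : C%:R * E ^+ d <= C'%:R * E ^+ d'.
    by apply: ler_pM; rewrite ?exprn_ge0 ?ler_nat ?ler_weXn2l//; lra.
  apply: H tf _ _ => //; last exact: le_trans h2.
  by apply: le_trans h1; rewrite ler_pM2l.
elim: k => [|k [d [C [C0 IH]]]].
  have [d [C [C0 H]]] := derivative_test_exists (R := R) 0.
  by exists d, C; split=> // j; rewrite leqn0 => /eqP ->.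
have [d' [C' [C0' H]]] := derivative_test_exists (R := R) k.+1.
exists (maxn d d'), (maxn C C'); split; first by rewrite leq_max C0.
move=> j; rewrite leq_eqVlt => /predU1P[->|jk].
  by apply: weaken H; exact: leq_maxr.
by apply: weaken (IH j jk); exact: leq_maxl.
Qed.

End SmoothSums.

(** * Savings at all frequencies r / P *)

Section PolynomialGrowthSums.
Context {R : realType}.

Lemma near_multiple (P F e : R) : 0 < F -> `|P - F| <= e -> e <= 2^-1 * F ->
  0 < P /\ P <= 2 * F.
Proof. by rewrite ler_norml => F0 /andP[? ?] ?; split; lra. Qed.

Lemma near_forall_leq (Q : nat -> R -> Prop) n : (forall j, \forall x \near +oo, Q j x) ->
  \forall x \near +oo, forall j, (j <= n)%N -> Q j x.
Proof.
move=> h; elim: n => [|n IH].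
  by apply: filterS (h 0%N) => x h0 j; rewrite leqn0 => /eqP ->.
apply: filterS2 IH (h n.+1) => x IH hn j; rewrite leq_eqVlt => /predU1P[->//|].
exact: IH.
Qed.

Lemma high_frequency_sum (a_ : nat -> R -> R) (s_ : nat -> R) (k d Cd D C0 M L : nat)
  (a C E beta c Y W : R) :
  (forall j x, (j <= k.+1)%N -> a < x -> is_derive x 1 (a_ j) (a_ j.+1 x)) ->
  (forall j, s_ j * s_ j = 1) ->
  (forall j x, (j <= k.+2)%N -> M%:R <= x -> 0 < s_ j * a_ j x) ->
  (forall j x, (j <= k.+1)%N -> M%:R <= x -> x * `|a_ j.+1 x| <= C * `|a_ j x|) ->
  (forall j, (j <= k)%N -> derivative_test (R := R) j d Cd) ->
  1 <= E -> Cd%:R * E ^+ d <= Y ^+ D -> 1 <= Y -> 0 <= C -> a < M%:R -> (0 < M)%N ->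
  8 * C * L%:R <= M%:R -> (k.+2 <= L)%N -> 0 < beta ->
  2 * Y ^+ D <= beta * `|a_ 1 M%:R| * L%:R -> beta * `|a_ k.+1 M%:R| * Y ^+ D <= 1 ->
  (forall j, (j < k)%N -> W * `|a_ j.+1 M%:R| <= M%:R ^+ j.+2 * `|a_ j.+2 M%:R|) ->
  M%:R <= 2 * Y ^+ C0 * L%:R -> (2 * Y ^+ C0) ^+ k.+1 * (2 * Y ^+ (D + D)) <= W ->
  E * `|\sum_(n < L) cos (2 * pi * (beta * a_ 0 (M%:R + n%:R)) + c)| <= L%:R.
Proof.
move=> da s2 sa ra test E1 EY Y1 C0' aM M0 CL kL b0 T1 Tk HW ML Wb.
have M0r : 0 < M%:R :> R by rewrite ltr0n.
have L0 : 0 < L%:R :> R by rewrite ltr0n (leq_trans _ kL).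
have YD : 0 < Y ^+ D by rewrite exprn_gt0//; lra.
pose F j := if (j <= k.+2)%N then `|a_ j M%:R| else 1.
have F0 j : 0 < F j.
  rewrite /F; case: ifP => // jk; rewrite normr_gt0; apply/eqP => e.
  by have := sa j _ jk (lexx _); rewrite e mulr0 ltxx.
have Fj j : (j <= k.+1)%N -> F j.+1 = `|a_ j.+1 M%:R| by rewrite /F ltnS => ->.
have HW' j : (j < k)%N -> W * F j.+1 <= M%:R ^+ j.+2 * F j.+2.
  by move=> jk; rewrite !Fj ?(leq_trans (ltnW jk))// ?HW// ltnS ltnW.
have [||j [jk Tj Sj]] := select_order F0 b0 L0 M0r Y1 _ _ HW' ML Wb.
- by rewrite Fj.
- by rewrite Fj.
rewrite Fj ?(leq_trans jk)// in Tj Sj.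
have e1 : `|a_ j.+1 M%:R| = s_ j.+1 * a_ j.+1 M%:R.
  by rewrite -(norm_signM _ (s2 j.+1)) gtr0_norm// sa// ltnS (leq_trans jk).
rewrite e1 in Tj Sj; set s := s_ j.+1 in e1 Tj Sj.
have ss : s * s = 1 by exact: s2.
pose lam := 3 / 4 * (beta * (s * a_ j.+1 M%:R)).
have aj0 : 0 < s * a_ j.+1 M%:R by apply: sa; rewrite // ltnS (leq_trans jk).
have lam0 : 0 < lam by rewrite /lam mulr_gt0// ?divr_gt0// mulr_gt0.
(* The shift is moved inside the phase, where differences do not see it; the sign s in front of the
   phase is harmless because cosine is even. *)
pose c1 := - (s * c / (2 * pi)).
have tf : tame j.+1 L lam (fun n => s * beta * a_ 0 (M%:R + n%:R) - c1).
  apply: (@tame_phase R a_ a s beta C c1 M L j) => //.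
  - by move=> i x ij; apply: da; rewrite (leq_trans ij).
  - by move=> x Mx; apply: sa; rewrite // ltnS (leq_trans jk).
  - by move=> x Mx; apply: ra => //; rewrite ltnS.
  - have t0 : s_ j.+2 * s != 0.
      by apply/eqP => e; have := s2 j.+2; have : s_ j.+2 * s * s = 0; [rewrite e mul0r|rewrite -mulrA ss mulr1 => ->; rewrite mul0r => /esym/eqP; rewrite oner_eq0].
    have e x : s * a_ j.+2 x = (s_ j.+2 * s) * (s_ j.+2 * a_ j.+2 x).
      by rewrite mulrACA s2 mul1r.
    case: (ltgtP (s_ j.+2 * s) 0) t0 => // sg _; [right|left] => x Mx; rewrite e.
      by rewrite nmulr_rle0// ltW// sa// !ltnS.
    by rewrite pmulr_rge0// ltW// sa// !ltnS.
  - by rewrite (leq_trans _ kL)// !ltnS.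
have := test j jk E L lam _ E1 lam0 tf _ _.
have cosE (n : 'I_L) : cos (2 * pi * (s * beta * a_ 0 (M%:R + n%:R) - c1)) =
    cos (2 * pi * (beta * a_ 0 (M%:R + n%:R)) + c).
  rewrite -[RHS](cos_signM _ ss); congr cos; rewrite /c1.
  have pi0 := @pi_gt0 R.
  have p2 : 2 * pi != 0 :> R by rewrite gt_eqF// mulr_gt0.
  have e : 2 * pi * (s * c / (2 * pi)) = s * c by rewrite mulrC divfK.
  by rewrite opprK mulrDr e; ring.
rewrite (eq_bigr _ (fun n _ => cosE n)); apply.
- apply: (@le_trans _ _ (lam * Y ^+ D)); first by rewrite ler_pM2l.
  rewrite /lam; have : 0 < beta * (s * a_ j.+1 M%:R) * Y ^+ D by apply: mulr_gt0 => //; apply: mulr_gt0.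
  by move: (beta * (s * a_ j.+1 M%:R)) Sj => t h1 h2; lra.
- apply: (le_trans EY); rewrite /lam.
  have -> : L%:R ^+ j.+1 * (3 / 4 * (beta * (s * a_ j.+1 M%:R))) =
     3 / 4 * (beta * (s * a_ j.+1 M%:R) * L%:R ^+ j.+1) by ring.
  by move: (beta * (s * a_ j.+1 M%:R) * _) Tj => t h1; lra.
Qed.

Variables (a_ : nat -> R -> R) (k : nat).
Hypothesis a_derive : forall j, eventually_derive (a_ j) (a_ j.+1).
Hypothesis a_sign : forall j, exists s : R, s * s = 1 /\ \forall x \near +oo, 0 < s * a_ j x.
Hypothesis a_ratio_upper : forall j, exists C : R,
  \forall x \near +oo, x * `|a_ j.+1 x| <= C * `|a_ j x|.
Hypothesis a_ratio_lower : forall j m,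
  \forall x \near +oo, ln x ^+ m * `|a_ j.+1 x| <= x ^+ j.+2 * `|a_ j.+2 x|.
Hypothesis a1_gt0 : \forall x \near +oo, 0 < a_ 1 x.
Hypothesis a1_lower : forall m, \forall x \near +oo, ln x ^+ m <= x * a_ 1 x.
Hypothesis a_last : exists C : R, \forall x \near +oo, x * `|a_ k.+1 x| <= C.

Lemma uniform_ratio n : exists2 C : R, 1 <= C & (\forall x \near +oo,
  forall j, (j <= n)%N -> x * `|a_ j.+1 x| <= C * `|a_ j x|) /\
  (\forall x \near +oo, x * `|a_ k.+1 x| <= C).
Proof.
have [C hC] : exists C : nat -> R, forall j, \forall x \near +oo, x * `|a_ j.+1 x| <= C j * `|a_ j x|.
  by have [C hC] := choice a_ratio_upper; exists C.
have [C' hC'] := a_last.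
have [B [BC B1 BC']] : exists B, [/\ forall j, (j <= n)%N -> C j <= B, 1 <= B & C' <= B].
  elim: n => [|n [B [BC B1 BC']]].
    exists (Num.max (C 0%N) (Num.max 1 C')); split; rewrite ?le_max ?lexx ?orbT//.
    by move=> j; rewrite leqn0 => /eqP ->; rewrite le_max lexx.
  exists (Num.max (C n.+1) B); split; rewrite ?le_max ?B1 ?BC' ?orbT//.
  move=> j; rewrite leq_eqVlt => /predU1P[->|/BC h]; first by rewrite le_max lexx.
  by rewrite le_max h orbT.
exists B => //; split; last by apply: filterS hC' => x h; exact: le_trans h BC'.
apply: filterS (near_forall_leq n hC) => x h j jn.
by apply: (le_trans (h j jn)); rewrite ler_wpM2r// BC.
Qed.

Lemma first_order_approximation (a C eta : R) (M L n : nat) :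
  (forall x, a < x -> is_derive x 1 (a_ 0) (a_ 1 x)) ->
  (forall x, a < x -> is_derive x 1 (a_ 1) (a_ 2 x)) ->
  a < M%:R -> (0 < M)%N ->
  (forall x, M%:R <= x -> 0 < a_ 1 x) -> (forall x, M%:R <= x -> x * `|a_ 2 x| <= C * a_ 1 x) ->
  (forall x, M%:R <= x -> 0 <= a_ 2 x) \/ (forall x, M%:R <= x -> a_ 2 x <= 0) ->
  0 <= C -> C * L%:R <= eta * M%:R -> 0 <= eta <= 2^-1 -> (n <= L)%N ->
  `|a_ 0 (M%:R + n%:R) - a_ 0 M%:R - n%:R * a_ 1 M%:R| <= 2 * eta * (n%:R * a_ 1 M%:R).
Proof.
move=> d0 d1 aM M0 p1 r1 s2 C0 CL eta01 nL.
have M0r : 0 < M%:R :> R by rewrite ltr0n.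
have [->|n0] := posnP n.
  by rewrite addr0 subrr !mul0r subr0 normr0 mulr0.
have n0r : 0 < n%:R :> R by rewrite ltr0n.
have nLr : n%:R <= L%:R :> R by rewrite ler_nat.
have Mn : M%:R < M%:R + n%:R :> R by lra.
have [c /andP[c1 c2] ->] := mvt d0 aM Mn.
have cb : M%:R <= c <= M%:R + L%:R by apply/andP; split; lra.
have /andP[h1 h2] := almost_constant d1 aM M0r p1 r1 s2 C0 CL eta01 cb.
have -> : a_ 1 c * (M%:R + n%:R - M%:R) - n%:R * a_ 1 M%:R = n%:R * (a_ 1 c - a_ 1 M%:R) by ring.
rewrite normrM (ger0_norm (ltW n0r)) (mulrCA _ n%:R) ler_pM2l//.
have := p1 _ (lexx _); case/andP: eta01 => e0 _ pM.
have : 0 <= eta * a_ 1 M%:R by rewrite mulr_ge0// ltW.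
by rewrite ler_norml => h; apply/andP; split; lra.
Qed.

(** [Y] is a free parameter because it is chosen before M; the shift [c] yields the sine sums as
    well and absorbs translations of the values. *)
Lemma polynomial_growth_sum (s b : nat) : exists C0 (a : R), (0 < C0)%N /\ forall (M L r : nat) (Y P c : R),
  a < M%:R -> ln M%:R <= Y -> Y <= ln M%:R ^+ 2 -> M%:R <= 2 * Y ^+ C0 * L%:R ->
  L%:R * Y ^+ C0 <= M%:R -> `|P - (a_ 0 (M%:R + L%:R) - a_ 0 M%:R)| <= 3 ->
  (0 < r)%N -> r%:R <= Y ^+ b * P ->
  Y ^+ s * `|\sum_(n < L) cos (2 * pi * (r%:R / P * a_ 0 (M%:R + n%:R)) + c)| <= L%:R.
Proof.
have [C C1 [near_ratio near_last]] := uniform_ratio k.+1.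
have [s_ hs] : exists s_ : nat -> R, forall j, s_ j * s_ j = 1 /\
    \forall x \near +oo, 0 < s_ j * a_ j x by have [S hS] := choice a_sign; exists S.
have [d [Cd [Cd0 test]]] := derivative_test_uniform (R := R) k.
(* [D] meets the requirement of the test at saving Y^s. [C0] makes the window so short that the
   error of linearization, multiplied by r <= 4 Y^D, still saves Y^s. The spare factors Y absorb
   constants; the exponents e1, e2, e3 are doubled below because Y may be as large as (ln M)^2. *)
pose D := (s * d).+1; pose C0 := (D + s + 2)%N.
pose e1 := ((C0 + 1) * k.+1 + (D + D + 1))%N.
pose e2 := (2 * C0 + 1)%N.
pose e3 := (b + D + C0 + 1)%N.
have /near_pinftyP[a ha] : \forall x \near +oo,
    ((forall j, (j <= k.+1)%N -> is_derive x (1 : R) (a_ j) (a_ j.+1 x)) /\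
     (forall j, (j <= k.+2)%N -> 0 < s_ j * a_ j x)) /\
    ((forall j, (j <= k.+1)%N -> x * `|a_ j.+1 x| <= C * `|a_ j x|) /\
     x * `|a_ k.+1 x| <= C) /\
    ((forall j, (j <= k)%N -> ln x ^+ (2 * e1) * `|a_ j.+1 x| <= x ^+ j.+2 * `|a_ j.+2 x|) /\
     0 < a_ 1 x /\ ln x ^+ (2 * e2) <= x * a_ 1 x) /\
    (1 * ln x ^+ (2 * e3) <= x /\ 128 + Cd%:R + 8 * C + k.+2%:R <= ln x).
  near=> x; split; [split|split; [split|split; [split; [|split]|split]]]; near: x => //.
  - exact: near_forall_leq.
  - by apply: near_forall_leq => j; exact: (hs j).2.
  - exact: near_forall_leq.
  - exact: near_lnX_le.
  - exact: near_ln_ge.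
exists C0, (Num.max a 1); split=> [|M L r Y P c]; first by rewrite /C0 addn2.
rewrite gt_max => /andP[aM M1] lnY Yln ML LM PL r0 rP.
have M0 : (0 < M)%N by rewrite -(ltr_nat R); apply: lt_trans M1.
have M0r : 0 < M%:R :> R by rewrite ltr0n.
have [[dM sgM] [[_ lastM] [[lowM [pM a1M]] [YM Ybig]]]] := ha _ aM.
have Mx x : M%:R <= x -> a < x by apply: lt_le_trans.
have Yge : 128 + Cd%:R + 8 * C + k.+2%:R <= Y by exact: le_trans lnY.
have Cdr : 0 <= Cd%:R :> R by [].
have kr : 0 <= k.+2%:R :> R by [].
have Y1 : 1 <= Y by lra.
have Y128 : 128 <= Y by lra.
have nY n : (n <= 128)%N -> n%:R <= Y by move=> n128; apply: le_trans Y128; rewrite ler_nat.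
have YCd : Cd%:R <= Y by lra.
have Cp : 0 <= C by lra.
have YC : C <= Y by lra.
have Y0 : 0 < Y by lra.
have l0 : 0 <= ln M%:R :> R by lra.
have Ypow e : Y ^+ e <= ln M%:R ^+ (2 * e).
  by rewrite exprM; apply: lerXn2r; rewrite ?nnegrE ?exprn_ge0//; lra.
have Yp e : 0 < Y ^+ e by rewrite exprn_gt0.
have Y1p e : 1 <= Y ^+ e by rewrite exprn_ege1.
have L0 : 0 < L%:R :> R.
  rewrite lt_neqAle ler0n andbT eq_sym; apply/eqP => L0.
  by move: ML; rewrite L0 mulr0; lra.
have YDC0 : Y ^+ C0 = Y ^+ D * Y ^+ s * Y ^+ 2 by rewrite /C0 !exprD.
have L4 : 4 * Y ^+ D < L%:R.
  have h : Y ^+ e3 <= M%:R by apply: le_trans YM; rewrite mul1r.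
  have h2 : Y * (Y ^+ D * Y ^+ C0) <= Y ^+ e3.
    rewrite /e3 addn1 exprS ler_pM2l// (exprD Y (b + D) C0) (exprD Y b D).
    by rewrite -[leRHS]mulrA ler_peMl// mulr_ge0// ltW.
  have h3 : 0 < Y ^+ D * Y ^+ C0 by rewrite mulr_gt0.
  rewrite -(ltr_pM2r (_ : 0 < 2 * Y ^+ C0)); last by rewrite mulr_gt0.
  apply: (@lt_le_trans _ _ (Y * (Y ^+ D * Y ^+ C0))).
    have -> : 4 * Y ^+ D * (2 * Y ^+ C0) = 8 * (Y ^+ D * Y ^+ C0) by ring.
    by rewrite ltr_pM2r//; apply: lt_le_trans Y128; rewrite ltr_nat.
  by rewrite [leRHS]mulrC; apply: le_trans ML; exact: le_trans h.
have YY : Y * Y <= Y ^+ C0.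
  rewrite YDC0 expr2 ler_peMl ?mulr_ge0 ?(ltW Y0)// mulr_ege1//.
have kL : (k.+2 <= L)%N.
  rewrite -(ler_nat R); have := Y1p (s * d)%N.
  have : Y <= Y ^+ D by rewrite /D exprS ler_peMr// ltW.
  lra.
have CL : 8 * C * L%:R <= M%:R.
  apply: le_trans LM; rewrite mulrC ler_wpM2l//; apply: le_trans YY.
  nra.
have dlt : 0 < Y / Y ^+ C0 <= 2^-1.
  rewrite divr_gt0//= ler_pdivrMr//; nra.
set delta := Y / Y ^+ C0 in dlt.
set F1 := a_ 1 M%:R.
have approx n : (n <= L)%N -> `|a_ 0 (M%:R + n%:R) - a_ 0 M%:R - n%:R * F1| <= delta / 2 * (n%:R * F1).
  move=> nL.
  have ex : C / Y ^+ C0 <= 2^-1 by rewrite ler_pdivrMr//; nra.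
  apply: le_trans (first_order_approximation (C := C) (eta := C / Y ^+ C0) (a := a) (L := L) _ _ aM M0 _ _ _ _ _ _ nL) _.
  - by move=> x ax; exact: ((ha x ax).1.1 0%N).
  - by move=> x ax; exact: ((ha x ax).1.1 1%N).
  - by move=> x /Mx/ha[_ [_ [[_ [p _]] _]]].
  - move=> x /Mx/ha[_ [[h _] [[_ [p _]] _]]].
    by have := h 1%N isT; rewrite (gtr0_norm p).
  - have [s22 _] := hs 2%N; have : s_ 2 != 0.
      by apply/eqP => e; move: s22; rewrite e mul0r => /esym/eqP; rewrite oner_eq0.
    case: (ltgtP (s_ 2) 0) => // sg _; [right|left] => x /Mx/ha[[_ h] _].
      by have := h 2%N isT; rewrite (nmulr_rgt0 _ sg) => /ltW.
    by have := h 2%N isT; rewrite (pmulr_rgt0 _ sg) => /ltW.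
  - exact: Cp.
  - by rewrite mulrAC ler_pdivlMr// -mulrA ler_wpM2l.
  - by rewrite ex andbT divr_ge0 ?(ltW (Yp _)).
  - rewrite ler_wpM2r ?mulr_ge0 ?(ltW pM)// /delta.
    have -> : Y / Y ^+ C0 / 2 = (Y / 2) * (Y ^+ C0)^-1 by field; rewrite gt_eqF.
    rewrite mulrA ler_wpM2r ?invr_ge0 ?(ltW (Yp _))//; lra.
have LF : 6 <= delta * (L%:R * F1).
  have h1 : Y ^+ e2 <= M%:R * F1 by apply: le_trans a1M; exact: Ypow.
  have h2 : M%:R * F1 <= 2 * Y ^+ C0 * (L%:R * F1) by rewrite mulrA ler_wpM2r// ltW.
  have h3 : Y ^+ e2 = Y * (Y ^+ C0 * Y ^+ C0) by rewrite /e2 addn1 exprS mul2n -addnn exprD.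
  rewrite h3 in h1; have := le_trans h1 h2.
  have -> : Y * (Y ^+ C0 * Y ^+ C0) = (Y * Y ^+ C0) * Y ^+ C0 by ring.
  have -> : 2 * Y ^+ C0 * (L%:R * F1) = 2 * (L%:R * F1) * Y ^+ C0 by ring.
  rewrite ler_pM2r// => h4.
  rewrite /delta mulrAC ler_pdivlMr//.
  have : Y * (Y * Y ^+ C0) <= Y * (2 * (L%:R * F1)) by rewrite ler_pM2l.
  have : 12 * Y ^+ C0 <= Y * Y * Y ^+ C0 by rewrite ler_pM2r//; nra.
  move: (Y ^+ C0) (L%:R * F1) => y z; lra.
have PF : `|P - L%:R * F1| <= delta * (L%:R * F1).
  have := approx L (leqnn L); set Delta := a_ 0 _ - a_ 0 _ in PL * => h.
  have -> : P - L%:R * F1 = (P - Delta) + (Delta - L%:R * F1) by ring.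
  by apply: (le_trans (ler_normD _ _)); lra.
have LF0 : 0 < L%:R * F1 by rewrite mulr_gt0.
have [P0 P2] : 0 < P /\ P <= 2 * (L%:R * F1).
  case/andP: dlt => d0 d2.
  have : delta * (L%:R * F1) <= 2^-1 * (L%:R * F1) by rewrite ler_wpM2r// ltW.
  exact: near_multiple LF0 PF.
(* Below this bound r < L, and [near_linear_sum] applies. Above it, P <= 2 L F1 gives beta F1 L >= 2
   Y^D, which starts the search for an order. *)
have [rs|rs] := leP (r%:R) (4 * Y ^+ D).
  have rL : (0 < r < L)%N by rewrite r0 -(ltr_nat R); exact: le_lt_trans L4.
  have d01 : 0 <= delta <= 2^-1 by case/andP: dlt => /ltW -> ->.
  have apx n : (n < L)%N -> `|a_ 0 (M%:R + n%:R) - a_ 0 M%:R - n%:R * F1| <= delta * (L%:R * F1).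
    move=> nL; apply: (le_trans (approx n (ltnW nL))); case/andP: d01 => d0 _.
    have nLr : n%:R <= L%:R :> R by rewrite ler_nat ltnW.
    apply: ler_pM.
    - exact: divr_ge0.
    - by apply: mulr_ge0 => //; exact: ltW.
    - by rewrite ler_pdivrMr// ler_peMr// ler1n.
    - by rewrite ler_pM2r.
  have := near_linear_sum (x := fun n => a_ 0 (M%:R + n%:R) - a_ 0 M%:R)
    (c + 2 * pi * (r%:R / P * a_ 0 M%:R)) rL pM d01 apx PF.
  rewrite (eq_bigr (fun n : 'I_L => cos (2 * pi * (r%:R / P * a_ 0 (M%:R + n%:R)) + c))); last first.
    by move=> n _; congr cos; ring.
  move=> /(ler_wpM2l (ltW (Yp s))) /le_trans; apply.
  have -> : Y ^+ s * (32 * r%:R * delta * L%:R) = (32 * (r%:R * (Y ^+ s * delta))) * L%:R by ring.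
  rewrite ler_piMl// /delta YDC0.
  have -> : Y ^+ s * (Y / (Y ^+ D * Y ^+ s * Y ^+ 2)) = (Y ^+ D * Y)^-1.
    by field; rewrite !gt_eqF.
  rewrite mulrA ler_pdivrMr ?mulr_gt0// mul1r.
  have : 128 * Y ^+ D <= Y * Y ^+ D by rewrite ler_pM2r.
  lra.
set beta := r%:R / P in rP *.
have r0r : 0 < r%:R :> R by rewrite ltr0n.
have b0 : 0 < beta by rewrite divr_gt0.
have T1 : 2 * Y ^+ D <= beta * `|a_ 1 M%:R| * L%:R.
  rewrite gtr0_norm//.
  have -> : beta * a_ 1 M%:R * L%:R = r%:R * (L%:R * F1) / P by rewrite /F1 /beta; field; rewrite gt_eqF.
  rewrite ler_pdivlMr//.
  have : 4 * Y ^+ D * P <= r%:R * P by rewrite ler_pM2r// ltW.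
  have : r%:R * P <= r%:R * (2 * (L%:R * F1)) by rewrite ler_pM2l.
  lra.
have bY : beta <= Y ^+ b by rewrite ler_pdivrMr.
have Tk : beta * `|a_ k.+1 M%:R| * Y ^+ D <= 1.
  rewrite -(ler_pM2l M0r) mulr1.
  have -> : M%:R * (beta * `|a_ k.+1 M%:R| * Y ^+ D) = beta * (M%:R * `|a_ k.+1 M%:R|) * Y ^+ D by ring.
  apply: (@le_trans _ _ (Y ^+ b * C * Y ^+ D)).
    by rewrite ler_pM2r//; apply: ler_pM => //; exact: ltW.
  have h : Y ^+ e3 <= M%:R by apply: le_trans YM; rewrite mul1r.
  apply: le_trans h; rewrite /e3 addn1 exprS (exprD Y (b + D) C0) (exprD Y b D).
  have -> : Y ^+ b * C * Y ^+ D = C * (Y ^+ b * Y ^+ D) by ring.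
  apply: ler_pM => //; first by rewrite mulr_ge0// ltW.
  by rewrite ler_peMr// mulr_ge0// ltW.
have Wb : (2 * Y ^+ C0) ^+ k.+1 * (2 * Y ^+ (D + D)) <= ln M%:R ^+ (2 * e1).
  apply: le_trans (Ypow e1); rewrite /e1 (exprD Y ((C0 + 1) * k.+1)) (exprM Y (C0 + 1)).
  have y0 : 0 <= 2 * Y ^+ C0 by rewrite mulr_ge0// ltW.
  apply: ler_pM.
  - by rewrite exprn_ge0.
  - by rewrite mulr_ge0// ltW.
  - apply: lerXn2r; rewrite ?nnegrE// ?(ltW (Yp _))//.
    by rewrite addn1 exprS ler_pM2r//; exact: (nY 2%N).
  - by rewrite (addn1 (D + D)) exprS ler_pM2r//; exact: (nY 2%N).
have EY : Cd%:R * (Y ^+ s) ^+ d <= Y ^+ D.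
  by rewrite -exprM /D exprS ler_pM2r.
apply: (@high_frequency_sum a_ s_ k d Cd D C0 M L a C (Y ^+ s) beta c Y (ln M%:R ^+ (2 * e1))) => //.
- by move=> j x jk ax; have [[h _] _] := ha x ax; exact: h.
- by move=> j; exact: (hs j).1.
- by move=> j x jk /Mx/ha[[_ h] _]; exact: h.
- by move=> j x jk /Mx/ha[_ [[h _] _]]; exact: h.
- by move=> j jk; apply: lowM; exact: ltnW.
Unshelve. all: by end_near. Qed.

End PolynomialGrowthSums.

(** * From windows to solutions *)

Section LocalSolution.
Context {R : realType}.

(** Replacing v n by an integer within 1 of it moves the angle by at most 2 pi r / q <= 8 kappa,
    which is small only at low frequencies. *)
Lemma csum_floor_approx (q r L : nat) (u : nat -> nat) (v : nat -> R) (eps kappa c : R) :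
  (0 < q)%N -> r%:R <= kappa * q%:R ->
  (forall n, (n < L)%N -> 0 <= v n - (u n)%:R <= 1) ->
  `|\sum_(n < L) cos (2 * pi * (r%:R / q%:R * v n) + c)| <= eps * L%:R ->
  `|\sum_(n < L) cos (2 * pi * (r%:R * (u n)%:R / q%:R) + c)| <= (8 * kappa + eps) * L%:R.
Proof.
move=> q0 rk vu h; have q0r : 0 < q%:R :> R by rewrite ltr0n.
have pi0 := @pi_gt0 R.
have pi4 : pi <= 4 :> R by have /andP[_] := @pihalf_02 R; lra.
set S := \sum_(n < L) _ in h; set S' := \sum_(n < L) _.
have -> : S' = (S' - S) + S by ring.
rewrite mulrDl; apply: (le_trans (ler_normD _ _)); apply: lerD => //.
rewrite /S' /S -sumrB; apply: (le_trans (ler_norm_sum _ _ _)).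
have -> : 8 * kappa * L%:R = \sum_(n < L) (8 * kappa).
  by rewrite sumr_const card_ord -[RHS]mulr_natr.
apply: ler_sum => n _; apply: (le_trans (cos_lipschitz _ _)).
have -> : 2 * pi * (r%:R * (u n)%:R / q%:R) + c - (2 * pi * (r%:R / q%:R * v n) + c) =
  - (2 * pi * (r%:R / q%:R) * (v n - (u n)%:R)) by ring.
have /andP[w0 w1] := vu n (ltn_ord n).
have rq : r%:R / q%:R <= kappa by rewrite ler_pdivrMr.
have rq0 : 0 <= r%:R / q%:R :> R by rewrite divr_ge0.
rewrite normrN !normrM (ger0_norm (_ : 0 <= 2))// (gtr0_norm pi0) -normrM !ger0_norm//.
have h1 : 2 * pi * (r%:R / q%:R) <= 8 * kappa.
  have h2 : pi * (r%:R / q%:R) <= 4 * kappa by apply: ler_pM => //; exact: ltW.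
  lra.
have h2 : 0 <= 2 * pi * (r%:R / q%:R) :> R.
  by apply: mulr_ge0 => //; apply: mulr_ge0 => //; exact: ltW.
by apply: le_trans h1; rewrite ler_piMr.
Qed.

Lemma sum_iota_ord (f : nat -> R) L : \sum_(n <- iota 0 L) f n = \sum_(n < L) f n.
Proof. by rewrite -(big_mkord xpredT f) /index_iota subn0. Qed.

Lemma floor_of_grid (G u x y i i' b0 : nat) (v : R) : (0 < G)%N -> (i + i' < G)%N ->
  u%:R <= G%:R * (v - b0%:R) < u.+1%:R -> u = ((G * x + i) + (G * y + i'))%N ->
  ((x + y + b0)%N%:Z : int) = Num.floor v.
Proof.
move=> G0 iG /andP[uv1 uv2] uE; have G0r : 0 < G%:R :> R by rewrite ltr0n.
have xyu : G%:R * (x + y)%:R <= u%:R :> R by rewrite -natrM ler_nat uE; lia.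
have uxy : u.+1%:R <= G%:R * ((x + y)%:R + 1) :> R.
  by rewrite natr1 -natrM ler_nat uE; lia.
have h1 : (x + y)%:R <= v - b0%:R by rewrite -(ler_pM2l G0r); exact: le_trans uv1.
have h2 : v - b0%:R < (x + y)%:R + 1 by rewrite -(ltr_pM2l G0r); exact: lt_le_trans uxy.
apply/esym/floor_def; rewrite intrD.
have -> : (Posz (x + y + b0))%:~R = (x + y)%:R + b0%:R :> R by rewrite -natrD.
by apply/andP; split; lra.
Qed.

(** The density hypotheses give P (a + b) <= 2 Y^7 a b. The low frequencies then cost 36 Y^(7-9)
    G1^2 a b and the high ones 32 Y^(18+7) G1 a b, against G1^2 a b. *)
Lemma circle_condition (P G1 a b : nat) (Y kappa : R) : 1000 <= Y ->
  (0 < P)%N -> Y ^+ 26 <= G1%:R -> kappa = (Y ^+ 9)^-1 ->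
  P%:R <= Y ^+ 7 * a%:R -> P%:R <= Y ^+ 7 * b%:R ->
  ((8 * kappa + (Y ^+ 9)^-1) * (2 * G1 * P)%:R * G1%:R +
    8 / kappa ^+ 2 * (2 * G1 * P)%:R) * (a%:R + b%:R) < G1%:R ^+ 2 * a%:R * b%:R.
Proof.
move=> Y1000 P0 G1Y kE aP bP.
have Y0 : 0 < Y by lra.
have Yp e : 0 < Y ^+ e by rewrite exprn_gt0.
have P0r : 0 < P%:R :> R by rewrite ltr0n.
have a0 : 0 < a%:R :> R by rewrite -(pmulr_rgt0 _ (Yp 7)); lra.
have b0 : 0 < b%:R :> R by rewrite -(pmulr_rgt0 _ (Yp 7)); lra.
have ab : P%:R * (a%:R + b%:R) <= 2 * Y ^+ 7 * (a%:R * b%:R).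
  have h1 : P%:R * a%:R <= Y ^+ 7 * b%:R * a%:R by rewrite ler_pM2r.
  have h2 : P%:R * b%:R <= Y ^+ 7 * a%:R * b%:R by rewrite ler_pM2r.
  by move: (a%:R) (b%:R) (P%:R) (Y ^+ 7) h1 h2 => x y z t; lra.
set g := G1%:R in G1Y *.
have g0 : 0 < g by apply: lt_le_trans G1Y.
have -> : (2 * G1 * P)%:R = 2 * g * P%:R by rewrite !natrM.
rewrite kE.
have -> : ((8 * (Y ^+ 9)^-1 + (Y ^+ 9)^-1) * (2 * g * P%:R) * g +
  8 / (Y ^+ 9)^-1 ^+ 2 * (2 * g * P%:R)) * (a%:R + b%:R) =
  (18 * (Y ^+ 9)^-1 * g + 16 * Y ^+ 18) * g * (P%:R * (a%:R + b%:R)).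
  have -> : (Y ^+ 9)^-1 ^+ 2 = (Y ^+ 18)^-1 by rewrite exprVn -exprM.
  by rewrite invrK; ring.
have c0 : 0 < (18 * (Y ^+ 9)^-1 * g + 16 * Y ^+ 18) * g.
  have h := Yp 18%N; have k : 0 < (Y ^+ 9)^-1 * g by rewrite mulr_gt0 ?invr_gt0.
  by rewrite mulr_gt0//; lra.
apply: (@le_lt_trans _ _ ((18 * (Y ^+ 9)^-1 * g + 16 * Y ^+ 18) * g * (2 * Y ^+ 7 * (a%:R * b%:R)))).
  by rewrite ler_pM2l.
have -> : (18 * (Y ^+ 9)^-1 * g + 16 * Y ^+ 18) * g * (2 * Y ^+ 7 * (a%:R * b%:R)) =
  ((36 * (Y ^+ 2)^-1) * g + 32 * Y ^+ 25) * (g * (a%:R * b%:R)).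
  by field; rewrite gt_eqF.
have -> : g ^+ 2 * a%:R * b%:R = g * (g * (a%:R * b%:R)) by ring.
rewrite ltr_pM2r; last by rewrite !mulr_gt0.
have h1 : 36 * (Y ^+ 2)^-1 <= 10^-1.
  rewrite ler_pdivrMr// expr2; nra.
have h2 : 36 * (Y ^+ 2)^-1 * g <= 10^-1 * g by rewrite ler_pM2r.
have h3 : 1000 * Y ^+ 25 <= g.
  by apply: le_trans G1Y; rewrite (exprS _ 25) ler_pM2r.
lra.
Qed.

(** After subtracting floor (al M) the values lie in [0, Delta + 1), and P > Delta + 2. Hence both
    sides of the congruence modulo GP are below GP, and it is an equality. *)
Lemma find_solution (al : R -> R) (M L P : nat) (Y Delta : R) (A B : seq nat) :
  1000 <= Y -> (0 < L)%N -> 0 <= al M%:R ->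
  (forall n, (n < L)%N -> 0 <= al (M%:R + n%:R) - al M%:R <= Delta) ->
  P = (Num.truncn Delta + 3)%N ->
  (forall r c, (0 < r)%N -> r%:R <= Y ^+ 18 * P%:R -> Y ^+ 9 *
     `|\sum_(n < L) cos (2 * pi * (r%:R / P%:R * al (M%:R + n%:R)) + c)| <= L%:R) ->
  uniq A -> uniq B -> (forall x y, x \in A -> y \in B -> (x + y < P)%N) ->
  P%:R <= Y ^+ 7 * (size A)%:R -> P%:R <= Y ^+ 7 * (size B)%:R ->
  exists n x y, [/\ (n < L)%N, x \in A, y \in B &
    ((x + y + Num.truncn (al M%:R))%N%:Z : int) = Num.floor (al (M%:R + n%:R))].
Proof.
move=> Y1000 L0 aM0 aMn PE ES uA uB ABP AP BP.
have Y0 : 0 < Y by lra.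
have Yp e : 0 < Y ^+ e by rewrite exprn_gt0.
have P0 : (0 < P)%N by rewrite PE addnS.
have P0r : 0 < P%:R :> R by rewrite ltr0n.
have L0r : 0 < L%:R :> R by rewrite ltr0n.
have [G1 [G1l G1u]] : exists G1 : nat, Y ^+ 26 <= G1%:R /\ G1%:R <= 2 * Y ^+ 26.
  exists (Num.truncn (Y ^+ 26)).+1.
  have /andP[h1 h2] := truncn_itv (ltW (Yp 26%N)).
  have h3 : 1 <= Y ^+ 26 by rewrite exprn_ege1//; lra.
  by split; [exact: ltW|rewrite -natr1; lra].
have G10 : (0 < G1)%N by rewrite -(ltr_nat R); exact: lt_le_trans G1l.
pose G := (2 * G1)%N.
have G0 : (0 < G)%N by rewrite muln_gt0.
have G0r : 0 < G%:R :> R by rewrite ltr0n.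
pose q := (G * P)%N.
have q0 : (0 < q)%N by rewrite muln_gt0 G0.
pose b0 := Num.truncn (al M%:R).
have /andP[b1 b2] := truncn_itv aM0; rewrite -/b0 in b1 b2.
pose v n := G%:R * (al (M%:R + n%:R) - b0%:R).
pose u n := Num.truncn (v n).
have v0 n : (n < L)%N -> 0 <= v n.
  by move=> nL; have /andP[h _] := aMn n nL; rewrite /v mulr_ge0//; lra.
have vu n : (n < L)%N -> (u n)%:R <= v n < (u n).+1%:R.
  by move=> nL; exact: truncn_itv (v0 n nL).
have D0 : 0 <= Delta by have /andP[h1 h2] := aMn 0%N L0; exact: le_trans h2.
have /andP[D1 D2] := truncn_itv D0.
have PD : Delta + 2 < P%:R by rewrite PE natrD; move: D2; rewrite -natr1; lra.
have uq n : (n < L)%N -> (u n < q)%N.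
  move=> nL; have /andP[h _] := vu n nL; rewrite -(ltr_nat R).
  apply: (le_lt_trans h); rewrite /v /q natrM ltr_pM2l//.
  have /andP[_ h2] := aMn n nL; move: b2; rewrite -natr1; lra.
pose kappa : R := (Y ^+ 9)^-1.
have k0 : 0 < kappa by rewrite invr_gt0.
pose U := [seq u n | n <- iota 0 L].
have sU : size U = L by rewrite size_map size_iota.
have bound r c : (0 < r)%N -> r%:R <= kappa * q%:R ->
    `|\sum_(n < L) cos (2 * pi * (r%:R * (u n)%:R / q%:R) + c)| <= (8 * kappa + kappa) * L%:R.
  move=> r0 rk; apply: (csum_floor_approx (v := v)) => //.
    move=> n nL; have /andP[h1 h2] := vu n nL.
    by rewrite -natr1 in h2; apply/andP; split; lra.
  have rP : r%:R <= Y ^+ 18 * P%:R.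
    apply: (le_trans rk); rewrite /q natrM mulrA ler_pM2r// /kappa mulrC ler_pdivrMr//.
    rewrite /G natrM -exprD; apply: (@le_trans _ _ (4 * Y ^+ 26)); first lra.
    by rewrite (exprS _ 26) ler_pM2r//; lra.
  (* The factor G in [v] cancels the one in q = GP, leaving the frequency r / P; the translation by
     [b0] goes into the constant shift. *)
  have := ES r (c - 2 * pi * (r%:R / P%:R * b0%:R)) r0 rP.
  rewrite (eq_bigr (fun n : 'I_L => cos (2 * pi * (r%:R / q%:R * v n) + c))); last first.
    move=> n _; congr cos; rewrite /v /q natrM; field.
    by rewrite !gt_eqF.
  by rewrite -ler_pdivlMl// mulrC.
have csE r : csum q r U = \sum_(n < L) cos (2 * pi * (r%:R * (u n)%:R / q%:R) + 0) :> R.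
  rewrite /csum big_map (sum_iota_ord (fun n => cos (2 * pi * (r%:R * (u n)%:R / q%:R)))).
  by apply: eq_bigr => n _; rewrite addr0.
have ssE r : ssum q r U = \sum_(n < L) cos (2 * pi * (r%:R * (u n)%:R / q%:R) + - (pi / 2)) :> R.
  rewrite /ssum big_map (sum_iota_ord (fun n => sin (2 * pi * (r%:R * (u n)%:R / q%:R)))).
  by apply: eq_bigr => n _; rewrite cosBpihalf.
have sA : 0 < (size A)%:R :> R by rewrite -(pmulr_rgt0 _ (Yp 7%N)); lra.
have sB : 0 < (size B)%:R :> R by rewrite -(pmulr_rgt0 _ (Yp 7%N)); lra.
have hasA : has predT A by rewrite has_predT -(ltr_nat R).
have hasB : has predT B by rewrite has_predT -(ltr_nat R).
have [x0 x0A _] := hasP hasA; have [y0 y0B _] := hasP hasB.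
have AltP : all (fun a => (a < P)%N) A.
  by apply/allP => x xA; apply: leq_ltn_trans (ABP x y0 xA y0B); exact: leq_addr.
have BltP : all (fun a => (a < P)%N) B.
  by apply/allP => y yB; apply: leq_ltn_trans (ABP x0 y x0A yB); exact: leq_addl.
have eps0 : 0 <= 8 * kappa + kappa by lra.
have G1G : (0 < G1 <= G)%N by rewrite G10 /G mul2n -addnn leq_addr.
have [||w [x [y [i [i' [wU xA yB [iG i'G] e]]]]]] :=
  circle_method (U := U) (kappa := kappa) eps0 G1G P0 uA uB AltP BltP k0.
- by move=> r r0 _ rk; rewrite sU csE ssE; split; exact: bound.
- rewrite sU ltr_pM2l//; exact: circle_condition G1l (erefl _) AP BP.
case/mapP: wU => n; rewrite mem_iota add0n => /andP[_ nL] wE.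
exists n, x, y; split=> //.
have iiG : (i + i' < G)%N by rewrite /G mul2n -addnn -addnS leq_add// ltnW.
apply: (floor_of_grid G0 iiG (vu n nL)).
move: e; rewrite wE (modn_small (uq n nL)) modn_small//.
have xy := ABP x y xA yB.
apply: (@leq_trans (G * (x + y).+1)); last by rewrite leq_mul2l xy orbT.
by rewrite mulnS mulnDr addnACA [X in (_ < X)%N]addnC ltn_add2l.
Qed.

End LocalSolution.

(** * Pigeonhole for a dense block *)

Section Blocks.

(** Elements below [lo] are discarded before the pigeonhole: the solution must be large, and the
    base of the chosen block must be comparable with N up to powers of Y. *)
Lemma dense_block (X : seq nat) N W lo : (0 < W)%N -> uniq X -> all (fun x => (x <= N)%N) X ->
  exists a, (size X - lo <= (N %/ W).+1 *
    size [seq x <- X | (lo <= x)%N && (x %/ W == a)%N])%N.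
Proof.
move=> W0 uX XN; set K := (N %/ W).+1.
pose X' := [seq x <- X | (lo <= x)%N].
have sX' : (size X - lo <= size X')%N.
  rewrite leq_subLR size_filter -(count_predC (fun x => (lo <= x)%N)) addnC leq_add2r.
  rewrite -size_filter -[X in (_ <= X)%N](size_iota 0 lo); apply: uniq_leq_size.
    exact: filter_uniq.
  by move=> x; rewrite mem_filter mem_iota /= add0n ltnNge => /andP[].
have X'K x : x \in X' -> (x %/ W < K)%N.
  by rewrite mem_filter => /andP[_ /(allP XN)] h; rewrite ltnS leq_div2r.
have tot : (size X' = \sum_(a < K) count (fun x => (x %/ W == a)%N) X')%N.
  elim: (X') X'K => [|x s IH] h; first by rewrite big1.
  rewrite /= big_split /= -IH; last by move=> y ys; apply: h; rewrite inE ys orbT.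
  have xK : (x %/ W < K)%N by apply: h; rewrite inE eqxx.
  rewrite (bigD1 (Ordinal xK))//= eqxx big1 ?addn0 ?add1n// => i.
  by rewrite -val_eqE /= eq_sym => /negbTE ->.
have cE a : size [seq x <- X | (lo <= x)%N && (x %/ W == a)%N] = count (fun x => (x %/ W == a)%N) X'.
  by rewrite size_filter count_filter; apply: eq_count => x; rewrite /= andbC.
apply: contrapT => nex.
have lt a : (K * count (fun x => (x %/ W == a)%N) X' < size X')%N.
  rewrite ltnNge; apply/negP => h; apply: nex; exists a; rewrite cE.
  exact: leq_trans sX' h.
have : (K * size X' <= \sum_(a < K) (size X').-1)%N.
  rewrite {1}tot big_distrr /=; apply: leq_sum => a _.
  by rewrite -ltnS (ltn_predK (lt a)) lt.
rewrite sum_nat_const card_ord leq_pmul2l// leqNgt => /negP; apply.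
by rewrite (ltn_predK (lt 0%N)).
Qed.

End Blocks.

(** * Sizes of blocks and windows *)

Section GlobalArgument.
Context {R : realType}.

Lemma crossing (al : R -> R) (m0 : nat) (T : R) : (\forall x \near +oo, T < al x) ->
  al m0%:R <= T -> exists M, [/\ (m0 <= M)%N, al M%:R <= T & T < al (M%:R + 1)].
Proof.
move=> /near_pinftyP[a ha] h0.
have ex : exists m, (m0 <= m)%N && (T < al m%:R).
  exists (maxn m0 (Num.truncn `|a|).+1); rewrite leq_maxl/= ha//.
  apply: (le_lt_trans (ler_norm a)).
  have /andP[_ h] := truncn_itv (normr_ge0 a); apply: (lt_le_trans h).
  by rewrite ler_nat leq_maxr.
case: (ex_minnP ex) => m /andP[m0m Tm] mmin.
have mm : (m0 < m)%N.
  by rewrite ltn_neqAle m0m andbT; apply/eqP => e; move: Tm; rewrite -e ltNge h0.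
case: m mm Tm mmin {m0m} => // m mm Tm mmin; exists m; split=> //.
- rewrite leNgt; apply/negP => h; have := mmin m; rewrite -ltnS mm h => /(_ isT).
  by rewrite ltnn.
- by rewrite natr1.
Qed.

Lemma increment_upper (al da : R -> R) (a C M D : R) : (forall x, a < x -> is_derive x 1 al (da x)) ->
  (forall x, a < x -> 0 < da x) -> (forall x, a < x -> 0 < al x) ->
  (forall x, a < x -> x * da x <= C * al x) ->
  0 <= C -> a < M -> 0 < M -> 0 < D -> 2 * C * D <= M ->
  al (M + D) <= 2 * al M /\ (al (M + D) - al M) * M <= 2 * C * D * al M.
Proof.
move=> ad da0 al0 daC C0 aM M0 D0 CD.
have MD : M < M + D by lra.
have [x /andP[x1 x2] e] := mvt ad aM MD.
have ax : a < x by lra.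
have p := da0 x ax.
have le1 : al x <= al (M + D).
  have [y /andP[y1 _] e'] := mvt ad ax x2.
  by rewrite -subr_ge0 e' mulr_ge0 ?ltW ?subr_gt0// da0// (lt_trans ax).
have h1 : M * da x <= C * al (M + D).
  apply: le_trans (_ : x * da x <= _); first by rewrite ler_pM2r// ltW.
  by apply: (le_trans (daC x ax)); rewrite ler_wpM2l.
have e2 : al (M + D) - al M = da x * D by rewrite e addrAC subrr add0r.
have h2 : (al (M + D) - al M) * M <= C * D * al (M + D).
  rewrite e2; have : M * da x * D <= C * al (M + D) * D by rewrite ler_pM2r.
  lra.
have pos : 0 < al (M + D) by apply: al0; lra.
have h3 : al (M + D) <= 2 * al M.
  have : 2 * C * D * al (M + D) <= M * al (M + D) by rewrite ler_pM2r.
  move=> h; rewrite -(ler_pM2r M0); lra.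
split=> //; apply: (le_trans h2).
have -> : 2 * C * D * al M = C * D * (2 * al M) by ring.
by rewrite ler_wpM2l// mulr_ge0// ltW.
Qed.

Lemma increment_lower (al da : R -> R) (a M D : R) : (forall x, a < x -> is_derive x 1 al (da x)) ->
  (forall x, a < x -> 0 < da x) -> (forall x, a < x -> al x <= x * ln x * da x) ->
  a < M -> 2 <= M -> 0 < D -> D <= M ->
  al M * D <= 4 * M * ln M * (al (M + D) - al M).
Proof.
move=> ad da0 alda aM M2 D0 DM.
have M0 : 0 < M by lra.
have MD : M < M + D by lra.
have [x /andP[x1 x2] ->] := mvt ad aM MD.
have ax : a < x by lra.
have p := da0 x ax.
have le1 : al M <= al x.
  have [y /andP[y1 _] e'] := mvt ad aM x1.
  by rewrite -subr_ge0 e' mulr_ge0 ?ltW ?subr_gt0// da0// (lt_trans aM).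
have l0 : 0 < ln M by rewrite ln_gt0//; lra.
have lx : ln x <= 2 * ln M.
  have e : 2 * ln M = ln (M * M) by rewrite lnM ?posrE//; ring.
  rewrite e ler_ln ?posrE; [nra|lra|nra].
have lx0 : 0 <= ln x by rewrite ln_ge0//; lra.
rewrite addrAC subrr add0r mulrA ler_pM2r//.
apply: (le_trans le1); apply: (le_trans (alda x ax)).
rewrite ler_pM2r//; have -> : 4 * M * ln M = (2 * M) * (2 * ln M) by ring.
by apply: ler_pM => //; lra.
Qed.

(** A and B have at least N / Y^2 elements, so discarding lo, about N / (2 Y^2), keeps half of them.
    The increment of [alpha] over the window will be at least N / (32 E Y^3); W, about N / (E Y^4),
    is smaller by a factor of order Y. *)
Lemma block_parameters (N : nat) (Y E : R) : 1000 <= Y -> Y <= E -> Y ^+ 6 * E <= 2 * N%:R ->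
  exists W lo : nat, [/\ (0 < W)%N /\ (W <= N)%N, N%:R <= 2 * (E * Y ^+ 4) * W%:R,
    W%:R * (E * Y ^+ 4) <= N%:R, lo%:R * (2 * Y ^+ 2) <= N%:R &
    N%:R + 4 * Y ^+ 2 * W%:R <= 4 * Y ^+ 2 * lo%:R /\ Y <= lo%:R].
Proof.
move=> Y1000 YE NE.
have Y0 : 0 < Y by lra.
have E0 : 0 < E by lra.
have Yp e : 0 < Y ^+ e by rewrite exprn_gt0.
have EY : 0 < E * Y ^+ 4 by rewrite mulr_gt0.
have N0 : 0 < N%:R :> R by have : 0 < Y ^+ 6 * E by [rewrite mulr_gt0]; lra.
have y2 : 1000 <= Y ^+ 2 by rewrite expr2; nra.
have Y1 : 1 <= Y by lra.
have E1 : 1 <= E by lra.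
have Y8 : 8 <= Y by lra.
have e6 : Y ^+ 6 * E = Y ^+ 2 * (E * Y ^+ 4) by ring.
have w1 : 1 <= N%:R / (E * Y ^+ 4).
  rewrite ler_pdivlMr// mul1r.
  have : 1000 * (E * Y ^+ 4) <= Y ^+ 2 * (E * Y ^+ 4) by rewrite ler_pM2r.
  lra.
have /andP[W1 W2] := truncn_itv (le_trans ler01 w1).
set W := Num.truncn _ in W1 W2.
have Wpos : (0 < W)%N.
  by rewrite -(ltr_nat R); rewrite -natr1 in W2; lra.
have W1r : 1 <= W%:R :> R by rewrite ler1n.
have lo0 : 0 <= N%:R / (2 * Y ^+ 2) by rewrite divr_ge0// mulr_ge0// ltW.
have /andP[l1 l2] := truncn_itv lo0.
set lo := Num.truncn _ in l1 l2.
have Y20 : 0 < 2 * Y ^+ 2 by rewrite mulr_gt0.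
rewrite ler_pdivlMr// in W1; rewrite ltr_pdivrMr// -natr1 in W2.
rewrite ler_pdivlMr// in l1; rewrite ltr_pdivrMr// -natr1 in l2.
have EY1 : 1 <= E * Y ^+ 4 by rewrite mulr_ege1 ?exprn_ege1.
have WN : W%:R <= N%:R :> R.
  by apply: le_trans W1; rewrite ler_peMr.
have h1 : 16 * Y ^+ 2 * W%:R <= N%:R.
  apply: le_trans W1; rewrite mulrC ler_wpM2l//.
  have -> : E * Y ^+ 4 = (E * Y ^+ 2) * Y ^+ 2 by ring.
  rewrite ler_pM2r; last exact: Yp.
  have : 1 * 16 <= E * Y ^+ 2 by apply: ler_pM; lra.
  lra.
have h2 : 16 * Y ^+ 2 <= N%:R by apply: le_trans h1; rewrite ler_peMr// mulr_ge0// ltW.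
have h3 : N%:R + 4 * Y ^+ 2 * W%:R <= 4 * Y ^+ 2 * lo%:R by lra.
exists W, lo; split=> //.
- by split=> //; rewrite -(ler_nat R).
- have : W%:R * (E * Y ^+ 4) >= E * Y ^+ 4 by rewrite ler_peMl// ltW.
  lra.
- split=> //; rewrite -(ler_pM2l (_ : 0 < 4 * Y ^+ 2)) ?mulr_gt0//.
  apply: le_trans h3.
  have : 4 * Y ^+ 2 * W%:R >= 0 by rewrite !mulr_ge0// ltW.
  have : 8 * Y ^+ 2 * Y <= Y ^+ 6 * E.
    have -> : Y ^+ 6 * E = Y ^+ 2 * Y * (Y ^+ 3 * E) by ring.
    have -> : 8 * Y ^+ 2 * Y = Y ^+ 2 * Y * 8 by ring.
    rewrite ler_pM2l ?mulr_gt0//.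
    have : 8 * 1 <= Y ^+ 3 * E; last by rewrite mulr1.
    apply: ler_pM => //; apply: (le_trans Y8).
    by rewrite (exprS _ 2) ler_peMr ?exprn_ege1// ltW.
  lra.
Qed.

(** [d] is the increment of [alpha] over one step and [z] the size of a block. The first claim lets
    two blocks fit in the window. For the second, Delta <= 4 C N / E while z >= N / (8 E Y^6); one
    further factor Y absorbs the constants, whence Y^7. *)
Lemma window_numerics (Y E N W al Delta M L C d z : R) : 1000 + 64 * C <= Y -> 1 <= C ->
  Y <= E -> 0 < W -> 0 < M -> 0 < L -> 0 < al ->
  N <= 2 * (E * Y ^+ 4) * W -> W * (E * Y ^+ 4) <= N -> N <= 4 * Y ^+ 2 * al -> al <= 2 * N ->
  al * L <= 4 * M * Y * Delta -> M <= 2 * E * L -> Delta * M <= 2 * C * L * al -> L * E <= M ->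
  d * M <= 2 * C * al -> Y ^+ 3 * E <= M -> Y ^+ 6 * E <= 2 * N -> W <= 4 * Y ^+ 2 * z ->
  2 * W + d <= Delta /\ Delta + 3 <= Y ^+ 7 * z.
Proof.
move=> YC C1 YE W0 M0 L0 al0 NW WN Nal alN alL ML DM LE dM YM YN Wz.
have Y0 : 0 < Y by lra.
have E0 : 0 < E := lt_le_trans Y0 YE.
have Cp : 0 <= C by lra.
have Y1 : 1 <= Y by lra.
have CY : 64 * C <= Y by lra.
have Yp e : 0 < Y ^+ e by rewrite exprn_gt0.
have EY4 : 0 < E * Y ^+ 4 by rewrite mulr_gt0.
have N0 : 0 < N by apply: lt_le_trans WN; rewrite mulr_gt0.
have alD : al <= 8 * E * Y * Delta.
  rewrite -(ler_pM2r L0); apply: (le_trans alL).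
  have D0 : 0 < Delta.
    have : 0 < 4 * M * Y * Delta by apply: lt_le_trans alL; rewrite mulr_gt0.
    by rewrite pmulr_rgt0// !mulr_gt0.
  have : M * (4 * Y * Delta) <= 2 * E * L * (4 * Y * Delta) by rewrite ler_pM2r// !mulr_gt0.
  lra.
have WD : Y * W <= 32 * Delta.
  rewrite -(ler_pM2r (mulr_gt0 E0 (Yp 3%N))).
  have -> : Y * W * (E * Y ^+ 3) = W * (E * Y ^+ 4) by ring.
  apply: (le_trans WN); apply: (le_trans Nal).
  have -> : 32 * Delta * (E * Y ^+ 3) = 4 * Y ^+ 2 * (8 * E * Y * Delta) by ring.
  by rewrite ler_pM2l// mulr_gt0.
have dD : d * Y ^+ 2 <= 16 * C * Delta.
  rewrite -(ler_pM2r (mulr_gt0 Y0 E0)).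
  have -> : 16 * C * Delta * (Y * E) = 2 * C * (8 * E * Y * Delta) by ring.
  have -> : d * Y ^+ 2 * (Y * E) = d * (Y ^+ 3 * E) by ring.
  have [d0|d0] := leP 0 d.
    apply: (le_trans (ler_wpM2l d0 YM)); apply: (le_trans dM).
    by rewrite ler_pM2l//; lra.
  apply: (@le_trans _ _ 0).
    by rewrite mulr_le0_ge0 ?(ltW d0)// mulr_ge0// ltW.
  by apply: mulr_ge0; [lra|exact: le_trans (ltW al0) alD].
have D0 : 0 <= Delta.
  have : 0 <= Y * W by rewrite mulr_ge0// ltW.
  lra.
split.
  have h1 : 128 * W <= Y * W by rewrite ler_pM2r//; lra.
  have [d0|d0] := leP d 0; first by lra.
  have h2 : 64 * C * d <= d * Y ^+ 2.
    rewrite mulrC ler_pM2l// expr2.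
    by rewrite -[leLHS]mulr1; apply: ler_pM; rewrite ?mulr_ge0.
  have h3 : C * (4 * d) <= C * Delta by lra.
  rewrite ler_pM2l in h3; lra.
have DE : Delta * E <= 2 * C * al.
  rewrite -(ler_pM2l L0).
  have -> : L * (Delta * E) = Delta * (L * E) by ring.
  apply: (le_trans (ler_wpM2l D0 LE)); apply: (le_trans DM); lra.
have h3 : 3 * E <= N.
  have : 6 * E <= Y ^+ 6 * E.
    rewrite ler_pM2r//; have : Y <= Y ^+ 6 by rewrite (exprS _ 5) ler_peMr ?exprn_ege1// ltW.
    lra.
  lra.
have CN : 2 * C * al <= 2 * C * (2 * N) by rewrite ler_pM2l//; lra.
have Nz : N <= 8 * E * Y ^+ 6 * z.
  apply: (le_trans NW).
  have : 2 * (E * Y ^+ 4) * W <= 2 * (E * Y ^+ 4) * (4 * Y ^+ 2 * z) by rewrite ler_pM2l// mulr_gt0.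
  have -> : 8 * E * Y ^+ 6 * z = 2 * (E * Y ^+ 4) * (4 * Y ^+ 2 * z) by ring.
  by [].
have z0 : 0 < z.
  have : 0 < 4 * Y ^+ 2 * z by apply: lt_le_trans Wz.
  by rewrite pmulr_rgt0// mulr_gt0.
rewrite -(ler_pM2r E0).
apply: (@le_trans _ _ ((4 * C + 1) * N)); first by lra.
apply: (@le_trans _ _ ((4 * C + 1) * (8 * E * Y ^+ 6 * z))); first by rewrite ler_pM2l//; lra.
have -> : (4 * C + 1) * (8 * E * Y ^+ 6 * z) = (32 * C + 8) * (Y ^+ 6 * z * E) by ring.
have -> : Y ^+ 7 * z * E = Y * (Y ^+ 6 * z * E) by ring.
by rewrite ler_pM2r ?mulr_gt0//; lra.
Qed.

End GlobalArgument.

(** * Density of A and B, and comparison of the two logarithmic scales *)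

Section Density.
Context {R : realType}.

Lemma upper_density_primes_frequently (A B : set nat) : (0 < upper_density_primes R A B)%E ->
  exists2 d : R, 0 < d & forall N0, exists2 N, (N0 <= N)%N &
    d <= (minn (count_upto A N) (count_upto B N))%:R / (count_upto primes_set N)%:R.
Proof.
rewrite /upper_density_primes; set u := fun N : nat => _ => h.
have [d d0 dl] : exists2 d : R, 0 < d & (d%:E < limn_esup u)%E.
  case: (limn_esup u) h => [x|_|//]; last by exists 1; rewrite ?ltry.
  rewrite lte_fin => x0; exists (x / 2); first by rewrite divr_gt0.
  by rewrite lte_fin; lra.
exists d => // N0; apply: contrapT => nex.
move: dl; rewrite ltNge => /negP; apply; apply: ge_ereal_inf.
exists (ereal_sup [set u n | n in [set n | (N0 <= n)%N]]).
  by exists [set n | (N0 <= n)%N] => //; exact: nbhs_infty_ge.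
apply: ge_ereal_sup => _ [n /= nN <-]; rewrite /u lee_fin leNgt; apply/negP => h'.
by apply: nex; exists n => //; exact: ltW.
Qed.

Lemma dense_in_primes (A B : set nat) : (0 < upper_density_primes R A B)%E ->
  exists2 c : R, 0 < c & forall N0, exists N, [/\ (N0 <= N)%N,
    c * N%:R <= (count_upto A N)%:R * ln N%:R & c * N%:R <= (count_upto B N)%:R * ln N%:R].
Proof.
move=> /upper_density_primes_frequently[d d0 hd].
have [c c0 hc] := chebyshev_lower R.
exists (d * c) => [|N0]; first exact: mulr_gt0.
have [N] := hd (maxn 2 N0); rewrite geq_max => /andP[N2 NN0] dN.
exists N; set p := (count_upto primes_set N)%:R in dN.
have p0 : 0 < p.
  rewrite lt_neqAle ler0n andbT eq_sym; apply/eqP => p0.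
  by move: dN; rewrite p0 invr0 mulr0; lra.
rewrite ler_pdivlMr// in dN.
have l0 : 0 <= ln N%:R :> R by rewrite ln_ge0// ler1n ltnW.
have key n : (minn (count_upto A N) (count_upto B N) <= n)%N -> d * c * N%:R <= n%:R * ln N%:R.
  rewrite -(ler_nat R) => /(le_trans dN) h.
  rewrite -mulrA; apply: (le_trans (ler_wpM2l (ltW d0) (hc N N2))).
  by rewrite mulrA ler_wpM2r.
by split=> //; apply: key; [exact: geq_minl|exact: geq_minr].
Qed.

Lemma dense_block_size (X : seq nat) (N W lo : nat) (Y : R) : (0 < W)%N -> (W <= N)%N ->
  uniq X -> all (fun x => (x <= N)%N) X -> 0 < Y -> N%:R <= Y ^+ 2 * (size X)%:R ->
  lo%:R * (2 * Y ^+ 2) <= N%:R -> exists a,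
  W%:R <= 4 * Y ^+ 2 * (size [seq x <- X | (lo <= x)%N && (x %/ W == a)%N])%:R.
Proof.
move=> W0 WN uX XN Y0 NX loN.
have [a ha] := dense_block lo W0 uX XN; exists a.
set z := size [seq x <- X | _] in ha *; rewrite leq_subLR -(ler_nat R) natrD natrM in ha.
set K := (N %/ W)%N.+1%:R in ha.
have KW : K * W%:R <= 2 * N%:R.
  rewrite /K -natrM mulSn -natrM ler_nat mul2n -addnn.
  by rewrite leq_add// leq_trunc_div.
have N0 : 0 < N%:R :> R by rewrite ltr0n (leq_trans W0).
have y20 : 0 < Y ^+ 2 by rewrite exprn_gt0.
have h1 : Y ^+ 2 * (size X)%:R <= Y ^+ 2 * (lo%:R + K * z%:R) by rewrite ler_pM2l.
have h2 : N%:R <= 2 * Y ^+ 2 * z%:R * K by lra.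
rewrite -(ler_pM2r N0).
have h3 : N%:R * W%:R <= 2 * Y ^+ 2 * z%:R * K * W%:R by rewrite ler_wpM2r.
have h4 : 2 * Y ^+ 2 * z%:R * (K * W%:R) <= 2 * Y ^+ 2 * z%:R * (2 * N%:R).
  by rewrite ler_wpM2l// !mulr_ge0// ltW.
lra.
Qed.

Lemma count_lower (c Y l n N lN : R) : 0 <= n -> 0 < c -> 0 < Y -> 2 * l <= c * Y ->
  lN <= l * (2 * Y) -> c * N <= n * lN -> N <= Y ^+ 2 * n.
Proof.
move=> n0 c0 Y0 lY lNY h; rewrite -(ler_pM2l c0); apply: (le_trans h).
apply: (le_trans (ler_wpM2l n0 lNY)).
have -> : n * (l * (2 * Y)) = (n * Y) * (2 * l) by ring.
have -> : c * (Y ^+ 2 * n) = (n * Y) * (c * Y) by ring.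
by rewrite ler_wpM2l// mulr_ge0// ltW.
Qed.

(** If lM^2 < Y, then al Y^6 <= alt lM^6 <= 2 N Y^3, so al <= 2 N / Y^3, which is too small for N <=
    4 Y^2 al. The exponent 6 leaves exactly one spare factor Y. *)
Lemma logs_comparable (al alt N lM Y : R) : 8 < Y -> 0 < lM -> 0 < al ->
  al / lM ^+ 6 <= alt / Y ^+ 6 -> alt <= 2 * N -> N <= 4 * Y ^+ 2 * al -> Y <= lM ^+ 2.
Proof.
move=> Y8 l0 al0 h altN Nal; have Y0 : 0 < Y by lra.
rewrite leNgt; apply/negP => lY.
have Yp e : 0 < Y ^+ e by rewrite exprn_gt0.
have l6 : lM ^+ 6 <= Y ^+ 3.
  rewrite (_ : 6%N = (2 * 3)%N)// exprM; apply: lerXn2r; rewrite ?nnegrE ?exprn_ge0 ?(ltW l0) ?(ltW Y0)//.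
  exact: ltW.
rewrite ler_pdivrMr ?exprn_gt0// in h.
have h1 : al * Y ^+ 6 <= alt * lM ^+ 6.
  by rewrite -ler_pdivlMr//; move: h; rewrite mulrAC.
have N0 : 0 < N.
  have : 0 < alt * lM ^+ 6 by apply: lt_le_trans h1; rewrite mulr_gt0.
  by rewrite pmulr_lgt0 ?exprn_gt0// => a0; lra.
have h2 : alt * lM ^+ 6 <= 2 * N * Y ^+ 3.
  by apply: ler_pM => //; rewrite ?exprn_ge0 ?(ltW l0)//; rewrite -(pmulr_lge0 _ (exprn_gt0 6 l0)); apply: le_trans h1; rewrite mulr_ge0// ltW.
have h3 : al * Y ^+ 3 <= 2 * N.
  rewrite -(ler_pM2r (Yp 3%N)) -mulrA -exprD; exact: le_trans h2.
have h4 : N * Y <= 4 * (2 * N).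
  apply: (@le_trans _ _ (4 * (al * Y ^+ 3))); last by rewrite ler_pM2l.
  have -> : 4 * (al * Y ^+ 3) = 4 * Y ^+ 2 * al * Y by ring.
  by rewrite ler_pM2r.
have : N * 8 < N * Y by rewrite ltr_pM2l.
lra.
Qed.

End Density.

(** * Assembly of the argument *)

Section SumsetFloor.
Context {R : realType}.

Lemma sum_extent (N y u v : R) : N <= 4 * y * u -> u <= N -> N <= 4 * y * v -> v <= N ->
  N <= 2 * y * (u + v) /\ u + v <= 2 * N.
Proof. by move=> h1 h2 h3 h4; split; lra. Qed.

Lemma block_base (Y E N T : R) : 1000 <= Y -> Y <= E -> Y ^+ 6 * E <= 2 * N ->
  N <= 2 * Y ^+ 2 * T -> Y <= T.
Proof.
move=> Y1000 YE NE NT; have Y0 : 0 < Y by lra.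
have y20 : 0 < 4 * Y ^+ 2 by rewrite mulr_gt0// exprn_gt0.
rewrite -(ler_pM2l y20); apply: (@le_trans _ _ (Y ^+ 6 * E)); last by lra.
have -> : Y ^+ 6 * E = Y ^+ 2 * (Y ^+ 4 * E) by ring.
have -> : 4 * Y ^+ 2 * Y = Y ^+ 2 * (4 * Y) by ring.
rewrite ler_pM2l ?exprn_gt0//; apply: ler_pM; [by []|exact: ltW| |by []].
have : Y <= Y ^+ 4 by rewrite (exprS _ 3) ler_peMr ?exprn_ege1 ?(ltW Y0)//; lra.
lra.
Qed.

Lemma block_extent (s : seq nat) (N W lo i : nat) (Y : R) : 0 < Y -> 0 < W%:R :> R ->
  all (fun x => (x <= N)%N) s -> N%:R + 4 * Y ^+ 2 * W%:R <= 4 * Y ^+ 2 * lo%:R ->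
  W%:R <= 4 * Y ^+ 2 * (size [seq x <- s | (lo <= x)%N && (x %/ W == i)%N])%:R ->
  N%:R <= 4 * Y ^+ 2 * (i * W)%N%:R /\ (i * W)%N%:R <= N%:R :> R.
Proof.
move=> Y0 W0r /allP sN loW Wz.
have W0 : (0 < W)%N by rewrite -(ltr0n R).
have y20 : 0 < 4 * Y ^+ 2 by rewrite mulr_gt0// exprn_gt0.
have : has predT [seq x <- s | (lo <= x)%N && (x %/ W == i)%N].
  rewrite has_predT -(ltr0n R) -(pmulr_rgt0 _ y20).
  exact: lt_le_trans Wz.
move=> /hasP[x]; rewrite mem_filter => /andP[/andP[lox /eqP xi] xs] _.
have xN := sN x xs.
split; last by rewrite ler_nat -xi (leq_trans (leq_trunc_div _ _)).
have loi : lo%:R <= (i * W)%N%:R + W%:R :> R.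
  rewrite -natrD ler_nat -mulSnr -xi; apply: (leq_trans lox).
  by rewrite ltnW// ltn_ceil.
have : 4 * Y ^+ 2 * lo%:R <= 4 * Y ^+ 2 * ((i * W)%N%:R + W%:R) by rewrite ler_pM2l.
lra.
Qed.

Lemma window_length (M : nat) (E : R) : 0 < E -> E <= M%:R ->
  exists L : nat, [/\ (0 < L)%N, L%:R * E <= M%:R & M%:R <= 2 * E * L%:R].
Proof.
move=> E0 EM.
have ME : 1 <= M%:R / E by rewrite ler_pdivlMr// mul1r.
have /andP[L1 L2] := truncn_itv (le_trans ler01 ME).
set L := Num.truncn _ in L1 L2; rewrite -natr1 in L2.
have L0 : (0 < L)%N by rewrite -(ltr_nat R); lra.
have L1r : 1 <= L%:R :> R by rewrite ler1n.
exists L; split=> //; first by rewrite -ler_pdivlMr.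
rewrite ltr_pdivrMr// in L2.
have : 1 * E <= L%:R * E by rewrite ler_pM2r.
lra.
Qed.

Lemma window_increments (al da : R -> R) (a C E Y : R) (M : nat) :
  (forall x, a < x -> is_derive (x : R) (1 : R) al (da x)) ->
  (forall x, a < x -> 0 < da x) -> (forall x, a < x -> 0 < al x) ->
  (forall x, a < x -> x * da x <= C * al x) -> (forall x, a < x -> al x <= x * ln x * da x) ->
  1 <= C -> a < M%:R -> 2 <= M%:R :> R -> 2 * C <= E -> E <= M%:R -> ln M%:R <= Y ->
  exists L : nat, [/\ (0 < L)%N, L%:R * E <= M%:R, M%:R <= 2 * E * L%:R,
    (al (M%:R + L%:R) - al M%:R) * M%:R <= 2 * C * L%:R * al M%:R &
    al M%:R * L%:R <= 4 * M%:R * Y * (al (M%:R + L%:R) - al M%:R) /\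
    forall n, (n < L)%N -> 0 <= al (M%:R + n%:R) - al M%:R <= al (M%:R + L%:R) - al M%:R].
Proof.
move=> dd dd0 ddal ddC ddl C1 aM M2 CE EM lnMY.
have E0 : 0 < E by lra.
have M0 : 0 < M%:R :> R by lra.
have [L [L0 LE ML]] := window_length E0 EM.
have L0r : 0 < L%:R :> R by rewrite ltr0n.
have mono u v : M%:R <= u -> u <= v -> al u <= al v.
  move=> mu; apply: (@le_of_derive_ge0 R al da a dd) => [x /dd0/ltW//|].
  exact: lt_le_trans mu.
have CLM : 2 * C * L%:R <= M%:R.
  by apply: le_trans LE; rewrite mulrC ler_pM2l.
have LM : L%:R <= M%:R :> R by apply: le_trans LE; rewrite ler_peMr//; lra.
have C0 : 0 <= C by lra.
have [_ DM] := increment_upper dd dd0 ddal ddC C0 aM M0 L0r CLM.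
have D0 : 0 <= al (M%:R + L%:R) - al M%:R by rewrite subr_ge0; apply: mono; lra.
exists L; split=> //; split=> [|n nL].
  apply: (le_trans (increment_lower dd dd0 ddl aM M2 L0r LM)).
  by apply: ler_wpM2r => //; rewrite ler_pM2l//; lra.
have n0 : 0 <= n%:R :> R by [].
have nLr : n%:R <= L%:R :> R by rewrite ler_nat ltnW.
by rewrite subr_ge0 lerD2r; apply/andP; split; apply: mono; lra.
Qed.

(** The sum of the block bases lies between al M and al (M + 1), so sums from the blocks exceed al M
    by little more than 2W at most; the bound on Delta makes room for them. *)
Lemma solve_in_window (al : R -> R) (M L W ia ib : nat) (Y Delta : R) (ZA ZB : seq nat) :
  1000 <= Y -> (0 < L)%N -> (0 < W)%N -> 0 < al M%:R ->
  (forall n, (n < L)%N -> 0 <= al (M%:R + n%:R) - al M%:R <= Delta) ->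
  al M%:R <= ((ia + ib) * W)%N%:R -> ((ia + ib) * W)%N%:R < al (M%:R + 1) ->
  2 * W%:R + (al (M%:R + 1) - al M%:R) <= Delta ->
  Delta + 3 <= Y ^+ 7 * (size ZA)%:R -> Delta + 3 <= Y ^+ 7 * (size ZB)%:R ->
  uniq ZA -> uniq ZB -> (forall x, x \in ZA -> (x %/ W)%N = ia) ->
  (forall y, y \in ZB -> (y %/ W)%N = ib) ->
  (forall (P : R) (r : nat) c, `|P - Delta| <= 3 -> (0 < r)%N -> r%:R <= Y ^+ 18 * P -> Y ^+ 9 *
    `|\sum_(n < L) cos (2 * pi * (r%:R / P * al (M%:R + n%:R)) + c)| <= L%:R) ->
  exists x y n, [/\ x \in ZA, y \in ZB & (x + y)%N%:Z = Num.floor (al (M + n)%N%:R)].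
Proof.
move=> Y1000 L0 W0 alM0 incr alM Mal WD PA PB uZA uZB ZAi ZBi ES.
have D0 : 0 <= Delta by have /andP[h1 h2] := incr 0%N L0; exact: le_trans h2.
set T := ((ia + ib) * W)%N in alM Mal.
have /andP[D1 D2] := truncn_itv D0.
pose P := (Num.truncn Delta + 3)%N.
have Pr : P%:R = (Num.truncn Delta)%:R + 3 :> R by rewrite /P natrD.
have D2' : Delta < (Num.truncn Delta)%:R + 1 by rewrite natr1.
have /andP[b1 b2] := truncn_itv (ltW alM0).
set b0 := Num.truncn (al M%:R) in b1 b2.
have b2' : al M%:R < b0%:R + 1 by rewrite natr1.
have [t Tt] : exists t, T = (t + b0)%N.
  by exists (T - b0)%N; rewrite subnK// -(ler_nat R); exact: le_trans alM.
have tr : T%:R = t%:R + b0%:R :> R by rewrite Tt natrD.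
have ESP r c' : (0 < r)%N -> r%:R <= Y ^+ 18 * P%:R -> Y ^+ 9 *
    `|\sum_(n < L) cos (2 * pi * (r%:R / P%:R * al (M%:R + n%:R)) + c')| <= L%:R.
  move=> r0 rP; apply: ES => //.
  by rewrite Pr ler_norml; apply/andP; split; lra.
(* The base T of the sums differs from floor (al M) by t; adding t to the residues from one block
   makes x' + y' + floor (al M) equal to x + y. *)
pose A' := [seq (x %% W)%N | x <- ZA]; pose B' := [seq (y %% W + t)%N | y <- ZB].
have eA x : x \in ZA -> x = (ia * W + x %% W)%N by move=> /ZAi <-; exact: divn_eq.
have eB y : y \in ZB -> y = (ib * W + y %% W)%N by move=> /ZBi <-; exact: divn_eq.
have uA' : uniq A'.
  by rewrite map_inj_in_uniq// => x y /eA ex /eA ey e; rewrite ex ey e.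
have uB' : uniq B'.
  by rewrite map_inj_in_uniq// => x y /eB ex /eB ey /addIn e; rewrite ex ey e.
have AB' x y : x \in A' -> y \in B' -> (x + y < P)%N.
  move=> /mapP[x' _ ->] /mapP[y' _ ->]; rewrite -(ltr_nat R) !natrD.
  have h1 : (x' %% W)%N%:R <= W%:R :> R by rewrite ler_nat ltnW// ltn_mod.
  have h2 : (y' %% W)%N%:R <= W%:R :> R by rewrite ler_nat ltnW// ltn_mod.
  lra.
have PA' : P%:R <= Y ^+ 7 * (size A')%:R by rewrite size_map Pr; lra.
have PB' : P%:R <= Y ^+ 7 * (size B')%:R by rewrite size_map Pr; lra.
have [n [x' [y' [nL xA' yB' e]]]] :=
  find_solution Y1000 L0 (ltW alM0) incr (erefl P) ESP uA' uB' AB' PA' PB'.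
case/mapP: xA' => x xZ xE; case/mapP: yB' => y yZ yE.
exists x, y, n; split=> //; rewrite natrD -e; congr Posz.
rewrite xE yE -/b0 {1}(eA x xZ) {1}(eB y yZ).
have -> : (x %% W + (y %% W + t) + b0 = x %% W + y %% W + (t + b0))%N by rewrite !addnA.
by rewrite -Tt /T mulnDl addnACA addnC.
Qed.

Theorem sumset_meets_floor (al da : R -> R) (l : nat) (C : R) (A B : set nat) (c : R) (K : nat) :
  1 <= C ->
  (\forall x \near +oo, is_derive (x : R) (1 : R) al (da x)) ->
  (\forall x \near +oo, 0 < da x) -> (\forall x \near +oo, 0 < al x) ->
  (\forall x \near +oo, x * da x <= C * al x) ->
  (\forall x \near +oo, al x <= x * ln x * da x) ->
  (\forall x \near +oo, al x <= x ^+ l) ->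
  (forall m, \forall x \near +oo, ln x ^+ m <= al x) ->
  (exists a, forall x y, a < x -> x <= y -> al x / ln x ^+ 6 <= al y / ln y ^+ 6) ->
  (exists C0 (a : R), (0 < C0)%N /\ forall (M L r : nat) (Y P c : R),
    a < M%:R -> ln M%:R <= Y -> Y <= ln M%:R ^+ 2 -> M%:R <= 2 * Y ^+ C0 * L%:R ->
    L%:R * Y ^+ C0 <= M%:R -> `|P - (al (M%:R + L%:R) - al M%:R)| <= 3 ->
    (0 < r)%N -> r%:R <= Y ^+ 18 * P ->
    Y ^+ 9 * `|\sum_(n < L) cos (2 * pi * (r%:R / P * al (M%:R + n%:R)) + c)| <= L%:R) ->
  0 < c -> (forall N0, exists N, [/\ (N0 <= N)%N,
    c * N%:R <= (count_upto A N)%:R * ln N%:R & c * N%:R <= (count_upto B N)%:R * ln N%:R]) ->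
  exists x y n : nat, [/\ A x /\ B y, (K <= x)%N, (K <= y)%N, (1 <= n)%N &
    (x + y)%N%:Z = Num.floor (al n%:R)].
Proof.
move=> C1 nd nda nal ndaC nalda nl nlog [a6 h6] [C0 [aE [C00 ES]]] c0 dens.
have /near_pinftyP[a ha] : \forall x \near +oo,
   [/\ is_derive (x : R) (1 : R) al (da x), 0 < da x, 0 < al x & x * da x <= C * al x] /\
   [/\ al x <= x * ln x * da x, al x <= x ^+ l, ln x ^+ (6 + C0) <= al x,
      1 * ln x ^+ (2 * (3 + C0)) <= x & (2 <= x /\ 1 <= ln x)].
  near=> x; split; split; try by near: x.
  - near: x; exact: near_lnX_le.
  - by split; near: x; [exact: nbhs_pinfty_ge|exact: near_ln_ge].
set a' := Num.max (Num.max a a6) (Num.max aE (2 * C)).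
have [m0 m0a] : exists m0 : nat, a' < m0%:R.
  exists (Num.truncn `|a'|).+1; apply: le_lt_trans (ler_norm _) _.
  by have /andP[] := truncn_itv (normr_ge0 a').
have aM x : m0%:R <= x -> [/\ a < x, a6 < x, aE < x & 2 * C < x].
  move=> /(lt_le_trans m0a); rewrite /a' !gt_max => /andP[/andP[-> ->] /andP[-> ->]].
  by split.
(* Every lower bound required of Y is gathered here: the numerical estimates, al m0 <= Y for the
   second crossing, x, y >= K, and the density of A and B. *)
pose Y0 : R := 1000 + 64 * C + `|al m0%:R| + K%:R + 2 * l%:R / c.
have [m1 [m01 m1Y]] : exists m1 : nat, (m0 <= m1)%N /\ forall x, m1%:R <= x -> Y0 <= ln x.
  have /near_pinftyP[b hb] := near_ln_ge Y0.
  exists (maxn m0 (Num.truncn `|b|).+1); split; first exact: leq_maxl.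
  move=> x mx; apply: hb; apply: lt_le_trans mx; apply: le_lt_trans (ler_norm _) _.
  have /andP[_ h] := truncn_itv (normr_ge0 b); apply: (lt_le_trans h).
  by rewrite ler_nat leq_maxr.
(* N is so large that al m1 <= 2N, which places the crossing of 2N beyond m1. *)
have [N [NN0 dA dB]] := dens (Num.truncn (al m1%:R)).+2.
have mono u v : m0%:R <= u -> u <= v -> al u <= al v.
  move=> mu; have [au _ _ _] := aM u mu.
  apply: (@le_of_derive_ge0 R al da a) => // x ax; first by have [[]] := ha x ax.
  by have [[_ /ltW]] := ha x ax.
have unb (T : R) : \forall x \near +oo, T < al x.
  near=> x; have h1 : ln x ^+ 1 <= al x by near: x.
  have h2 : T + 1 <= ln x by near: x; exact: near_ln_ge.
  by rewrite expr1 in h1; lra.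
have m1a : m0%:R <= m1%:R :> R by rewrite ler_nat.
have alm1 : al m1%:R <= (2 * N)%N%:R.
  have [am _ _ _] := aM _ m1a.
  have [[_ _ p _] _] := ha _ am.
  have /andP[_ h] := truncn_itv (ltW p).
  by apply: (le_trans (ltW h)); rewrite ler_nat (leq_trans (ltnW NN0))// leq_pmull.
have [Mt [m1Mt alMt Mtal]] := crossing (unb (2 * N)%N%:R) alm1.
have m1Mtr : m1%:R <= Mt%:R :> R by rewrite ler_nat.
have m0Mt : m0%:R <= Mt%:R :> R by exact: le_trans m1Mtr.
(* Sums of two block bases are at most 2N, so the later crossing M satisfies M <= Mt, and ln M <= Y
   holds although M is not yet known. *)
pose Y := ln Mt%:R : R.
have YY0 : Y0 <= Y by exact: m1Y.
have al0n : 0 <= `|al m0%:R| by [].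
have K0 : 0 <= K%:R :> R by [].
have lc0 : 0 <= 2 * l%:R / c by rewrite divr_ge0 ?mulr_ge0// ltW.
have Y1000 : 1000 + 64 * C <= Y by rewrite /Y0 in YY0; lra.
have YK : K%:R <= Y by rewrite /Y0 in YY0; lra.
have Yal : al m0%:R <= Y.
  by have := ler_norm (al m0%:R); rewrite /Y0 in YY0; lra.
have Ylc : 2 * l%:R <= c * Y.
  by rewrite [leRHS]mulrC -ler_pdivrMr//; rewrite /Y0 in YY0; lra.
have CY : 2 * C <= Y by lra.
have Y8 : 8 < Y by lra.
clear Y0 m1Y YY0; have Y0p : 0 < Y by lra.
have Y1 : 1 <= Y by lra.
have Yp e : 0 < Y ^+ e by rewrite exprn_gt0.
have [aMt a6Mt _ _] := aM _ m0Mt.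
have [[_ _ alMt0 _] [_ _ logMt _ [Mt2 _]]] := ha _ aMt.
rewrite natrM in alMt Mtal.
pose E := Y ^+ C0.
have E0 : 0 < E by exact: Yp.
have YE : Y <= E.
  by rewrite /E -(prednK C00) exprS ler_peMr ?exprn_ege1 ?(ltW Y0p)//; lra.
have CE : 2 * C <= E := le_trans CY YE.
have NE : Y ^+ 6 * E <= 2 * N%:R.
  by rewrite -exprD; apply: le_trans alMt.
have Y1000' : 1000 <= Y by lra.
have [W [lo [[W0 WN] NW WNr loN [loW Ylo]]]] := block_parameters Y1000' YE NE.
have W0r : 0 < W%:R :> R by rewrite ltr0n.
have N0r : 0 < N%:R :> R by rewrite ltr0n (leq_trans W0).
have lnN : ln N%:R <= l%:R * (2 * Y).
  have aMt1 : a < Mt%:R + 1 by apply: lt_trans aMt _; rewrite ltrDl.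
  have [_ [_ up _ _ _]] := ha _ aMt1.
  have sq : Mt%:R + 1 <= Mt%:R ^+ 2 :> R by clear -Mt2; rewrite expr2; nra.
  have : N%:R <= (Mt%:R ^+ 2) ^+ l :> R.
    have hl : (Mt%:R + 1) ^+ l <= (Mt%:R ^+ 2) ^+ l :> R.
      by apply: lerXn2r; rewrite ?nnegrE ?exprn_ge0//; lra.
    apply: le_trans hl; apply: le_trans up; apply: le_trans (ltW Mtal).
    by rewrite ler_peMl// ler1n.
  have p : 0 < Mt%:R :> R by exact: lt_le_trans Mt2.
  rewrite -(@ler_ln R) ?posrE ?exprn_gt0// lnXn ?exprn_gt0// lnXn//.
  rewrite -[_ *+ l]mulr_natl -[_ *+ 2]mulr_natl.
  by [].
have [sA [uA cA memA]] := count_upto_seq A N.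
have [sB [uB cB memB]] := count_upto_seq B N.
rewrite -cA in dA; rewrite -cB in dB.
have NA := count_lower (ler0n _ _) c0 Y0p Ylc lnN dA.
have NB := count_lower (ler0n _ _) c0 Y0p Ylc lnN dB.
have allA : all (fun x => (x <= N)%N) sA by apply/allP => x /memA[_ /andP[]].
have allB : all (fun x => (x <= N)%N) sB by apply/allP => x /memB[_ /andP[]].
have [ia WA] := dense_block_size W0 WN uA allA Y0p NA loN.
have [ib WB] := dense_block_size W0 WN uB allB Y0p NB loN.
have [NiA iAN] := block_extent Y0p W0r allA loW WA.
have [NiB iBN] := block_extent Y0p W0r allB loW WB.
set ZA := [seq x <- sA | _] in WA; set ZB := [seq x <- sB | _] in WB.
pose T := ((ia + ib) * W)%N.
have Tr : T%:R = (ia * W)%N%:R + (ib * W)%N%:R :> R by rewrite /T mulnDl natrD.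
have [NT TN] : N%:R <= 2 * Y ^+ 2 * T%:R /\ T%:R <= 2 * N%:R :> R.
  by rewrite Tr; exact: sum_extent.
have alT : al m0%:R <= T%:R by exact: le_trans Yal (block_base Y1000' YE NE NT).
have [M [m0M alM Mal]] := crossing (unb T%:R) alT.
have m0Mr : m0%:R <= M%:R :> R by rewrite ler_nat.
have [aMM a6M aEM CM] := aM _ m0Mr.
have [[_ _ alM0 _] [_ _ _ powM [M2 lnM1]]] := ha _ aMM.
have M0 : 0 < M%:R :> R := lt_le_trans (ltr0Sn R 1) M2.
have MMt : (M <= Mt)%N.
  rewrite leqNgt; apply/negP => h.
  have : al (Mt%:R + 1) <= al M%:R.
    by apply: mono; [rewrite (le_trans m0Mt)// lerDl|rewrite natr1 ler_nat].
  by rewrite leNgt (le_lt_trans (le_trans alM TN) Mtal).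
have dd x : a < x -> is_derive (x : R) (1 : R) al (da x) by move=> /ha[[]].
have dd0 x : a < x -> 0 < da x by move=> /ha[[]].
have ddal x : a < x -> 0 < al x by move=> /ha[[]].
have ddC x : a < x -> x * da x <= C * al x by move=> /ha[[]].
have ddl x : a < x -> al x <= x * ln x * da x by move=> /ha[_ []].
have C0p : 0 <= C := le_trans ler01 C1.
have C2M : 2 * C * 1 <= M%:R by rewrite mulr1 ltW.
have [al2 dM] := increment_upper dd dd0 ddal ddC C0p aMM M0 ltr01 C2M.
have Nal : N%:R <= 4 * Y ^+ 2 * al M%:R.
  apply: (le_trans NT); have -> : 4 * Y ^+ 2 * al M%:R = 2 * Y ^+ 2 * (2 * al M%:R) by ring.
  by rewrite ler_pM2l ?mulr_gt0//; exact: le_trans (ltW Mal) al2.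
have MMtr : M%:R <= Mt%:R :> R by rewrite ler_nat.
have lnMY : ln M%:R <= Y by rewrite /Y ler_ln ?posrE// (lt_le_trans M0).
have lM0 : 0 < ln M%:R :> R := lt_le_trans ltr01 lnM1.
have YlnM : Y <= ln M%:R ^+ 2.
  exact: logs_comparable Y8 lM0 alM0 (h6 M%:R Mt%:R a6M MMtr) alMt Nal.
have YM : Y ^+ 3 * E <= M%:R.
  rewrite -exprD; apply: le_trans powM; rewrite mul1r exprM.
  by apply: lerXn2r; rewrite // nnegrE ?exprn_ge0// ltW.
have EM : E <= M%:R by apply: le_trans YM; rewrite ler_peMl ?exprn_ege1 ?(ltW E0) ?Y1.
have [L [L0 LE ML DM [alL incr]]] := window_increments dd dd0 ddal ddC ddl C1 aMM M2 CE EM lnMY.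
have L0r : 0 < L%:R :> R by rewrite ltr0n.
have dM' : (al (M%:R + 1) - al M%:R) * M%:R <= 2 * C * al M%:R by rewrite mulr1 in dM.
have alM2N : al M%:R <= 2 * N%:R := le_trans alM TN.
have [WD PA] := window_numerics Y1000 C1 YE W0r M0 L0r alM0 NW WNr Nal alM2N alL ML DM LE dM' YM NE WA.
have [_ PB] := window_numerics Y1000 C1 YE W0r M0 L0r alM0 NW WNr Nal alM2N alL ML DM LE dM' YM NE WB.
have inZ s i x : x \in [seq x <- s | (lo <= x)%N && (x %/ W == i)%N] ->
    [/\ x \in s, (lo <= x)%N & (x %/ W)%N = i].
  by rewrite mem_filter => /andP[/andP[lox /eqP xi] xs].
have [|||||x [y [n [xZ yZ e]]]] :=
    solve_in_window Y1000' L0 W0 alM0 incr alM Mal WD PA PB _ _ _ _ _.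
- exact: filter_uniq.
- exact: filter_uniq.
- by move=> x /inZ[].
- by move=> x /inZ[].
- by move=> P r c' PL r0 rP; apply: ES.
have [xs lox _] := inZ _ _ _ xZ; have [ys loy _] := inZ _ _ _ yZ.
have loK : (K <= lo)%N by rewrite -(ler_nat R); exact: le_trans Ylo.
exists x, y, (M + n)%N; split=> //.
- by split; [have [] := (memA x).1 xs|have [] := (memB y).1 ys].
- exact: leq_trans lox.
- exact: leq_trans loy.
- by rewrite addn_gt0 -(ltr0n R) M0.
Unshelve. all: by end_near. Qed.

End SumsetFloor.

(** * Integer exponents in place of real ones *)

Section HardyHypotheses.
Context {R : realType}.

Lemma sub_polynomial_upper (alpha : R -> R) (l : R) :
  (\forall x \near +oo, 0 < alpha x) -> 0 < l ->
  alpha x / x `^ l @[x --> +oo] --> (0 : R) ->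
  exists n : nat, \forall x \near +oo, alpha x <= x ^+ n.
Proof.
move=> apos l0 hl; exists (Num.truncn l).+1.
have h : \forall x \near +oo, `|alpha x / x `^ l| < 1.
  exact: (@cvgr0_norm_lt R _ R _ _ (fun x => alpha x / x `^ l) hl 1 ltr01).
near=> x.
have x1 : 1 < x by near: x; exact: near_pinfty_gt.
have x0 : 0 < x by lra.
have ax : 0 < alpha x by near: x.
have : `|alpha x / x `^ l| < 1 by near: x.
rewrite gtr0_norm ?divr_gt0 ?powR_gt0// ltr_pdivrMr ?powR_gt0// mul1r => /ltW/le_trans; apply.
rewrite -powR_mulrn ?(ltW x0)//; apply: ler_powR; first exact: ltW.
by have /andP[_ /ltW] := truncn_itv (ltW l0).
Unshelve. all: by end_near. Qed.

Lemma polynomial_gap (alpha : R -> R) (p : {poly R}) :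
  (forall (m : R) (p : {poly R}), 0 < m ->
     `|alpha x - p.[x]| / (ln x) `^ m @[x --> +oo] --> +oo) ->
  forall m, \forall x \near +oo, ln x ^+ m <= `|alpha x - p.[x]|.
Proof.
move=> h m; have /cvgryPge/(_ 1) h1 := h m.+1%:R p (ltr0Sn _ _).
near=> x.
have l1 : 1 <= ln x by near: x; exact: near_ln_ge.
have l0 : 0 < ln x by lra.
have : 1 <= `|alpha x - p.[x]| / (ln x) `^ m.+1%:R by near: x.
rewrite powR_mulrn ?(ltW l0)// ler_pdivlMr ?exprn_gt0// mul1r; apply: le_trans.
by rewrite ler_weXn2l.
Unshelve. all: by end_near. Qed.

End HardyHypotheses.

Theorem theorem1p19 (R : realType) (alpha : R -> R) (A B : set nat)
  (halpha : sub_polynomial alpha)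
  (halpha_pos : \forall x \near +oo, 0 < alpha x)
  (halpha_log : forall (m : R) (p : {poly R}), 0 < m ->
     `|alpha x - p.[x]| / (ln x) `^ m @[x --> +oo] --> +oo)
  (hA : A `<=` primes_set) (hB : B `<=` primes_set)
  (hAB : (0 < upper_density_primes R A B)%E) :
  forall K : nat, exists x y n : nat,
    [/\ A x /\ B y, (K <= x)%N, (K <= y)%N, (1 <= n)%N &
        (x + y)%N%:Z = Num.floor (alpha n%:R)].
Proof.
move=> K; case: halpha => [[H hH Halpha] [l' l'0 hl']].
have [l alpha_le] := sub_polynomial_upper halpha_pos l'0 hl'.
have gap p := polynomial_gap p halpha_log.
have [F [hF HF Fid Fln]] := hardy_field_adjoin_id_ln hH.
have Falpha := HF _ Halpha.
have log_le m : \forall x \near +oo, ln x ^+ m <= alpha x.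
  apply: filterS2 (gap 0 m) halpha_pos => x h p.
  by rewrite horner0 subr0 gtr0_norm in h.
have deriv j := iter_derive1_derive hF Falpha j.
have ratio_upper j := derivs_ratio_upper hF Falpha Fid Fln halpha_pos alpha_le gap j.
have log_deriv m := alpha_log_derivative hF Falpha Fid Fln halpha_pos gap m.
(* [alpha] is not assumed increasing; this follows from its growing faster than the logarithm,
   through the case m = 1 of the bound on its logarithmic derivative. *)
have da_pos : \forall x \near +oo, 0 < derivs alpha 1 x.
  near=> x.
  have x1 : 1 < x by near: x; exact: near_pinfty_gt.
  have p : 0 < alpha x by near: x.
  have : 1%:R * alpha x <= x * ln x * derivs alpha 1 x by near: x.
  rewrite mul1r => /(lt_le_trans p); rewrite pmulr_rgt0// mulr_gt0 ?ln_gt0//; lra.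
have [c c0 dens] := dense_in_primes hAB.
apply: (@sumset_meets_floor R alpha (derivs alpha 1) l l.+1%:R A B c K) => //.
- by rewrite ler1n.
- exact: deriv 0%N.
- by apply: filterS3 (ratio_upper 0%N) da_pos halpha_pos => x h p q;
    rewrite /= !gtr0_norm// addn0 in h.
- by apply: filterS (log_deriv 1%N) => x; rewrite mul1r.
- exact: alpha_div_lnX_nondecreasing hF Falpha Fid Fln halpha_pos gap 6.
apply: (@polynomial_growth_sum R (derivs alpha) l).
- exact: deriv.
- move=> j; have [s [s2 s0 _ _]] := iter_derive1_signed hF Falpha Fid Fln gap j.
  by exists s.
- by move=> j; exists (l + j).+1%:R.
- exact: derivs_ratio_lower hF Falpha Fid Fln gap.
- exact: da_pos.
- move=> m; apply: filterS2 (iter_derive1_lower hF Falpha Fid Fln gap 1 m) da_pos => x.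
  by rewrite expr1 => h p; rewrite gtr0_norm in h.
- exact: derivs_last hF Falpha Fid Fln halpha_pos alpha_le gap.
Unshelve. all: by end_near. Qed.
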